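(* Consider the block energy arrival model with energy block length $L$. Let $\varepsilon\in(0,1/2)$ and let $\varepsilon_1>0$, $\varepsilon_2>0$ satisfy $\varepsilon_1+\varepsilon_2=\varepsilon$. Define $\lambda_1=2P\log2+\frac12\log(1+P)$ and $\lambda_2=8P+1$. There exists a constant $\kappa>0$ not depending on $n$ such that for all sufficiently large $n$ and any $L\le n$, one can construct a blockwise best-effort $(n,M,\varepsilon)$-EH code with $$\rho=\frac{\sqrt{(\lambda_1L+\lambda_2\log n)(P+1)(L\,\mathbb{E}[E^2]+3P^2)\log\frac1{\varepsilon_2}}}{P\sqrt{PLn}}=\Theta\!\left(\sqrt{\frac{\max\{\log n,L\}}{n}}\right)$$ and codeword symbol variance $$S=P(1-\rho)=P-\Theta\!\left(\sqrt{\frac{\max\{\log n,L\}}{n}}\right)$$ which satisfies $$\frac1n\log M\ge\frac12\log(1+P)-\sqrt{\frac{(\lambda_1L+\lambda_2\log n)(L\,\mathbb{E}[E^2]+3P^2)\log\frac1{\varepsilon_2}}{LP(P+1)n}}-\sqrt{\frac{P}{(P+1)n}}\,\Phi^{-1}(\varepsilon_1)-\frac{\kappa\max\{\log n,L\}}{n}.$$ In particular, with $$\alpha=\frac{2\rho P}{L\,\mathbb{E}[E^2]+3S^2},\qquad\beta=\frac{\alpha}{1+63\alpha S},\qquad\gamma(\varepsilon_2)=\frac{\log\frac1{\varepsilon_2}}{LP\beta+\frac{L^2\alpha^2\mathbb{E}[E^2]}{2}}=\Theta\!\left(\sqrt{\frac{n}{\max\{\log n,L\}}}\right),$$ the number of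 mismatch events satisfies $\mathbb{P}\{|\mathcal{Q}^{(n)}(W)|\ge\gamma(\varepsilon_2)+1\}\le\varepsilon_2$.
   Context: Logarithms are natural; $\Phi$ is the standard normal cdf; $\mathcal{N}(\mu,\sigma^2)$ denotes the normal law or its density; $\|\cdot\|$ is the Euclidean norm; $\Theta(\cdot)$ is with respect to $n\to\infty$ and denotes a positive quantity. Block energy arrivals. $E$ is a non-negative random variable with $0<P=\mathbb{E}[E]$ and $\mathbb{E}[E^2]<\infty$. Let the natural number $L$ be the energy block length (it may depend on $n$; in this model it is assumed throughout that $L$ remains constant or grows sublinearly in $n$) and $b_\ell=(\ell-1)L$ for $\ell\in\mathbb{N}$. The variables $E_{b_\ell+1}$, $\ell\in\mathbb{N}$, are i.i.d. copies of $E$, and $E_{b_\ell+1}=E_{b_\ell+2}=\dots=E_{b_\ell+L}$ for every $\ell$. Channel and codes. The channel is $Y_k=X_k+Z_k$ with $Z_1,Z_2,\dots$ i.i.d. $\mathcal{N}(0,1)$, independent of messages, codebook and energy. An $(n,M)$-EH code has a message $W$ uniform on $\{1,\dots,M\}$, encoders producing the time-$k$ input from $(W,E_1,\dots,E_k)$ such that almost surely $\sum_{i=1}^kX_i^2\le\sum_{i=1}^kE_i$ for all $k\le n$, and a decoder $\varphi$ producing an estimate of $W$ from the $n$ channel outputs only. It is an $(n,M,\varepsilon)$-EH code if its average probability of decoding error is at most $\varepsilon$. Blockwise best-effort $(n,M)$-EH code with variance $S\in(0,P)$ (i.e. blockwise save-and-transmit with no saving phase). For each message $w$, the codeword $X^n(w)$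 has i.i.d. $\mathcal{N}(0,S)$ entries; codewords are mutually independent and independent of $W$, the energy arrivals and the noise. Let $\bar n=\lceil n/L\rceil$. For $\ell=1,\dots,\bar n$ the transmitted block $f_\ell=(\tilde X_{b_\ell+1}(w),\dots,\tilde X_{\min\{b_\ell+L,n\}}(w))$ is defined recursively: if $\sum_{k=b_\ell+1}^{\min\{b_\ell+L,n\}}X_k(w)^2\le\sum_{k=1}^{b_\ell+1}E_k-\sum_{i=1}^{\ell-1}\|f_i\|^2$, then $f_\ell=(X_{b_\ell+1}(w),\dots,X_{\min\{b_\ell+L,n\}}(w))$; otherwise $f_\ell$ is the all-zero block. The received symbols are $\tilde Y_k(W)=\tilde X_k(W)+Z_k$. For a threshold $\log\xi$ (a free design parameter of the code), the decoder outputs $j$ if $j$ is the unique message with $\sum_{k=1}^n\log\frac{q_{Y|X}(\tilde Y_k(W)|X_k(j))}{p_Y(\tilde Y_k(W))}\ge\log\xi$, where $q_{Y|X}(\cdot|x)=\mathcal{N}(x,1)$ and $p_Y=\mathcal{N}(0,S+1)$; otherwise it outputs a uniformly random message. All probabilities are taken jointly over the random codebook, $W$, the energy arrivals, the noise, and the decoder's randomization. Mismatched positions: $\mathcal{Q}^{(n)}(w)=\{k\in\{1,\dots,n\}:\tilde X_k(w)\ne X_k(w)\}$.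
   Formalization: The final bound is proved for the number of blocks containing a mismatched position, not for the number of mismatched positions |Q^(n)(W)|; the latter fails e.g. for E=P constant and L=⌈√n⌉, where the first block alone yields √n mismatches. For L=1 the two agree. *)

(* Defs.v *)
From HB Require Import structures.
From mathcomp Require Import all_boot all_order all_algebra.
From mathcomp Require Import all_classical all_reals all_analysis.
Import Order.TTheory GRing.Theory Num.Theory.
Import numFieldNormedType.Exports.

Set Implicit Arguments.
Unset Strict Implicit.
Unset Printing Implicit Defensive.

Local Open Scope classical_set_scope.
Local Open Scope ring_scope.

(* Times k and blocks l are numbered from 0, so that time k lies in block
   k %/ L, block l starts at time l * L, and k <= n in 1-based numbering
   is k : 'I_n here. *)

Section probability_notions.
Context {R : realType} {d : measure_display} {T : measurableType d}.
Variable Pr : probability T R.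

Definition has_law (X : {RV Pr >-> R}) (mu : set R -> \bar R) : Prop :=
  forall B : set R, measurable B -> distribution Pr X B = mu B.

Definition uniform_message (M : nat) (W : T -> 'I_M) : Prop :=
  forall w : 'I_M, measurable (W @^-1` [set w]) /\
                   Pr (W @^-1` [set w]) = (M%:R^-1)%:E.

(* Mutual independence of a family of set systems: the product rule over every
   finite subfamily. *)
Definition mutually_independent (I : eqType) (F : I -> set (set T)) : Prop :=
  forall (s : seq I) (B : I -> set T), uniq s ->
    (forall i, i \in s -> F i (B i)) ->
    Pr (\bigcap_(i in [set` s]) B i) = (\prod_(i <- s) Pr (B i))%E.

End probability_notions.

(* The quantile function of N(0,1); the standard normal cdf is a continuous
   increasing bijection onto (0,1), so on (0,1) this is its inverse. *)
Definition Phi {R : realType} (x : R) : R :=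
  fine (normal_prob (0 : R) 1 `]-oo, x]%classic).

Definition Phi_inv {R : realType} (p : R) : R := inf [set x : R | p <= Phi x].

Definition Theta_pos {R : realType} (f g : nat -> R) : Prop :=
  (\forall n \near \oo, 0 < f n) /\ f =Theta_\oo g.

Section codes.
Context {R : realType}.

(* A code whose encoder and decoder share a seed in Theta, here the random
   codebook together with the randomization of the decoder.  The types enforce
   that the input at time k depends on the energy up to time k only and that
   the decoder sees the n outputs only. *)
Record eh_code (Theta : Type) (n M : nat) := EHCode {
  encode : Theta -> 'I_M -> forall k : 'I_n, ('I_k.+1 -> R) -> R ;
  decode : Theta -> ('I_n -> R) -> 'I_M }.

Section performance.
Context {d : measure_display} {T : measurableType d} (Pr : probability T R).
Variables (Theta : Type) (n M : nat) (C : eh_code Theta n M).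
Variables (En Z : nat -> T -> R) (W : T -> 'I_M) (theta : T -> Theta).

Definition channel_input (t : T) (k : 'I_n) : R :=
  encode C (theta t) (W t) (fun i : 'I_k.+1 => En i t).

Definition channel_output (t : T) (k : 'I_n) : R := channel_input t k + Z k t.

Definition energy_feasible : Prop :=
  {ae Pr, forall t, forall k : 'I_n,
     \sum_(i < n | (i <= k)%N) channel_input t i ^+ 2
       <= \sum_(i < n | (i <= k)%N) En i t}.

Definition decoding_error : set T :=
  [set t | decode C (theta t) (channel_output t) != W t].

Definition is_eps_eh_code (eps : R) : Prop :=
  energy_feasible /\ (Pr decoding_error <= eps%:E)%E.

End performance.
End codes.

Section best_effort.
Context {R : realType}.
Variables (L n : nat).

Section encoder.
Variables (x : 'I_n -> R) (e : nat -> R).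

Definition block_energy (l : nat) : R :=
  \sum_(k < n | (k %/ L == l)%N) x k ^+ 2.

(* Energy harvested up to and including the first symbol of block l. *)
Definition harvested (l : nat) : R := \sum_(k < (l * L).+1) e k.

(* Energy spent by the blocks transmitted before block l, see [spentE]. *)
Fixpoint spent (l : nat) : R :=
  if l is m.+1 then
    spent m + (if block_energy m <= harvested m - spent m
               then block_energy m else 0)
  else 0.

Definition be_input (k : 'I_n) : R :=
  let l := (k %/ L)%N in
  if block_energy l <= harvested l - spent l then x k else 0.

Lemma spentE (l : nat) : spent l = \sum_(k < n | (k %/ L < l)%N) be_input k ^+ 2.
Proof.
elim: l => [|l IHl]; first by rewrite big_pred0.
rewrite (bigID (fun k : 'I_n => (k %/ L < l)%N)) /= IHl; congr (_ + _).
  by apply: eq_bigl => k; rewrite ltnS andb_idl// => /ltnW.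
rewrite (eq_bigl (fun k : 'I_n => (k %/ L == l)%N)); last first.
  by move=> k; rewrite ltnS -leqNgt eqn_leq.
rewrite -IHl; case: ifP => fit.
  by apply: eq_bigr => k /eqP kl; rewrite /be_input kl fit.
by rewrite big1// => k /eqP kl; rewrite /be_input kl fit expr0n.
Qed.

End encoder.

Lemma be_input_causal (x : 'I_n -> R) (e e' : nat -> R) (k : 'I_n) :
  (forall i, (i <= k)%N -> e i = e' i) -> be_input x e k = be_input x e' k.
Proof.
move=> ee'.
have hE l : (l <= k %/ L)%N -> harvested e l = harvested e' l.
  move=> lk; apply: eq_bigr => i _; apply: ee'.
  rewrite (leq_trans (ltn_ord i : (i <= l * L)%N))//.
  by rewrite (leq_trans (leq_mul lk (leqnn L)))// leq_divM.
have sE l : (l <= k %/ L)%N -> spent x e l = spent x e' l.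
  by elim: l => //= l IHl lk; rewrite IHl ?(ltnW lk)// hE// ltnW.
by rewrite /be_input hE// sE.
Qed.

Variables (M : nat) (S xi : R).

Let seed : Type := (('I_M -> 'I_n -> R) * 'I_M)%type.

(* [inord] only extends the energy sequence past time k, where it is not read
   (lemma [be_input_causal]). *)
Definition be_encode (s : seed) (w : 'I_M) (k : 'I_n) (e : 'I_k.+1 -> R) : R :=
  be_input (s.1 w) (fun i => e (inord i)) k.

Lemma be_encodeE (s : seed) (w : 'I_M) (k : 'I_n) (e : nat -> R) :
  be_encode s w (fun i : 'I_k.+1 => e i) = be_input (s.1 w) e k.
Proof. by apply: be_input_causal => i ik; rewrite inordK. Qed.

Definition score (c : 'I_M -> 'I_n -> R) (y : 'I_n -> R) (j : 'I_M) : R :=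
  \sum_(k < n) ln (normal_pdf (c j k) 1 (y k)
                   / normal_pdf 0 (Num.sqrt (S + 1)) (y k)).

Definition be_decode (s : seed) (y : 'I_n -> R) : 'I_M :=
  odflt s.2 [pick j | (ln xi <= score s.1 y j)
                      && [forall i, (ln xi <= score s.1 y i) ==> (i == j)]].

Definition best_effort_code : eh_code (R := R) seed n M :=
  EHCode be_encode be_decode.

End best_effort.

Section random_coding.
Context {R : realType} {d : measure_display} {T : measurableType d}.
Variables (Pr : probability T R) (L n M : nat) (S : R).
Variables (En Z : nat -> {RV Pr >-> R}) (W : T -> 'I_M).
Variables (X : 'I_M -> 'I_n -> {RV Pr >-> R}) (D : T -> 'I_M).

(* The sigma-algebras generated by the block energies, the noise, the codeword
   symbols, the message (true) and the decoder's random guess (false). *)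
Definition sources (i : nat + nat + 'I_M * 'I_n + bool) : set (set T) :=
  match i with
  | inl (inl (inl l)) => preimage_set_system setT (En (l * L)%N) measurable
  | inl (inl (inr k)) => preimage_set_system setT (Z k) measurable
  | inl (inr (w, k)) => preimage_set_system setT (X w k) measurable
  | inr b => preimage_set_system setT (if b then W else D) setT
  end.

Record best_effort_setup (lawE : set R -> \bar R) : Prop := BestEffortSetup {
  energy_block : forall k t, En k t = En (k %/ L * L)%N t ;
  energy_law : forall l, has_law (En (l * L)%N) lawE ;
  noise_law : forall k, has_law (Z k) (normal_prob 0 1) ;
  symbol_law : forall w k, has_law (X w k) (normal_prob 0 (Num.sqrt S)) ;
  message_law : uniform_message Pr W ;
  guess_law : uniform_message Pr D ;
  sources_independent : mutually_independent Pr sources }.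

Definition codebook_seed (t : T) : ('I_M -> 'I_n -> R) * 'I_M :=
  (fun w k => X w k t, D t).

(* The set of mismatched positions for the transmitted message W. *)
Definition mismatched (t : T) : {set 'I_n} :=
  [set k : 'I_n | be_input L (X (W t) ^~ t) (En ^~ t) k != X (W t) k t]%SET.

Definition num_blocks : nat := (n + L.-1) %/ L.

(* A mismatch event silences a whole block, so the number of mismatch events is
   the number of blocks that contain mismatched positions; it is
   #|mismatched t| when L = 1. *)
Definition num_mismatch_events (t : T) : nat :=
  #|[pred l : 'I_num_blocks | [exists k in mismatched t, (k %/ L == l)%N]]|.

End random_coding.

Lemma num_mismatch_events1 (R : realType) (d : measure_display)
    (T : measurableType d) (Pr : probability T R) (n M : nat)
    (En : nat -> {RV Pr >-> R}) (W : T -> 'I_M)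
    (X : 'I_M -> 'I_n -> {RV Pr >-> R}) (t : T) :
  num_mismatch_events 1 En W X t = #|mismatched 1 En W X t|.
Proof.
have nE : n = num_blocks 1 n by rewrite /num_blocks addn0 divn1.
rewrite -(card_imset _ (@cast_ord_inj _ _ nE)); apply: eq_card => l.
rewrite inE; apply/existsP/imsetP => [[k /andP[kQ]]|[k kQ ->]].
  by rewrite divn1 => /eqP kl; exists k => //; apply: val_inj.
by exists k; rewrite kQ divn1 /=.
Qed.

Section parameters.
Context {R : realType}.
(* m2 stands for the second moment of the energy variable. *)
Variables (P m2 eps2 : R) (L n : nat).

Definition lambda1 : R := 2 * P * ln 2 + ln (1 + P) / 2.

Definition lambda2 : R := 8 * P + 1.

Definition rho : R :=
  Num.sqrt ((lambda1 * L%:R + lambda2 * ln n%:R) * (P + 1)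
            * (L%:R * m2 + 3 * P ^+ 2) * ln (1 / eps2))
  / (P * Num.sqrt (P * L%:R * n%:R)).

Definition Svar : R := P * (1 - rho).

Definition alpha : R := 2 * rho * P / (L%:R * m2 + 3 * Svar ^+ 2).

Definition beta : R := alpha / (1 + 63 * alpha * Svar).

Definition gamma : R :=
  ln (1 / eps2)
  / (L%:R * P * beta + L%:R ^+ 2 * alpha ^+ 2 * m2 / 2).

Definition rate_lower_bound (eps1 kappa : R) : R :=
  ln (1 + P) / 2
  - Num.sqrt ((lambda1 * L%:R + lambda2 * ln n%:R)
              * (L%:R * m2 + 3 * P ^+ 2) * ln (1 / eps2)
              / (L%:R * P * (P + 1) * n%:R))
  - Num.sqrt (P / ((P + 1) * n%:R)) * Phi_inv eps1
  - kappa * Num.max (ln n%:R) L%:R / n%:R.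

End parameters.

(* Main.v *)
(** Every misfit silences a block, and a silenced block costs the transmitted
    message at most its energy in score, up to a noise term whose exponential
    moment is 1 given the lost symbols.  Block energies stay below
    Lambda = 2 P ln 2 L + 8 P ln n, so the score of the message is at least the
    score of the ideal Gaussian code minus (number of misfits) Lambda - ln n / 2.
    A Gaussian rotation turns the ideal score into N(0, sigma^2 V) given the
    noise energy V, which gives a Berry-Esseen bound directly, and a wrong
    codeword has likelihood ratio of mean 1.

    The number of misfits is controlled by a supermartingale: if U is the energy
    reserve and B a block energy, then C exp (- a U) theta^-(K - misfits) does
    not increase in mean as soon as E exp (- a L E) E exp (a B) <= 1.  A misfit
    happens exactly when B is large compared with the reserve, so silencing B
    is compensated by the factor theta <= E exp (a B).

    Finally Lambda is smaller than lambda1 L + lambda2 ln n by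
    ln (1 + P) / 2 L + ln n.  Multiplied by gamma this slack is of the order of
    sqrt (n max (ln n, L)), which dominates every other error term, the one in
    Phi_inv included; hence kappa = 1 suffices. *)

Require Import Defs.
From HB Require Import structures.
From mathcomp Require Import all_boot all_order all_algebra.
From mathcomp Require Import all_classical all_reals all_analysis.
From mathcomp Require Import measurable_realfun normal_distribution ring lra zify.
Import Order.TTheory GRing.Theory Num.Theory.
Import numFieldNormedType.Exports.

Set Implicit Arguments.
Unset Strict Implicit.
Unset Printing Implicit Defensive.

Local Open Scope classical_set_scope.
Local Open Scope ring_scope.

(** * Decoupling of independent sources *)

Section decoupling.
Context {R : realType} {d : measure_display} {T : measurableType d}.
Variable Pr : probability T R.

(** Conditional expectations are replaced by decoupling: a function that reads one family of sources
    through its first argument and a disjoint family through its second has, on the diagonal, an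
    iterated integral as its mean. Conditioning then means freezing an argument.

    The delicate constant is [gamma]. The tilt [L * alpha] is the exact root of the drift equation
    obtained from 1 - x <= exp (- x). To first order it yields theta^(- gamma) = eps2, with nothing
    left for the prefactor C, for rounding gamma to an integer and for the last, possibly incomplete
    block. These losses are O(rho) in the exponent. They are paid by the sharper bound 1 - x <= exp
    (- x - x^2 / 4), which allows a tilt larger by a factor 1 + d, where d depends on the energy
    moments only: the gain in the exponent, about d log (1 / eps2), stays fixed while rho vanishes.

    The power backoff rho balances two losses, the capacity given up by lowering the power from P to
    S and the score given up to mismatches. Each costs rho P / (2 (P + 1)) per symbol, and together
    they are the first square root of the rate bound. *)

Lemma indep_generated (G : set (set T)) (B : set T) :
  G `<=` measurable -> setI_closed G -> G setT -> measurable B ->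
  (forall A, G A -> Pr (A `&` B) = Pr A * Pr B)%E ->
  forall A, <<s G >> A -> (Pr (A `&` B) = Pr A * Pr B)%E.
Proof.
move=> Gm GI GT mB GE A sA.
have Bfin : ((fine (Pr B))%:E = Pr B)%E by rewrite fineK// fin_num_measure.
have r0 : 0 <= fine (Pr B) by exact: fine_ge0.
(* As functions of A both sides are finite measures, the trace of [Pr] on B and [Pr] scaled by the
   probability of B; they agree on the pi-system G. *)
pose m2 := mscale (NngNum r0) Pr.
have := @g_sigma_algebra_measure_unique _ R T G Gm (fun=> setT) (fun=> GT) _
  (mrestr Pr mB) m2 GI.
move=> H; have -> : (Pr (A `&` B) = mrestr Pr mB A)%E by [].
rewrite H//.
- by rewrite muleC -[X in (X * _)%E]Bfin.
- by rewrite bigcup_const.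
- by move=> C /GE; rewrite muleC -[X in (X * _)%E]Bfin.
- by move=> _; apply: le_lt_trans (probability_le1 Pr _) _; [exact: measurableI|exact: ltry].
Qed.

Variables (I : choiceType) (F : I -> set (set T)).
Hypothesis indF : mutually_independent Pr F.
Hypothesis Fm : forall i, F i `<=` measurable.
Hypothesis FI : forall i, setI_closed (F i).
Hypothesis FT : forall i, F i setT.

(** A pi-system generating the sigma-algebra of the sources in J. The sets B i are constrained at
    every index, also outside s, so that two representations can be spliced freely. *)
Definition cylinders (J : pred I) : set (set T) :=
  [set A | exists (s : seq I) (B : I -> set T), [/\ uniq s, all J s,
     forall i, F i (B i) & A = \bigcap_(i in [set` s]) B i]].

Lemma cylindersT J : cylinders J setT.
Proof. by exists [::], (fun=> setT); split => //; rewrite set_nil bigcap_set0. Qed.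

Lemma cylinders_measurable J : cylinders J `<=` measurable.
Proof.
move=> _ [s [B [us Js FB ->]]].
rewrite bigcap_seq; apply: (@big_ind _ measurable) => [||i _] //.
  by move=> *; exact: measurableI.
exact: Fm.
Qed.

Lemma cylindersI J : setI_closed (cylinders J).
Proof.
move=> _ _ [s [B [us Js FB ->]]] [s' [B' [us' Js' FB' ->]]].
exists (undup (s ++ s')), (fun i => (if i \in s then B i else setT) `&`
                                    (if i \in s' then B' i else setT)).
split.
- exact: undup_uniq.
- apply/allP => i; rewrite mem_undup mem_cat => /orP[]; exact/allP.
- by move=> i; apply: FI; case: ifP.
- apply/seteqP; split=> [t [H H'] i /=|t H]; first rewrite mem_undup mem_cat.
    by move=> _; split; case: ifPn => // ?; [exact: H|exact: H'].
  split=> i /= si; have := H i; rewrite /= mem_undup mem_cat si ?orbT.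
    by case=> //.
  by case=> //.
Qed.

Lemma cylinders_gen (J : pred I) i A : J i -> F i A -> <<s cylinders J >> A.
Proof.
move=> Ji FA; apply: sub_sigma_algebra.
exists [:: i], (fun j => if j == i then A else setT); split => //=.
- by rewrite Ji.
- by move=> j; case: eqP => [->|].
- by rewrite set_cons1 bigcap_set1 eqxx.
Qed.

Lemma indep_cylinders (J K : pred I) A B : (forall i, J i -> ~~ K i) ->
  cylinders J A -> cylinders K B -> (Pr (A `&` B) = Pr A * Pr B)%E.
Proof.
move=> JK [s [A' [us Js FA ->]]] [s' [B' [us' Ks' FB ->]]].
have ss' i : i \in s' -> (i \in s) = false.
  by move=> /(allP Ks') Ki; apply/negP => /(allP Js)/JK; rewrite Ki.
pose C i := if i \in s then A' i else B' i.
have FC i : F i (C i) by rewrite /C; case: ifP.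
have AC : \bigcap_(i in [set` s]) A' i = \bigcap_(i in [set` s]) C i.
  by apply: eq_bigcapr => i /= si; rewrite /C si.
have BC : \bigcap_(i in [set` s']) B' i = \bigcap_(i in [set` s']) C i.
  by apply: eq_bigcapr => i /= si; rewrite /C ss'.
rewrite AC BC !indF// -big_cat/= -indF//; last first.
  by rewrite cat_uniq us us' andbT /= -all_predC; apply/allP => i /ss'/= ->.
congr (Pr _); apply/seteqP; split=> [t [H H'] i /=|t H].
  by rewrite mem_cat => /orP[]; [exact: H|exact: H'].
by split=> i /= si; apply: H; rewrite /= mem_cat si ?orbT.
Qed.

(** Uniqueness of measures is applied once per argument: first with a cylinder over J held fixed,
    then with an arbitrary event of K held fixed. *)
Lemma indep_sigma (J K : pred I) A B : (forall i, J i -> ~~ K i) ->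
  <<s cylinders J >> A -> <<s cylinders K >> B ->
  (Pr (A `&` B) = Pr A * Pr B)%E.
Proof.
move=> JK sA sB.
have sKm : <<s cylinders K >> `<=` measurable.
  apply: smallest_sub; first exact: sigma_algebra_measurable.
  exact: cylinders_measurable.
apply: (indep_generated _ _ _ _ _ sA) => //.
- exact: cylinders_measurable.
- exact: cylindersI.
- exact: cylindersT.
- exact: sKm.
- move=> C JC; rewrite setIC muleC.
  apply: (indep_generated _ _ _ _ _ sB) => //.
  + exact: cylinders_measurable.
  + exact: cylindersI.
  + exact: cylindersT.
  + exact: cylinders_measurable JC.
  + by move=> D KD; rewrite setIC muleC; exact: indep_cylinders JC KD.
Qed.

(** The same points with a coarser sigma-algebra: measurability on this type expresses that a
    function depends on the sources in J only. *)
Definition sigma_of (J : pred I) := g_sigma_algebraType (cylinders J).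

Lemma sigma_of_measurable J :
  measurable_fun [set: T] (id : T -> sigma_of J).
Proof.
move=> _ A sA; rewrite setTI preimage_id.
apply: (smallest_sub _ _ sA); first exact: sigma_algebra_measurable.
exact: cylinders_measurable.
Qed.

Definition to_sigma J : T -> sigma_of J := id.

HB.instance Definition _ J :=
  isMeasurableFun.Build _ _ _ _ (to_sigma J) (sigma_of_measurable (J := J)).

Let law J : probability (sigma_of J) R := distribution Pr (to_sigma J).

Section two_blocks.
Variables (J K : pred I) (f : sigma_of J * sigma_of K -> \bar R).
Hypothesis JK : forall i, J i -> ~~ K i.
Hypothesis mf : measurable_fun setT f.
Hypothesis f0 : forall x, (0 <= f x)%E.

Let diag : T -> sigma_of J * sigma_of K := fun t => (t, t).

Let mdiag : measurable_fun setT diag.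
Proof. by apply/measurable_fun_pairP; split; exact: sigma_of_measurable. Qed.

HB.instance Definition _ := isMeasurableFun.Build _ _ _ _ diag mdiag.

(** Independence says that the diagonal map carries [Pr] to the product of its restrictions to the
    two sigma-algebras; Tonelli does the rest. The inner integral plays the role of the conditional
    mean given the sources in J. *)
Lemma integral_decouple :
  (\int[Pr]_t f (t, t) = \int[Pr]_t \int[Pr]_s f (t, s))%E.
Proof.
have -> : (\int[Pr]_t f (t, t) = \int[distribution Pr diag]_x f x)%E.
  by rewrite ge0_integral_distribution.
have -> : (\int[distribution Pr diag]_x f x = \int[law J \x law K]_x f x)%E.
  apply: eq_measure_integral => A mA _; apply/esym.
  by apply: product_measure_unique => //= B C sB sC; exact: (indep_sigma JK).
rewrite fubini_tonelli1//= ge0_integral_distribution//; last 2 first.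
- exact: measurable_fun_fubini_tonelli_F.
- by move=> t; apply: integral_ge0.
apply: eq_integral => t _ /=; rewrite /fubini_F ge0_integral_distribution//.
by apply: measurableT_comp => //; exact: measurable_pair1.
Qed.

Lemma measurable_decouple :
  measurable_fun [set: sigma_of J] (fun t => \int[Pr]_s f (t, s))%E.
Proof.
rewrite (_ : (fun t => _) = fubini_F (law K) f).
  exact: measurable_fun_fubini_tonelli_F.
apply/funext => t; rewrite /fubini_F ge0_integral_distribution//.
by apply: measurableT_comp => //; exact: measurable_pair1.
Qed.

End two_blocks.

Lemma measurable_sigma_of (J : pred I) i d' (T' : measurableType d') (V : T -> T') :
  J i -> preimage_set_system setT V measurable `<=` F i ->
  measurable_fun setT (V : sigma_of J -> T').
Proof.
move=> Ji VF _ A mA; apply: (cylinders_gen Ji); apply: VF.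
by exists A.
Qed.

Lemma sigma_ofS (J K : pred I) d' (T' : measurableType d') (h : T -> T') :
  {subset J <= K} -> measurable_fun [set: sigma_of J] h ->
  measurable_fun [set: sigma_of K] h.
Proof.
move=> JK mh _ A mA; apply: (sub_sigma_algebra2 (M := cylinders J)) (mh _ _ mA) => //.
move=> B [s [C [us Js FC ->]]]; exists s, C; split => //.
by apply/allP => i /(allP Js)/JK.
Qed.

Lemma sigma_ofW (J : pred I) d' (T' : measurableType d') (h : T -> T') :
  measurable_fun [set: sigma_of J] h -> measurable_fun setT h.
Proof.
by move=> mh; apply: (measurableT_comp mh); exact: sigma_of_measurable.
Qed.

Lemma integral_prod_indep (s : seq I) (h : I -> T -> R) : uniq s ->
  (forall i, i \in s -> measurable_fun [set: sigma_of (pred1 i)] (h i)) ->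
  (forall i t, 0 <= h i t) ->
  (\int[Pr]_t (\prod_(i <- s) h i t)%:E = \prod_(i <- s) \int[Pr]_t (h i t)%:E)%E.
Proof.
elim: s => [|i s IHs] /= us mh h0.
  rewrite big_nil; under eq_integral do rewrite big_nil.
  rewrite integral_cst// -[RHS]mule1; congr (_ * _)%E; exact: probability_setT.
have /andP[si us'] := us.
have mi : measurable_fun [set: sigma_of (pred1 i)] (h i) by apply: mh; rewrite mem_head.
have mhs j : j \in s -> measurable_fun [set: sigma_of (mem s)] (h j).
  move=> sj; apply: (@sigma_ofS (pred1 j)); first by move=> k /eqP ->.
  by apply: mh; rewrite inE sj orbT.
pose f (x : sigma_of (pred1 i) * sigma_of (mem s)) : \bar R :=
  (h i x.1 * \prod_(j <- s) h j x.2)%:E.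
have -> : (\int[Pr]_t (\prod_(j <- (i :: s)) h j t)%:E = \int[Pr]_t f (t, t))%E.
  by apply: eq_integral => t _; rewrite big_cons.
have mprod : measurable_fun [set: sigma_of (mem s)] (fun t => \prod_(j <- s) h j t).
  by apply: measurable_prod => j /mhs.
rewrite integral_decouple; first last.
- by move=> x; rewrite lee_fin mulr_ge0// prodr_ge0.
- apply/measurable_EFinP; apply: measurable_funM.
    exact: (measurableT_comp mi measurable_fst).
  exact: (measurableT_comp mprod measurable_snd).
- by move=> j /eqP ->.
rewrite big_cons -IHs//; last by move=> j sj; apply: mh; rewrite inE sj orbT.
under eq_integral => t _.
  rewrite /f/=.
  under eq_integral do rewrite EFinM.
  rewrite ge0_integralZl//; [|exact/measurable_EFinP/(sigma_ofW mprod)|by move=> *; rewrite lee_fin prodr_ge0|by rewrite lee_fin].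
  over.
rewrite ge0_integralZr//.
- exact/measurable_EFinP/(sigma_ofW mi).
- by move=> *; rewrite lee_fin.
- by apply: integral_ge0 => *; rewrite lee_fin prodr_ge0.
Qed.

End decoupling.

(** * Gaussian integrals *)

Section normal_integrals.
Context {R : realType}.
Implicit Types (m s x y : R) (f : R -> \bar R).
Local Notation mu := (@lebesgue_measure R).

(** The Radon-Nikodym derivative of the normal law and [normal_pdf] have the same integral over
    every measurable set, hence agree almost everywhere. *)
Lemma ge0_integral_normal_prob m s f :
  measurable_fun setT f -> (forall x, 0 <= f x)%E ->
  (\int[normal_prob m s]_x f x = \int[mu]_x (f x * (normal_pdf m s x)%:E))%E.
Proof.
move=> mf f0; have Ndom := @normal_prob_dominates R m s.
rewrite -(Radon_Nikodym_SigmaFinite.change_of_variables Ndom)//.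
have mp : measurable_fun setT (fun x => (normal_pdf m s x)%:E).
  by apply/measurable_EFinP; exact: measurable_normal_pdf.
apply: ae_eq_integral => //.
- apply: emeasurable_funM => //.
  exact: measurable_int (Radon_Nikodym_SigmaFinite.f_integrable Ndom).
- exact: emeasurable_funM.
- apply: ae_eqe_mul2l; apply: integral_ae_eq => //.
  + exact: Radon_Nikodym_SigmaFinite.f_integrable.
  + by move=> A _ mA; rewrite -Radon_Nikodym_SigmaFinite.f_integral.
Qed.

Let affine (a b : R) : measurableTypeR R -> measurableTypeR R := fun x => a * x + b.

Let measurable_affine a b : measurable_fun setT (affine a b).
Proof. by apply: measurable_funD => //; exact: measurable_funM. Qed.

HB.instance Definition _ a b :=
  isMeasurableFun.Build _ _ _ _ (affine a b) (measurable_affine a b).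

(** By uniqueness it is enough to compare half-open intervals. A negative slope exchanges the open
    and the closed end, which leaves the length unchanged. *)
Lemma lebesgue_measure_affine (a b : R) (A : set R) : a != 0 -> measurable A ->
  (mu A = `|a|%:E * mu ((fun x => a * x + b)%R @^-1` A))%E.
Proof.
move=> a0 mA.
apply: (@lebesgue_measure_unique _ (mscale (NngNum (normr_ge0 a)) (pushforward mu (affine a b)))) => // _ [[x y] _ <-] /=.
rewrite /mscale/= /pushforward.
have [a_gt0|a_lt0] : 0 < a \/ a < 0 by case: (ltgtP a 0) a0 => //; [right|left].
- have -> : affine a b @^-1` `]x, y] = `](x - b) / a, (y - b) / a]%classic.
    apply/seteqP; split => z /=; rewrite /affine !in_itv/=;
    by rewrite ltr_pdivrMr// ler_pdivlMr// ltrBlDr lerBrDr [z * a]mulrC.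
  rewrite !lebesgue_measure_itv/= !lte_fin ltr_pM2r ?invr_gt0// ltrBlDr subrK.
  case: ifPn => _; last by rewrite mule0.
  rewrite -!EFinD -EFinM gtr0_norm//; congr EFin; by field.
- have -> : affine a b @^-1` `]x, y] = `[(y - b) / a, (x - b) / a[%classic.
    apply/seteqP; split => z /=; rewrite /affine !in_itv/= andbC;
    by rewrite ltr_ndivlMr// ler_ndivrMr// ltrBlDr lerBrDr [z * a]mulrC.
  rewrite !lebesgue_measure_itv/= !lte_fin ltr_nM2r ?invr_lt0// ltrBlDr subrK.
  case: ifPn => _; last by rewrite mule0.
  rewrite -!EFinD -EFinM ltr0_norm//; congr EFin; by field.
Qed.

Lemma ge0_integral_affine (a b : R) f : a != 0 ->
  measurable_fun setT f -> (forall x, 0 <= f x)%E ->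
  (\int[mu]_x f x = \int[mu]_x (f (a * x + b)%R * `|a|%:E))%E.
Proof.
move=> a0 mf f0.
have mfa : measurable_fun setT (f \o affine a b).
  exact: (measurableT_comp mf (measurable_affine a b)).
rewrite ge0_integralZr//.
have E : (\int[mu]_x f x =
    \int[mscale (NngNum (normr_ge0 a)) (pushforward mu (affine a b))]_x f x)%E.
  move=> ?; apply: eq_measure_integral => A mA _.
  exact: (lebesgue_measure_affine b a0 mA).
rewrite (E (measurable_affine a b)).
rewrite ge0_integral_mscale//= muleC; congr (_ * _)%E.
by rewrite ge0_integral_pushforward.
Qed.

Lemma normal_pdf_sqr m s x : s != 0 -> normal_pdf m s x =
  (Num.sqrt (s ^+ 2 * pi *+ 2))^-1 * expR (- ((x - m) ^+ 2 / s ^+ 2 / 2)).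
Proof.
move=> s0; rewrite normal_pdfE// /normal_peak /normal_fun; congr (_ * expR _).
by rewrite -mulr_natr invfM mulNr mulrA.
Qed.

(** Completing the square once and for all: a product of two Gaussian densities is determined by the
    product of the variances and by the total quadratic exponent. It serves the disintegration
    behind the rotation and the convolution of a symbol with the noise. *)
Lemma normal_pdfM m1 s1 x1 m2 s2 x2 m3 s3 x3 m4 s4 x4 (c : R) :
  s1 != 0 -> s2 != 0 -> s3 != 0 -> s4 != 0 ->
  s1 ^+ 2 * s2 ^+ 2 = s3 ^+ 2 * s4 ^+ 2 ->
  c + (x1 - m1) ^+ 2 / s1 ^+ 2 + (x2 - m2) ^+ 2 / s2 ^+ 2 =
  (x3 - m3) ^+ 2 / s3 ^+ 2 + (x4 - m4) ^+ 2 / s4 ^+ 2 ->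
  expR (- (c / 2)) * normal_pdf m1 s1 x1 * normal_pdf m2 s2 x2 =
  normal_pdf m3 s3 x3 * normal_pdf m4 s4 x4.
Proof.
move=> s10 s20 s30 s40 ss xx; rewrite !normal_pdf_sqr//.
have e (p q u v : R) : p * expR u * (q * expR v) = p * q * expR (u + v).
  by rewrite expRD; ring.
have sq (u v : R) : (Num.sqrt (u ^+ 2 * pi *+ 2))^-1 *
    (Num.sqrt (v ^+ 2 * pi *+ 2))^-1 = (Num.sqrt (u ^+ 2 * v ^+ 2 * (pi *+ 2) ^+ 2))^-1.
  rewrite -invfM -sqrtrM; last by rewrite mulrn_wge0// mulr_ge0 ?sqr_ge0 ?pi_ge0.
  by congr (Num.sqrt _)^-1; ring.
rewrite [expR _ * (_ * _)]mulrCA -expRD !e !sq ss; congr (_ * expR _).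
by move: xx => /(congr1 (fun z => - (z / 2))); lra.
Qed.

Lemma normal_pdf_affine (a b z : R) : a != 0 ->
  normal_pdf b `|a| (a * z + b) * `|a| = normal_pdf 0 1 z.
Proof.
move=> a0; have na0 : `|a| != 0 by rewrite normr_eq0.
rewrite !normal_pdf_sqr// ?oner_eq0//.
have -> : Num.sqrt (`|a| ^+ 2 * pi *+ 2) = `|a| * Num.sqrt (1 ^+ 2 * pi *+ 2 : R).
  by rewrite -mulrnAr sqrtrM ?sqr_ge0// sqrtr_sqr normr_id expr1n mul1r.
rewrite real_normK ?num_real// addrK subr0 expr1n divr1 exprMn.
have -> : a ^+ 2 * z ^+ 2 / a ^+ 2 = z ^+ 2 by field.
by rewrite invfM; set K := (Num.sqrt _)^-1; field.
Qed.

Lemma ge0_integral_normal_affine (a b : R) f : a != 0 ->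
  measurable_fun setT f -> (forall x, 0 <= f x)%E ->
  (\int[normal_prob 0 1]_z f (a * z + b)%R = \int[normal_prob b `|a|]_x f x)%E.
Proof.
move=> a0 mf f0.
have mfa : measurable_fun setT (fun z : R => f (a * z + b)%R).
  by apply: (measurableT_comp mf); apply: measurable_funD => //; exact: measurable_funM.
rewrite (ge0_integral_normal_prob 0 1 mfa)// (ge0_integral_normal_prob b `|a| mf f0).
pose g x := (f x * (normal_pdf b `|a| x)%:E)%E.
have mg : measurable_fun setT g.
  by apply: emeasurable_funM => //; apply/measurable_EFinP; exact: measurable_normal_pdf.
have g0 x : (0 <= g x)%E by rewrite mule_ge0// lee_fin normal_pdf_ge0.
rewrite [RHS](ge0_integral_affine b a0 mg g0).
by apply: eq_integral => z _; rewrite -muleA -EFinM normal_pdf_affine.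
Qed.

Lemma ge0_integral_normal_scale (a : R) f : a != 0 ->
  measurable_fun setT f -> (forall x, 0 <= f x)%E ->
  (\int[normal_prob 0 1]_z f (a * z)%R = \int[normal_prob 0 `|a|]_x f x)%E.
Proof.
move=> a0 mf f0; have <- := ge0_integral_normal_affine 0 a0 mf f0.
by apply: eq_integral => z _; rewrite addr0.
Qed.

Lemma ge0_integral_normal_scale_gt0 (a : R) f : 0 < a ->
  measurable_fun setT f -> (forall x, 0 <= f x)%E ->
  (\int[normal_prob 0 1]_z f (a * z)%R = \int[normal_prob 0 a]_x f x)%E.
Proof.
move=> a0 mf f0; have a_neq0 : a != 0 by rewrite gt_eqF.
by have := ge0_integral_normal_scale a_neq0 mf f0; rewrite (gtr0_norm a0).
Qed.

Local Notation N01 := (normal_prob (0 : R) 1).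

Lemma measurable_fun2 d (T : measurableType d) (F : R * R -> \bar R) (u v : T -> R) :
  measurable_fun setT F -> measurable_fun setT u -> measurable_fun setT v ->
  measurable_fun setT (fun t => F (u t, v t)).
Proof.
move=> mF mu' mv; apply: (measurableT_comp mF).
by apply/measurable_fun_pairP; split.
Qed.

(* Given x, the second coordinate w = s x + c z has law N(s x, c^2); given w,
   the variable x has law N(s w, c^2), so (x - s w) / c is again N(0, 1). *)
Lemma integral_normal_rotation (c s : R) (F : R * R -> \bar R) :
  c ^+ 2 + s ^+ 2 = 1 -> c != 0 -> measurable_fun setT F ->
  (forall p, 0 <= F p)%E ->
  (\int[N01]_x \int[N01]_z F (c * x - s * z, s * x + c * z)%R =
   \int[N01]_x \int[N01]_z F (x, z))%E.
Proof.
move=> cs c0 mF F0; have nc0 : `|c| != 0 by rewrite normr_eq0.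
have mcm (k : R) d (T : measurableType d) (g : T -> R) : measurable_fun setT g ->
    measurable_fun setT (fun t => k * g t) by move=> mg; exact: measurable_funM.
pose p (x w : R) := (normal_pdf 0 1 w * normal_pdf (s * w) `|c| x)%:E.
have mpdf (m k : R) : measurable_fun setT (normal_pdf m k) by exact: measurable_normal_pdf.
have mpdfE (m k : R) : measurable_fun setT (fun x => (normal_pdf m k x)%:E).
  by apply/measurable_EFinP; exact: mpdf.
have mF1 d (T : measurableType d) (u v : T -> R) : measurable_fun setT u ->
    measurable_fun setT v -> measurable_fun setT (fun t => F (u t, v t)).
  exact: measurable_fun2.
have pE x w : (normal_pdf (s * x) `|c| w * normal_pdf 0 1 x)%:E = p x w.
  congr EFin.
  have := @normal_pdfM 0 1 x (s * x) `|c| w 0 1 w (s * w) `|c| x 0.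
  rewrite mul0r oppr0 expR0 mul1r => pE; rewrite mulrC {}pE// ?oner_eq0//.
  rewrite real_normK ?num_real// expr1n !addr0 add0r !divr1.
  have c20 : c ^+ 2 != 0 by rewrite sqrf_eq0.
  apply: (mulIf c20); rewrite !mulrDl !divfK//.
  by have := congr1 (fun u => u * (x ^+ 2 - w ^+ 2)) cs; rewrite /=; lra.
pose g x w := F ((x - s * w) / c, w).
have mg : measurable_fun setT (fun q : R * R => g q.1 q.2).
  apply: mF1 => //; apply: measurable_funM => //; apply: measurable_funB => //.
  exact: mcm.
have g0 x w : (0 <= g x w)%E by exact: F0.
have mg1 x : measurable_fun setT (g x) by exact: measurable_fun_pair2 mg.
have mg2 w : measurable_fun setT (g ^~ w) by exact: (measurable_fun_pair1 _ mg).
have mp : measurable_fun setT (fun q : R * R => p q.1 q.2).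
  apply/measurable_EFinP => /=; apply: measurable_funM.
    exact: (measurableT_comp (mpdf 0 1) measurable_snd).
  under eq_fun do rewrite normal_pdf_sqr//.
  apply: measurable_funM => //; apply: measurableT_comp => //.
  apply: measurableT_comp => //; do 2 apply: measurable_funM => //.
  apply: measurable_funX; apply: measurable_funB => //; exact: mcm.
have p0 x w : (0 <= p x w)%E by rewrite lee_fin mulr_ge0// normal_pdf_ge0.
have row (x : R) : (\int[N01]_z F (c * x - s * z, s * x + c * z)%R =
    \int[normal_prob (s * x) `|c|]_w g x w)%E.
  have <- := ge0_integral_normal_affine (s * x) c0 (mg1 x) (g0 x).
  apply: eq_integral => z _; rewrite /g; congr (F (_, _)); last by rewrite addrC.
  apply: (mulIf c0); rewrite divfK//.
  by have := congr1 (fun u => u * x) cs; rewrite /=; lra.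
have col (w : R) : (\int[normal_prob (s * w) `|c|]_x g x w = \int[N01]_z F (z, w))%E.
  have <- := ge0_integral_normal_affine (s * w) c0 (mg2 w) (g0^~ w).
  by apply: eq_integral => z _; rewrite /g addrK mulrC mulKf.
have row' (x : R) : ((\int[normal_prob (s * x) `|c|]_w g x w) * (normal_pdf 0 1 x)%:E =
    \int[mu]_w (g x w * p x w))%E.
  have m1 : measurable_fun [set: R] (fun w => g x w * (normal_pdf (s * x) `|c| w)%:E)%E.
    by apply: emeasurable_funM => //; exact: mpdfE.
  rewrite (ge0_integral_normal_prob _ _ (mg1 x) (g0 x)) -ge0_integralZr//.
  - by apply: eq_integral => w _; rewrite -muleA -EFinM pE.
  - by move=> w _; rewrite mule_ge0// lee_fin normal_pdf_ge0.
  - by rewrite lee_fin normal_pdf_ge0.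
have col' (w : R) : ((\int[normal_prob (s * w) `|c|]_x g x w) * (normal_pdf 0 1 w)%:E =
    \int[mu]_x (g x w * p x w))%E.
  have m1 : measurable_fun [set: R] (fun x => g x w * (normal_pdf (s * w) `|c| x)%:E)%E.
    by apply: emeasurable_funM => //; exact: mpdfE.
  rewrite (ge0_integral_normal_prob _ _ (mg2 w) (g0^~ w)) -ge0_integralZr//.
  - by apply: eq_integral => x _; rewrite -muleA -EFinM [X in X%:E]mulrC.
  - by move=> x _; rewrite mule_ge0// lee_fin normal_pdf_ge0.
  - by rewrite lee_fin normal_pdf_ge0.
transitivity (\int[mu]_x \int[mu]_w (g x w * p x w))%E.
  rewrite ge0_integral_normal_prob//; first last.
  - by move=> x; apply: integral_ge0.
  - apply: (@measurable_fun_fubini_tonelli_F _ _ _ _ _ N01 (fun q => F (c * q.1 - s * q.2, s * q.1 + c * q.2)%R)) => //.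
    apply: mF1; [apply: measurable_funB|apply: measurable_funD]; exact: mcm.
  by apply: eq_integral => x _; rewrite row row'.
rewrite (@fubini_tonelli _ _ _ _ _ mu mu (fun q => g q.1 q.2 * p q.1 q.2)%E)/=; last 2 first.
- exact: emeasurable_funM.
- by move=> q; rewrite mule_ge0.
rewrite (@fubini_tonelli _ _ _ _ _ N01 N01 F)//.
rewrite [RHS]ge0_integral_normal_prob//; last 2 first.
- exact: (@measurable_fun_fubini_tonelli_G _ _ _ _ _ N01 F).
- by move=> w; apply: integral_ge0.
by apply: eq_integral => w _; rewrite -col -col'.
Qed.

Lemma integral_normal_cst m s (r : \bar R) : (\int[normal_prob m s]_x r = r)%E.
Proof.
rewrite integral_cst// -[RHS]mule1; congr (_ * _)%E.
exact: (probability_setT (normal_prob m s)).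
Qed.

Lemma integral_normal_lin (a b : R) f :
  measurable_fun setT f -> (forall x, 0 <= f x)%E ->
  (\int[N01]_x \int[N01]_z f (a * x + b * z)%R =
   \int[N01]_x f (Num.sqrt (a ^+ 2 + b ^+ 2) * x)%R)%E.
Proof.
move=> mf f0; have [->|b0] := eqVneq b 0.
  rewrite expr0n addr0 sqrtr_sqr.
  under eq_integral => x _.
    under eq_integral do rewrite mul0r addr0.
    rewrite integral_normal_cst; over.
  have [->|a0] := eqVneq a 0; first by rewrite normr0.
  have na0 : `|a| != 0 by rewrite normr_eq0.
  have H := ge0_integral_normal_scale na0 mf f0; rewrite normr_id in H.
  exact: (etrans (ge0_integral_normal_scale a0 mf f0) (esym H)).
set r := Num.sqrt _.
have r0 : r != 0.
  by rewrite gt_eqF// sqrtr_gt0 ltr_wpDl ?sqr_ge0// exprn_even_gt0.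
have r2 : r ^+ 2 = a ^+ 2 + b ^+ 2 by rewrite sqr_sqrtr// addr_ge0 ?sqr_ge0.
have mf2 : measurable_fun setT (fun p : R * R => f (r * p.2)%R).
  by apply: (measurableT_comp mf); exact: measurable_funM.
have cs1 : (b / r) ^+ 2 + (a / r) ^+ 2 = 1.
  by rewrite !expr_div_n -mulrDl addrC -r2 divff// sqrf_eq0.
have br0 : b / r != 0 by rewrite mulf_neq0// invr_eq0.
have H := integral_normal_rotation cs1 br0 mf2 (fun p => f0 _).
transitivity (\int[N01]_x \int[N01]_z f (r * z)%R)%E; last first.
  by rewrite integral_normal_cst.
apply: etrans H; apply: eq_integral => x _; apply: eq_integral => z _.
by congr f => /=; field.
Qed.

(** In the standard variables (x / sqrt S, z) the integrand is a quadratic form of trace zero with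
    eigenvalues plus and minus half of sqrt (S / (S + 1)). A suitable rotation removes its diagonal,
    leaving a multiple of the product of the coordinates. *)
Lemma integral_normal_info_density (S : R) f : 0 < S ->
  measurable_fun setT f -> (forall x, 0 <= f x)%E ->
  (\int[normal_prob 0 (Num.sqrt S)]_x \int[N01]_z
     f (((x + z) ^+ 2 / (S + 1) - z ^+ 2) / 2)%R =
   \int[N01]_g \int[N01]_h f (Num.sqrt (S / (S + 1)) * (g * h))%R)%E.
Proof.
move=> S0 mf f0.
have S10 : 0 < S + 1 by rewrite addr_gt0.
pose F (x : R) := (\int[N01]_z f (((x + z) ^+ 2 / (S + 1) - z ^+ 2) / 2)%R)%E.
have mF0 : measurable_fun setT (fun p : R * R => f (((p.1 + p.2) ^+ 2 / (S + 1) - p.2 ^+ 2) / 2)%R).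
  apply: (measurableT_comp mf); apply: measurable_funM => //; apply: measurable_funB.
    by apply: measurable_funM => //; apply: measurable_funX; exact: measurable_funD.
  exact: measurable_funX.
have mF : measurable_fun setT F by exact: (@measurable_fun_fubini_tonelli_F _ _ _ _ _ N01 _ mF0).
have F0 x : (0 <= F x)%E by apply: integral_ge0.
pose q := Num.sqrt S; pose r := Num.sqrt (S + 1).
have q0 : 0 < q by rewrite sqrtr_gt0.
have r0 : 0 < r by rewrite sqrtr_gt0.
have q2 : q ^+ 2 = S by rewrite sqr_sqrtr// ltW.
have r2 : r ^+ 2 = S + 1 by rewrite sqr_sqrtr// ltW.
have q_neq0 : q != 0 by rewrite gt_eqF.
have r_neq0 : r != 0 by rewrite gt_eqF.
have r_gt1 : 1 < r by rewrite -sqrtr1 ltr_sqrt// ltrDr.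
have rV1 : r^-1 < 1 by rewrite invf_lt1.
have rV0 : 0 < r^-1 by rewrite invr_gt0.
(* Half-angle formulas: the double angle has cosine 1 / r and sine q / r, consistent because q^2 + 1
   = r^2. *)
pose c := Num.sqrt ((1 + r^-1) / 2); pose s := Num.sqrt ((1 - r^-1) / 2).
have c2 : c ^+ 2 = (1 + r^-1) / 2 by rewrite sqr_sqrtr//; lra.
have s2 : s ^+ 2 = (1 - r^-1) / 2 by rewrite sqr_sqrtr//; lra.
have c0 : c != 0 by rewrite gt_eqF// sqrtr_gt0; lra.
have cs : c * s = q / r / 2.
  rewrite -sqrtrM; last by lra.
  rewrite -[RHS]ger0_norm; last by rewrite !divr_ge0// ltW.
  rewrite -sqrtr_sqr; congr Num.sqrt.
  rewrite !expr_div_n q2.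
  have -> : S = r ^+ 2 - 1 by rewrite r2 addrK.
  by field.
have sqE : Num.sqrt (S / (S + 1)) = q / r.
  by rewrite sqrtrM ?ltW// sqrtrV// ltW.
apply: (etrans (esym (ge0_integral_normal_scale_gt0 q0 mF F0))).
pose G (p : R * R) := f (q / r * (p.1 * p.2))%R.
have mG : measurable_fun setT G.
  by apply: (measurableT_comp mf); apply: measurable_funM => //; exact: measurable_funM.
have cs1 : c ^+ 2 + s ^+ 2 = 1 by rewrite c2 s2; lra.
rewrite sqE; apply: etrans (integral_normal_rotation cs1 c0 mG (fun p => f0 _)).
apply: eq_integral => x _; apply: eq_integral => z _; rewrite /G/=; congr f.
rewrite -r2.
have -> : (c * x - s * z) * (s * x + c * z) =
  (c * s) * (x ^+ 2 - z ^+ 2) + (c ^+ 2 - s ^+ 2) * (x * z) by ring.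
rewrite cs c2 s2.
have -> : ((q * x + z) ^+ 2 / r ^+ 2 - z ^+ 2) / 2 =
  (q ^+ 2 * x ^+ 2 + 2 * q * x * z + (1 - r ^+ 2) * z ^+ 2) / r ^+ 2 / 2 by field.
have -> : 1 - r ^+ 2 = - q ^+ 2 by rewrite r2 q2; ring.
by field.
Qed.

Lemma integral_normal_expR_sqr (a s : R) : 0 < s -> 2 * a * s ^+ 2 < 1 ->
  (\int[normal_prob 0 s]_x (expR (a * x ^+ 2))%:E =
   (Num.sqrt (1 - 2 * a * s ^+ 2))^-1%:E)%E.
Proof.
move=> s0 as1; set k := Num.sqrt _.
have k0 : 0 < k by rewrite sqrtr_gt0 subr_gt0.
have k2 : k ^+ 2 = 1 - 2 * a * s ^+ 2 by rewrite sqr_sqrtr// subr_ge0 ltW.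
have s_neq0 : s != 0 by rewrite gt_eqF.
have k_neq0 : k != 0 by rewrite gt_eqF.
have mexp : measurable_fun setT (fun x : R => (expR (a * x ^+ 2))%:E).
  apply/measurable_EFinP; apply: measurableT_comp => //.
  by apply: measurable_funM => //; exact: measurable_funX.
rewrite (ge0_integral_normal_prob 0 s mexp)//.
have e x : expR (a * x ^+ 2) * normal_pdf 0 s x = k^-1 * normal_pdf 0 (s / k) x.
  have sk0 : s / k != 0 by rewrite mulf_neq0// invr_eq0.
  rewrite !normal_pdf_sqr// !subr0 mulrCA -expRD mulrA; congr (_ * expR _).
    rewrite -invfM; congr (_^-1).
    rewrite -[in RHS](gtr0_norm k0) -sqrtr_sqr -sqrtrM ?sqr_ge0//.
    by rewrite sqrtr_sqr gtr0_norm//; congr Num.sqrt; field.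
  have -> : a = (1 - k ^+ 2) / (2 * s ^+ 2) by rewrite k2; field.
  by field; rewrite s_neq0 k_neq0.
under eq_integral do rewrite -EFinM e EFinM.
rewrite ge0_integralZl//.
- by rewrite integral_normal_pdf mule1.
- by apply/measurable_EFinP; exact: measurable_normal_pdf.
- by move=> x _; rewrite lee_fin normal_pdf_ge0.
- by rewrite lee_fin invr_ge0 ltW.
Qed.

Lemma integral_normal_expR (t : R) :
  (\int[N01]_z (expR (t * z))%:E = (expR (t ^+ 2 / 2))%:E)%E.
Proof.
have mexp : measurable_fun setT (fun x : R => (expR (t * x))%:E).
  have mt : measurable_fun [set: R] (fun x => t * x) by exact: measurable_funM.
  apply/measurable_EFinP; exact: (measurableT_comp (@measurable_expR R) mt).
rewrite (ge0_integral_normal_prob 0 1 mexp)//.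
have e x : expR (t * x) * normal_pdf 0 1 x = expR (t ^+ 2 / 2) * normal_pdf t 1 x.
  rewrite !normal_pdf_sqr ?oner_eq0// mulrCA -expRD [RHS]mulrCA -expRD.
  by congr (_ * expR _); rewrite expr1n !divr1; field.
under eq_integral do rewrite -EFinM e EFinM.
rewrite ge0_integralZl//.
- by rewrite integral_normal_pdf mule1.
- by apply/measurable_EFinP; exact: measurable_normal_pdf.
- by move=> x _; rewrite lee_fin normal_pdf_ge0.
Qed.

Lemma integral_normal_pdf_conv (S y : R) : 0 < S ->
  (\int[normal_prob 0 (Num.sqrt S)]_x (normal_pdf x 1 y)%:E =
   (normal_pdf 0 (Num.sqrt (S + 1)) y)%:E)%E.
Proof.
move=> S0; have S10 : 0 < S + 1 by rewrite addr_gt0.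
have pdfC x : normal_pdf x 1 y = normal_pdf y 1 x.
  by rewrite !normal_pdf_sqr ?oner_eq0// -(sqrrN (y - x)) opprB.
have mpdf m s : measurable_fun setT (fun x : R => (normal_pdf m s x)%:E).
  by apply/measurable_EFinP; exact: measurable_normal_pdf.
under eq_integral do rewrite pdfC.
rewrite (ge0_integral_normal_prob 0 _ (mpdf y 1)); last first.
  by move=> x; rewrite lee_fin normal_pdf_ge0.
have e x : normal_pdf y 1 x * normal_pdf 0 (Num.sqrt S) x =
    normal_pdf 0 (Num.sqrt (S + 1)) y *
    normal_pdf (S * y / (S + 1)) (Num.sqrt (S / (S + 1))) x.
  have := @normal_pdfM y 1 x 0 (Num.sqrt S) x 0 (Num.sqrt (S + 1)) y
    (S * y / (S + 1)) (Num.sqrt (S / (S + 1))) x 0.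
  rewrite mul0r oppr0 expR0 mul1r; apply; rewrite ?oner_eq0//.
  - by rewrite gt_eqF// sqrtr_gt0.
  - by rewrite gt_eqF// sqrtr_gt0.
  - by rewrite gt_eqF// sqrtr_gt0 divr_gt0.
  - rewrite !sqr_sqrtr ?divr_ge0 ?ltW// expr1n mul1r mulrCA divff ?gt_eqF// mulr1//.
  - rewrite !sqr_sqrtr ?divr_ge0 ?ltW// expr1n.
    by field; rewrite !gt_eqF.
under eq_integral do rewrite -EFinM e EFinM.
rewrite ge0_integralZl//.
- by rewrite integral_normal_pdf mule1.
- by apply/measurable_EFinP; exact: measurable_normal_pdf.
- by move=> x _; rewrite lee_fin normal_pdf_ge0.
- by rewrite lee_fin normal_pdf_ge0.
Qed.

Lemma PhiE x : (Phi x)%:E = N01 `]-oo, x].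
Proof. by rewrite /Phi fineK// fin_num_measure. Qed.

Lemma Phi_itv x y : x <= y -> (Phi y)%:E = ((Phi x)%:E + N01 `]x, y])%E.
Proof.
move=> xy; rewrite !PhiE -measureU//.
  by congr (N01 _); rewrite -itv_bndbnd_setU// ?bnd_simp.
apply/seteqP; split => z //= []; rewrite !in_itv/= => zx /andP[xz _].
by move: (lt_le_trans xz zx); rewrite ltxx.
Qed.

Lemma normal_peak1_le1 : normal_peak (1 : R) <= 1.
Proof.
rewrite /normal_peak invf_le1 ?sqrtr_gt0; last first.
  by rewrite expr1n mul1r mulrn_wgt0// pi_gt0.
have pi2 := @pi_ge2 R; rewrite expr1n mul1r -[leLHS]sqrtr1 ler_sqrt; lra.
Qed.

Lemma Phi_le x y : x <= y -> Phi x <= Phi y.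
Proof. by move=> xy; rewrite -lee_fin (Phi_itv xy) leeDl. Qed.

Lemma Phi_lipschitz x y : x <= y -> Phi y <= Phi x + (y - x).
Proof.
move=> xy; rewrite -lee_fin (Phi_itv xy) EFinD leeD2l//.
have -> : (y - x)%:E = (\int[mu]_(z in `]x, y]) (cst 1 z))%E.
  rewrite integral_cst//= mul1e lebesgue_measure_itv/= lte_fin.
  by case: ltP => // yx; rewrite (@le_anti _ _ x y) ?xy// subrr.
apply: ge0_le_integral => //.
- by move=> z _; rewrite lee_fin normal_pdf_ge0.
- by apply/measurable_EFinP/measurable_funTS; exact: measurable_normal_pdf.
- move=> z _; rewrite lee_fin (le_trans (normal_pdf_ub _ _ (oner_neq0 _)))//.
  exact: normal_peak1_le1.
Qed.

Lemma Phi_increment (k x y : R) : x <= y -> 0 <= k ->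
  (forall z, x <= z <= y -> k <= normal_pdf 0 1 z) ->
  Phi x + k * (y - x) <= Phi y.
Proof.
move=> xy k0 kz; rewrite -lee_fin (Phi_itv xy) EFinD leeD2l//.
have -> : (k * (y - x))%:E = (\int[mu]_(z in `]x, y]) (cst k%:E z))%E.
  rewrite integral_cst//= lebesgue_measure_itv/= lte_fin.
  by case: ltP => // yx; rewrite (@le_anti _ _ x y) ?xy// subrr mulr0 mule0.
apply: ge0_le_integral => //.
- by apply/measurable_EFinP/measurable_funTS; exact: measurable_normal_pdf.
- move=> z /=; rewrite in_itv/= => /andP[xz zy].
  by rewrite lee_fin kz// ltW.
Qed.

Lemma Phi_ge0 x : 0 <= Phi x. Proof. exact: fine_ge0. Qed.

End normal_integrals.

(** * The mismatch supermartingale *)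

Section association.
Context {R : realType} {d : measure_display} {T : measurableType d}.
Variable mu : probability T R.

Lemma prob_integral_cst (r : \bar R) : (\int[mu]_x r = r)%E.
Proof.
rewrite integral_cst// -[RHS]mule1; congr (_ * _)%E.
exact: probability_setT.
Qed.

Lemma ge0_integral_le (f g : T -> R) : measurable_fun setT f ->
  measurable_fun setT g -> (forall x, 0 <= f x) -> (forall x, f x <= g x) ->
  (\int[mu]_x (f x)%:E <= \int[mu]_x (g x)%:E)%E.
Proof.
move=> mf mg f0 fg; apply: ge0_le_integral => //.
- by move=> x _; rewrite lee_fin.
- exact/measurable_EFinP.
- exact/measurable_EFinP.
- by move=> x _; rewrite lee_fin.
Qed.

Lemma prob_le_integral (A : set T) (f : T -> R) : measurable A ->
  measurable_fun setT f -> (forall x, 0 <= f x) -> (forall x, A x -> 1 <= f x) ->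
  (mu A <= \int[mu]_x (f x)%:E)%E.
Proof.
move=> mA mf f0 fA; rewrite -[A]setIT -integral_indic//.
apply: ge0_integral_le => // x; rewrite indicE; case: (boolP (x \in A)) => //.
by rewrite inE => /fA.
Qed.

Lemma prob_le_add (A B C : set T) : measurable A -> measurable B -> measurable C ->
  A `<=` B `|` C -> (mu A <= mu B + mu C)%E.
Proof.
move=> mA mB mC ABC; apply: (@le_trans _ _ (mu (B `|` C))); last exact: measureU2.
by apply: le_measure; rewrite ?inE//; exact: measurableU.
Qed.

Lemma union_bound (I : finType) (P : pred I) (A : I -> set T) (B : set T) :
  measurable B -> (forall i, measurable (A i)) ->
  (forall t, B t -> exists2 i, P i & A i t) ->
  (mu B <= \sum_(i | P i) mu (A i))%E.
Proof.
move=> mB mA BA; rewrite bigfs ?index_enum_uniq//; last first.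
  by move=> i _; rewrite mem_index_enum.
by apply: content_sub_fsum.
Qed.

(* Either c <= f throughout the upper set A of f, or f < c outside A. *)
Lemma integral_association (A : T -> bool) (f : T -> R) (c : R) :
  measurable_fun setT A -> measurable_fun setT f -> (forall x, 0 <= f x) ->
  0 <= c -> (c%:E <= \int[mu]_x (f x)%:E)%E ->
  (forall x y, A x -> ~~ A y -> f y <= f x) ->
  (\int[mu]_x (if A x then c else f x)%:E <= \int[mu]_x (f x)%:E)%E.
Proof.
move=> mA mf f0 c0 cf Af.
have mif : measurable_fun setT (fun x => if A x then c else f x).
  exact: measurable_fun_ifT.
have if0 x : 0 <= (if A x then c else f x) by case: ifP.
have [cA|/existsNP[x0 /not_implyP[Ax0 /negP]]] := pselect (forall x, A x -> c <= f x).
  by apply: ge0_integral_le => // x; case: ifPn => // /cA.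
rewrite -ltNge => fx0; apply: le_trans cf.
rewrite -[leRHS]prob_integral_cst; apply: ge0_integral_le => // x.
by case: ifPn => // /(Af _ _ Ax0) /le_trans; apply; exact: ltW.
Qed.

End association.

(** * One step of the supermartingale *)

Section mismatch_step.
Context {R : realType} {d0 d : measure_display}.
Context {T0 : measurableType d0} {T : measurableType d}.
Variables (Q : probability T0 R) (Pr : probability T R).
Variables (E : T0 -> R) (B : T -> R) (a theta C : R) (L : nat).
Hypothesis mE : measurable_fun setT E.
Hypothesis E0 : forall q, 0 <= E q.
Hypothesis mB : measurable_fun setT B.
Hypothesis a0 : 0 <= a.
Hypothesis theta0 : 0 < theta.
Hypothesis C0 : 0 <= C.

(* Bound on the probability of at least r more mismatches starting from the
   energy reserve u. *)
Definition mismatch_potential (r : nat) (u : R) : R :=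
  if r is r'.+1 then C * expR (- (a * u)) * theta^-1 ^+ r' else 1.

(** The test sees the energy e once, since only the first arrival of the block is available when the
    block is chosen; afterwards the block has delivered [L%:R * e]. A misfit costs no energy but
    uses up one of the r mismatches. *)
Definition next_potential (r : nat) (u e b : R) : R :=
  if b <= u + e then mismatch_potential r (u + L%:R * e - b)
  else mismatch_potential r.-1 (u + L%:R * e).

Lemma mismatch_potential_ge0 r u : 0 <= mismatch_potential r u.
Proof.
by case: r => //= r; rewrite !mulr_ge0 ?expR_ge0// exprn_ge0// invr_ge0 ltW.
Qed.

Lemma next_potential_ge0 r u e b : 0 <= next_potential r u e b.
Proof. by rewrite /next_potential; case: ifP => _; exact: mismatch_potential_ge0. Qed.

Let mgfB := (\int[Pr]_s (expR (a * B s))%:E)%E.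
Let mgfE := (\int[Q]_q (expR (- (a * (L%:R * E q))))%:E)%E.
Hypothesis theta_mgf : (theta%:E <= mgfB)%E.
Hypothesis mgf_le1 : (mgfE * mgfB <= 1)%E.
Hypothesis C_mgf : (1 <= C%:E * mgfE)%E.

Let meB : measurable_fun setT (fun s => expR (a * B s)).
Proof. by apply: measurableT_comp => //; exact: measurable_funM. Qed.

Let meE : measurable_fun setT (fun q => expR (- (a * (L%:R * E q)))).
Proof.
apply: measurableT_comp => //; apply: measurableT_comp => //.
by do 2 apply: measurable_funM => //.
Qed.

Lemma measurable_mismatch_potential d' (T' : measurableType d') r (u : T' -> R) :
  measurable_fun setT u -> measurable_fun setT (fun t => mismatch_potential r (u t)).
Proof.
move=> mu; case: r => [|r] //=; apply: measurable_funM => //.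
apply: measurable_funM => //; apply: measurableT_comp => //.
by apply: measurableT_comp => //; exact: measurable_funM.
Qed.

Lemma measurable_next_potential d' (T' : measurableType d') r (u e b : T' -> R) :
  measurable_fun setT u -> measurable_fun setT e -> measurable_fun setT b ->
  measurable_fun setT (fun t => next_potential r (u t) (e t) (b t)).
Proof.
move=> mu me mb; apply: measurable_fun_ifT.
- by apply: measurable_fun_ler => //; exact: measurable_funD.
- apply: measurable_mismatch_potential; apply: measurable_funB => //.
  by apply: measurable_funD => //; exact: measurable_funM.
- by apply: measurable_mismatch_potential; apply: measurable_funD => //; exact: measurable_funM.
Qed.

Let mgfB0 : (0 <= mgfB)%E.
Proof. by apply: integral_ge0 => s _; rewrite lee_fin expR_ge0. Qed.

Let mgfE0 : (0 <= mgfE)%E.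
Proof. by apply: integral_ge0 => s _; rewrite lee_fin expR_ge0. Qed.

(** The potential changes form at r = 0, hence three cases. For r = 1 a misfit leads to the value 1;
    for a fixed block energy this caps a decreasing function of the arrival on its lower values, and
    C makes 1 no larger than the mean. For larger r a misfit replaces [expR (a * B s)] by [theta];
    for a fixed arrival this caps an increasing function of the block energy. Association applies
    both times. *)
Lemma integral_next_potential r u :
  (\int[Q]_q \int[Pr]_s (next_potential r u (E q) (B s))%:E
    <= (mismatch_potential r u)%:E)%E.
Proof.
case: r => [|[|r]].
- under eq_integral => q _.
    under eq_integral => s _ do rewrite /next_potential if_same/=.
    rewrite prob_integral_cst; over.
  by rewrite /= prob_integral_cst.
- have mnp : measurable_fun setT (fun p : T0 * T =>
      (next_potential 1 u (E p.1) (B p.2))%:E).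
    apply/measurable_EFinP; apply: measurable_next_potential => //.
      exact: (measurableT_comp mE measurable_fst).
    exact: (measurableT_comp mB measurable_snd).
  rewrite (@fubini_tonelli _ _ _ _ _ Q Pr _ mnp)/=; last first.
    by move=> p; rewrite lee_fin next_potential_ge0.
  pose k (s : T) := C * expR (- (a * u)) * expR (a * B s).
  have k0 s : 0 <= k s by rewrite !mulr_ge0 ?expR_ge0.
  have inner s : (\int[Q]_q (next_potential 1 u (E q) (B s))%:E <= (k s)%:E * mgfE)%E.
    have -> : ((k s)%:E * mgfE = \int[Q]_q (k s * expR (- (a * (L%:R * E q))))%:E)%E.
      under eq_integral do rewrite EFinM.
      by rewrite ge0_integralZl ?lee_fin//; exact/measurable_EFinP.
    pose f q := k s * expR (- (a * (L%:R * E q))).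
    have npE q : next_potential 1 u (E q) (B s) =
        if E q < B s - u then 1 else f q.
      rewrite /next_potential ltrBrDl.
      case: ltP => //= _; rewrite expr0 mulr1 /f/k -!mulrA -!expRD; congr (_ * expR _).
      ring.
    under eq_integral do rewrite npE.
    (* If the reserve alone covers the block, non-negative arrivals exclude a misfit. Otherwise B s
       > u gives [k s >= C], so that the mean of f is at least 1 as association requires. *)
    have [su|su] := leP (B s) u.
      apply: ge0_integral_le => //.
      + by apply: measurable_fun_ifT => //; [exact: measurable_fun_ltr|exact: measurable_funM].
      + exact: measurable_funM.
      + by move=> q; case: ifP => // _; rewrite mulr_ge0 ?expR_ge0.
      + move=> q; rewrite ifF//; apply/negbTE; rewrite -leNgt.
        by rewrite (le_trans _ (E0 q))// subr_le0.
    apply: integral_association => //.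
    + exact: measurable_fun_ltr.
    + exact: measurable_funM.
    + by move=> q; rewrite mulr_ge0 ?expR_ge0.
    + under eq_integral do rewrite EFinM.
      rewrite ge0_integralZl ?lee_fin//; last exact/measurable_EFinP.
      apply: (le_trans C_mgf); apply: lee_wpmul2r => //; rewrite lee_fin /k -mulrA.
      rewrite ler_peMr// -expRD -[leLHS]expR0 ler_expR.
      by rewrite addrC -mulrBr mulr_ge0// subr_ge0 ltW.
    + move=> q q' /= Eq; rewrite -leNgt => Eq'; rewrite /f ler_wpM2l// ler_expR lerN2.
      by rewrite !ler_wpM2l// ltW// (lt_le_trans Eq).
  apply: (@le_trans _ _ (\int[Pr]_s ((k s)%:E * mgfE))%E).
    apply: ge0_le_integral => //.
    + by move=> s _; apply: integral_ge0 => q _; rewrite lee_fin next_potential_ge0.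
    + apply: (@measurable_fun_fubini_tonelli_G _ _ _ _ _ Q _ mnp) => p.
      by rewrite lee_fin next_potential_ge0.
    + by apply: emeasurable_funM => //; apply/measurable_EFinP; exact: measurable_funM.
  have -> : (\int[Pr]_s ((k s)%:E * mgfE) =
      (C * expR (- (a * u)))%:E * (mgfE * mgfB))%E.
    under eq_integral do rewrite /k EFinM -muleA.
    rewrite ge0_integralZl//; first last.
    + by rewrite lee_fin mulr_ge0 ?expR_ge0.
    + by move=> s _; rewrite mule_ge0// lee_fin expR_ge0.
    + by apply: emeasurable_funM => //; exact/measurable_EFinP.
    congr (_ * _)%E; rewrite ge0_integralZr//; first by rewrite muleC.
    exact/measurable_EFinP.
  rewrite /mismatch_potential expr0 mulr1 -[leRHS]mule1.
  by apply: lee_wpmul2l => //; rewrite lee_fin mulr_ge0 ?expR_ge0.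
- pose K := C * expR (- (a * u)) * theta^-1 ^+ r.+1.
  have K0 : 0 <= K by exact: (mismatch_potential_ge0 r.+2 u).
  (* Apart from a factor depending on the arrival only, a fitting block contributes [expR (a * B s)]
     and a silenced one contributes [theta], the inverse of the factor lost in the potential. *)
  pose h v s := if v < B s then theta else expR (a * B s).
  have npE q s : next_potential r.+2 u (E q) (B s) =
      K * expR (- (a * (L%:R * E q))) * h (u + E q) s.
    rewrite /next_potential /h; case: ltP => /= _.
      have -> : - (a * (u + L%:R * E q)) = - (a * u) + - (a * (L%:R * E q)) by ring.
      rewrite expRD /K exprS; field.
      by rewrite gt_eqF.
    have -> : - (a * (u + L%:R * E q - B s)) =
      - (a * u) + - (a * (L%:R * E q)) + a * B s by ring.
    by rewrite !expRD /K; ring.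
  have mh v : measurable_fun setT (h v).
    by apply: measurable_fun_ifT => //; exact: measurable_fun_ltr.
  have h0 v s : 0 <= h v s by rewrite /h; case: ifP => _; [exact: ltW|exact: expR_ge0].
  have inner q : (\int[Pr]_s (next_potential r.+2 u (E q) (B s))%:E <=
      (K * expR (- (a * (L%:R * E q))))%:E * mgfB)%E.
    under eq_integral do rewrite npE EFinM.
    have Kq : 0 <= K * expR (- (a * (L%:R * E q))) by rewrite mulr_ge0 ?expR_ge0.
    rewrite ge0_integralZl//; last 2 first.
    + exact/measurable_EFinP.
    + by move=> s _; rewrite lee_fin.
    apply: lee_wpmul2l; first by rewrite lee_fin.
    apply: integral_association => //; first exact: measurable_fun_ltr.
    + exact: ltW.
    + move=> s s' /= us; rewrite -leNgt => us'; rewrite ler_expR ler_wpM2l//.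
      by rewrite ltW// (le_lt_trans us').
  apply: (@le_trans _ _ (\int[Q]_q ((K * expR (- (a * (L%:R * E q))))%:E * mgfB))%E).
    apply: ge0_le_integral => //.
    + by move=> q _; apply: integral_ge0 => s _; rewrite lee_fin next_potential_ge0.
    + apply: (@measurable_fun_fubini_tonelli_F _ _ _ _ _ Pr (fun p : T0 * T =>
        (next_potential r.+2 u (E p.1) (B p.2))%:E)).
        apply/measurable_EFinP; apply: measurable_next_potential => //.
          exact: (measurableT_comp mE measurable_fst).
        exact: (measurableT_comp mB measurable_snd).
      by move=> p; rewrite lee_fin next_potential_ge0.
    + by apply: emeasurable_funM => //; apply/measurable_EFinP; exact: measurable_funM.
  under eq_integral do rewrite EFinM -muleA.
  rewrite ge0_integralZl//; first last.
  + by move=> s _; rewrite mule_ge0// lee_fin expR_ge0.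
  + by apply: emeasurable_funM => //; exact/measurable_EFinP.
  rewrite ge0_integralZr//; last exact/measurable_EFinP.
  by rewrite -[leRHS]mule1; apply: lee_wpmul2l.
Qed.

End mismatch_step.

(** * The best-effort process *)

Section best_effort_process.
Context {R : realType}.
Variables (L n : nat).
Implicit Types (x : 'I_n -> R) (e : nat -> R).

Definition fits x e (l : nat) : bool :=
  block_energy L x l <= harvested L e l - spent L x e l.

Definition misfits x e (l : nat) : nat := (\sum_(m < l) ~~ fits x e m)%N.

(** The budget tested by the encoder is larger by the first arrival of block l ([fitsE]). Leaving
    that arrival out makes the reserve a function of the blocks before l alone, as decoupling past
    from present requires. *)
Definition reserve x e (l : nat) : R :=
  L%:R * (\sum_(m < l) e (m * L)%N) - spent L x e l.

Lemma harvestedE e l : (forall k, e k = e (k %/ L * L)%N) -> (0 < L)%N ->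
  harvested L e l = L%:R * (\sum_(m < l) e (m * L)%N) + e (l * L)%N.
Proof.
move=> eb L0; rewrite /harvested big_ord_recr/=; congr (_ + _).
elim: l => [|l IHl]; first by rewrite mul0n !big_ord0 mulr0.
rewrite mulSnr big_split_ord/= IHl big_ord_recr/= mulrDr; congr (_ + _).
rewrite (eq_bigr (fun=> e (l * L)%N)); last first.
  by move=> i _; rewrite eb divnMDl// divn_small ?addn0.
by rewrite sumr_const card_ord mulr_natl.
Qed.

Lemma fitsE x e l : (forall k, e k = e (k %/ L * L)%N) -> (0 < L)%N ->
  fits x e l = (block_energy L x l <= reserve x e l + e (l * L)%N).
Proof. by move=> eb L0; rewrite /fits harvestedE// addrAC. Qed.

Lemma reserveS x e l : reserve x e l.+1 = reserve x e l + L%:R * e (l * L)%N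
  - (if fits x e l then block_energy L x l else 0).
Proof. by rewrite /reserve big_ord_recr/= -/(fits x e l) mulrDr; ring. Qed.

Lemma be_input_fits x e k :
  be_input L x e k = if fits x e (k %/ L)%N then x k else 0.
Proof. by []. Qed.

Context {d : measure_display} {T : measurableType d}.
Variables (x : 'I_n -> T -> R) (e : nat -> T -> R).

Lemma measurable_block_energy l :
  (forall k : 'I_n, (k %/ L = l)%N -> measurable_fun setT (x k)) ->
  measurable_fun setT (fun t => block_energy L (x ^~ t) l).
Proof.
move=> mx; rewrite /block_energy.
under eq_fun do rewrite big_mkcond/=.
apply: measurable_sum => k; case: eqP => // kl.
by apply: measurable_funX; exact: mx.
Qed.

Lemma measurable_harvested l :
  (forall k, (k %/ L <= l)%N -> measurable_fun setT (e k)) -> (0 < L)%N ->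
  measurable_fun setT (fun t => harvested L (e ^~ t) l).
Proof.
move=> me L0; apply: measurable_sum => k; apply: me.
by rewrite -[leqRHS](mulnK _ L0) leq_div2r// -ltnS.
Qed.

Lemma measurable_spent l : (0 < L)%N ->
  (forall k : 'I_n, (k %/ L < l)%N -> measurable_fun setT (x k)) ->
  (forall k, (k %/ L < l)%N -> measurable_fun setT (e k)) ->
  measurable_fun setT (fun t => spent L (x ^~ t) (e ^~ t) l).
Proof.
move=> L0; elim: l => [|l IHl] mx me //=.
have ms : measurable_fun setT (fun t => spent L (x ^~ t) (e ^~ t) l).
  by apply: IHl => k kl; [apply: mx|apply: me]; exact: ltnW.
have mb : measurable_fun setT (fun t => block_energy L (x ^~ t) l).
  by apply: measurable_block_energy => k kl; apply: mx; rewrite kl.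
have mh : measurable_fun setT (fun t => harvested L (e ^~ t) l).
  exact: measurable_harvested.
apply: measurable_funD => //; apply: measurable_fun_ifT => //.
by apply: measurable_fun_ler => //; exact: measurable_funB.
Qed.

Lemma measurable_fits l : (0 < L)%N ->
  (forall k : 'I_n, (k %/ L <= l)%N -> measurable_fun setT (x k)) ->
  (forall k, (k %/ L <= l)%N -> measurable_fun setT (e k)) ->
  measurable_fun setT (fun t => fits (x ^~ t) (e ^~ t) l).
Proof.
move=> L0 mx me; apply: measurable_fun_ler.
  by apply: measurable_block_energy => k kl; apply: mx; rewrite kl.
apply: measurable_funB; first exact: measurable_harvested.
by apply: measurable_spent => // k /ltnW; [exact: mx|exact: me].
Qed.

Lemma measurable_misfits l : (0 < L)%N ->
  (forall k : 'I_n, (k %/ L < l)%N -> measurable_fun setT (x k)) ->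
  (forall k, (k %/ L < l)%N -> measurable_fun setT (e k)) ->
  measurable_fun setT (fun t => misfits (x ^~ t) (e ^~ t) l).
Proof.
move=> L0; elim: l => [|l IHl] mx me.
  rewrite /misfits; under eq_fun do rewrite big_ord0.
  exact: measurable_cst.
rewrite /misfits; under eq_fun do rewrite big_ord_recr/=.
apply: measurable_fun_addn.
  by apply: IHl => k kl; [apply: mx|apply: me]; exact: ltnW.
have mf : measurable_fun setT (fun t => fits (x ^~ t) (e ^~ t) l).
  exact: measurable_fits.
rewrite (_ : (fun _ => _) =
  (fun t => if fits (x ^~ t) (e ^~ t) l then 0%N else 1%N)).
  exact: measurable_fun_ifT.
by apply/funext => t; case: fits.
Qed.

Lemma measurable_reserve l : (0 < L)%N ->
  (forall k : 'I_n, (k %/ L < l)%N -> measurable_fun setT (x k)) ->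
  (forall k, (k %/ L < l)%N -> measurable_fun setT (e k)) ->
  measurable_fun setT (fun t => reserve (x ^~ t) (e ^~ t) l).
Proof.
move=> L0 mx me; apply: measurable_funB; last exact: measurable_spent.
apply: measurable_funM => //; apply: measurable_sum => m.
by apply: me; rewrite mulnK.
Qed.

Lemma measurable_be_input k : (0 < L)%N ->
  (forall k, measurable_fun setT (x k)) ->
  (forall k, measurable_fun setT (e k)) ->
  measurable_fun setT (fun t => be_input L (x ^~ t) (e ^~ t) k).
Proof. by move=> L0 mx me; apply: measurable_fun_ifT => //; exact: measurable_fits. Qed.

End best_effort_process.

(** The potential is taken at a random number of remaining mismatches. This number has finitely many
    values, so the composite is a finite sum of truncations. *)
Lemma measurable_nat_family (R : realType) d (T : measurableType d)
    (g : nat -> T -> R) (rho : T -> nat) (K : nat) :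
  (forall j, measurable_fun setT (g j)) -> measurable_fun setT rho ->
  (forall t, (rho t <= K)%N) -> measurable_fun setT (fun t => g (rho t) t).
Proof.
move=> mg mrho rhoK.
rewrite (_ : (fun _ => _) = fun t => \sum_(j < K.+1) (if rho t == j then g j t else 0)).
  apply: measurable_sum => j; apply: measurable_fun_ifT => //.
  apply: (measurable_fun_bool true); rewrite setTI.
  rewrite (_ : _ @^-1` _ = rho @^-1` [set nat_of_ord j]).
    by rewrite -[X in measurable X]setTI; exact: mrho.
  by apply/seteqP; split => t /=; [move/eqP|move=> ->; rewrite eqxx].
apply/funext => t; have rK : (rho t < K.+1)%N by rewrite ltnS.
rewrite (bigD1 (Ordinal rK))//= eqxx big1 ?addr0// => j jr.
by rewrite ifF//; apply/negbTE; apply: contraNN jr => /eqP rj; apply/eqP/val_inj.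
Qed.

(** * The energy constraint of the best-effort encoder *)

Section energy_constraint.
Context {R : realType}.
Variables (L n : nat) (x : 'I_n -> R) (e : nat -> R).
Hypotheses (L0 : (0 < L)%N) (e0 : forall k, 0 <= e k).

Lemma spent_le_harvested l : spent L x e l.+1 <= harvested L e l.
Proof.
have hS m : harvested L e m <= harvested L e m.+1.
  rewrite /harvested (big_ord_widen_cond (m.+1 * L).+1 predT e) ?ltnS ?leq_mul//.
  by rewrite [leRHS](bigID (fun i : 'I__ => (i < (m * L).+1)%N))/= lerDl sumr_ge0.
elim: l => [|l IHl]; first by rewrite /=; case: ifP; rewrite add0r subr0// => _; rewrite sumr_ge0.
have sl : spent L x e l.+1 <= harvested L e l.+1 := le_trans IHl (hS l).
have spentS m : spent L x e m.+1 = spent L x e m +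
    (if block_energy L x m <= harvested L e m - spent L x e m
     then block_energy L x m else 0) by [].
by rewrite spentS; case: ifP => [|_]; rewrite ?addr0// lerBrDl.
Qed.

(** A block is transmitted only if the arrivals up to its first symbol pay for all of it, so the
    constraint holds at every time inside the block and not only at its end. *)
Lemma be_input_energy (k : 'I_n) :
  \sum_(i < n | (i <= k)%N) be_input L x e i ^+ 2 <= \sum_(i < n | (i <= k)%N) e i.
Proof.
apply: (@le_trans _ _ (spent L x e (k %/ L).+1)).
  rewrite spentE [leRHS](bigID (fun i : 'I_n => (i <= k)%N))/=.
  rewrite (eq_bigl (fun i : 'I_n => (i %/ L < (k %/ L).+1)%N && (i <= k)%N)).
    by rewrite lerDl sumr_ge0// => i _; rewrite sqr_ge0.
  by move=> i /=; rewrite andb_idl// ltnS => ik; rewrite leq_div2r.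
apply: (le_trans (spent_le_harvested _)); rewrite /harvested.
have kn : ((k %/ L * L).+1 <= n)%N.
  by apply: leq_ltn_trans (ltn_ord k); exact: leq_divM.
rewrite (big_ord_widen n e kn).
rewrite [leRHS](bigID (fun i : 'I_n => (i < (k %/ L * L).+1)%N))/=.
rewrite (eq_bigl (fun i : 'I_n => (i <= k)%N && (i < (k %/ L * L).+1)%N)).
  by rewrite lerDl sumr_ge0.
move=> i /=; rewrite andb_idl// ltnS => ik.
by apply: leq_trans ik _; exact: leq_divM.
Qed.

End energy_constraint.

(** * Elementary inequalities and the normal cdf *)

Section exp_inequalities.
Context {R : realType}.
Implicit Types x y z : R.

Lemma expR_ge1DxD2 z : 0 <= z -> 1 + z + z ^+ 2 / 2 <= expR z.
Proof.
move=> z0; have -> : 1 + z + z ^+ 2 / 2 = series (exp_coeff z) 3.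
  rewrite /series/= !big_nat_recr//= big_nil /exp_coeff/= add0r expr0 divr1 expr1 divr1.
  by rewrite (_ : (2`!)%:R = 2 :> R).
apply: nondecreasing_cvgn_le; last exact: is_cvg_series_exp_coeff.
apply: nondecreasing_series => k _ _; rewrite /exp_coeff/=.
by rewrite divr_ge0// exprn_ge0.
Qed.

(** The quadratic Taylor polynomials at z and - z multiply to 1 + z^4 / 4 >= 1, so the lower bound
    for exp z inverts to the upper bound for exp (- z). *)
Lemma expRN_le z : 0 <= z -> expR (- z) <= 1 - z + z ^+ 2 / 2.
Proof.
move=> z0; have p0 : 0 < 1 - z + z ^+ 2 / 2 by nra.
rewrite expRN -[leRHS]invrK lef_pV2 ?posrE ?invr_gt0 ?expR_gt0//.
apply: le_trans (expR_ge1DxD2 z0); rewrite -[leLHS]mul1r ler_pdivrMr//.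
have -> : (1 + z + z ^+ 2 / 2) * (1 - z + z ^+ 2 / 2) = 1 + z ^+ 4 / 4 by field.
by rewrite lerDl divr_ge0// exprn_ge0.
Qed.

(** The expansion of - ln (1 - x) starts with x + x^2 / 2; asking for one quarter only leaves room
    for the crude estimate exp (- z) >= (1 - z / 3)^3. This quadratic gain is what [tilt_drift]
    spends. *)
Lemma onem_le_expR x : 0 <= x <= 1 -> 1 - x <= expR (- (x + x ^+ 2 / 4)).
Proof.
move=> /andP[x0 x1]; set z := x + x ^+ 2 / 4.
have z3 : 0 <= 1 - z / 3 by rewrite /z; nra.
have e3 : expR (- z) = expR (- (z / 3)) ^+ 3.
  by rewrite -expRM_natl; congr expR; field.
have le3 : (1 - z / 3) ^+ 3 <= expR (- z).
  by rewrite e3 lerXn2r ?nnegrE ?expR_ge0// expR_ge1Dx.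
apply: le_trans le3; rewrite /z.
have x2 : 0 <= x ^+ 2 by rewrite sqr_ge0.
have x3 : 0 <= x ^+ 3 by rewrite exprn_ge0.
suff : 0 <= x ^+ 2 * (1 / 12 + x / 6 + x ^+ 2 / 48 - x * (1 + x / 4) ^+ 3 / 27).
  by move=> H; rewrite -subr_ge0; apply: le_trans H _; rewrite le_eqVlt; apply/orP; left; apply/eqP; field.
rewrite mulr_ge0//.
have : (1 + x / 4) ^+ 3 <= 2 by nra.
by nra.
Qed.

(** The logarithm of the left side is x + x^2 + O(x^3), and 3 / 2 absorbs the remainder on this
    range. The left side is the moment generating function of a squared normal; the constant 3 / 2
    is the origin of the term 3 S^2 in [alpha]. *)
Lemma sqrt_mgf_le x : `|x| <= 1 / 8 ->
  (Num.sqrt (1 - 2 * x))^-1 <= expR (x + 3 / 2 * x ^+ 2).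
Proof.
rewrite ler_norml => /andP[x1 x2].
have s0 : 0 < 1 - 2 * x by lra.
rewrite -[leRHS]invrK -expRN lef_pV2 ?posrE ?sqrtr_gt0 ?expR_gt0//.
rewrite -[leLHS]ger0_norm ?expR_ge0// -sqrtr_sqr ler_sqrt ?(ltW s0)//.
rewrite -expRM_natl.
have -> : 2%:R * - (x + 3 / 2 * x ^+ 2) = - (2 * x + 3 * x ^+ 2) by field.
have [x0|x0] := leP 0 x.
  apply: le_trans (expRN_le _) _; first by nra.
  have : x ^+ 2 * (6 * x + 9 / 2 * x ^+ 2) <= x ^+ 2 * 1.
    by apply: ler_wpM2l; [exact: sqr_ge0|nra].
  by rewrite -subr_ge0 => H; rewrite -subr_ge0; apply: le_trans H _; rewrite le_eqVlt; apply/orP; left; apply/eqP; field.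
set y := - x; have y0 : 0 < y by rewrite oppr_gt0.
have y1 : y <= 1 / 8 by rewrite /y; lra.
have -> : x = - y by rewrite opprK.
set w := 2 * y - 3 * y ^+ 2.
have -> : - (2 * - y + 3 * (- y) ^+ 2) = w by rewrite /w; ring.
have w0 : 0 <= 1 - w / 2 by rewrite /w; nra.
have : (1 - w / 2) ^+ 2 <= expR (- w).
  have -> : expR (- w) = expR (- (w / 2)) ^+ 2 by rewrite -expRM_natl; congr expR; field.
  by rewrite lerXn2r ?nnegrE ?expR_ge0// expR_ge1Dx.
move=> H.
have : 1 <= (1 + 2 * y) * (1 - w / 2) ^+ 2.
  rewrite /w -subr_ge0.
  have -> : (1 + 2 * y) * (1 - (2 * y - 3 * y ^+ 2) / 2) ^+ 2 - 1 =
     y ^+ 3 * (5 - 15 / 4 * y + 9 / 2 * y ^+ 2) by field.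
  by rewrite mulr_ge0 ?exprn_ge0 ?(ltW y0)//; nra.
move=> H2.
have w3 : 1 <= (1 + 2 * y) * expR (- w).
  by apply: le_trans H2 _; rewrite ler_wpM2l//; lra.
have ew : expR (- w) * expR w = 1 by rewrite mulrC expRxMexpNx_1.
by rewrite mulrN opprK; have := ler_wpM2r (expR_ge0 w) w3; rewrite mul1r -mulrA ew mulr1.
Qed.

End exp_inequalities.

Section dilated_gaussian.
Context {R : realType}.
Local Notation N01 := (normal_prob (0 : R) 1).

(** For v < 1 / 4 the right side exceeds 1. Otherwise the 1-Lipschitz bound on [Phi] applies to x /
    sqrt v - x, whose denominator stays away from 0. The error is linear in the deviation of v,
    ready to be averaged over the noise energy. *)
Lemma normal_dilated_cdf (x v : R) : 0 <= v ->
  (N01 [set h | Num.sqrt v * h < x]%R <= (Phi x + 2 * (1 + `|x|) * `|v - 1|)%:E)%E.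
Proof.
move=> v0; have x0 := normr_ge0 x; have P0 := Phi_ge0 x.
have mD : measurable [set h : R | Num.sqrt v * h < x].
  have mt : measurable_fun [set: R] (fun z => Num.sqrt v * z) by exact: measurable_funM.
  have := measurable_fun_ltr mt (measurable_cst x) measurableT (Y := [set true]).
  by rewrite setTI; exact.
have [v4|v4] := ltP v (1 / 4).
  apply: (@le_trans _ _ 1%E); first exact: probability_le1.
  have -> : `|v - 1| = 1 - v by rewrite ler0_norm ?opprB//; lra.
  rewrite lee_fin; nra.
have sv : 0 < Num.sqrt v by rewrite sqrtr_gt0; lra.
have sv2 : Num.sqrt v ^+ 2 = v by rewrite sqr_sqrtr.
have svh : 1 / 2 <= Num.sqrt v by nra.
apply: (@le_trans _ _ (N01 `]-oo, x / Num.sqrt v])).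
  apply: le_measure; rewrite ?inE// => h /=.
  by rewrite in_itv/= => /ltW; rewrite mulrC -ler_pdivlMr.
rewrite -PhiE lee_fin.
have lip : Phi (x / Num.sqrt v) <= Phi x + `|x / Num.sqrt v - x|.
  have [le|/ltW le] := lerP x (x / Num.sqrt v).
    exact: Phi_lipschitz.
  by apply: (le_trans (Phi_le le)); rewrite lerDl; lra.
apply: le_trans lip _; rewrite lerD2l.
have -> : x / Num.sqrt v - x = x * (1 - v) / (Num.sqrt v * (1 + Num.sqrt v)).
  by rewrite -{2}sv2; field; rewrite !gt_eqF//; lra.
rewrite normrM normfV normrM (gtr0_norm (_ : 0 < Num.sqrt v * (1 + Num.sqrt v))); last first.
  by rewrite mulr_gt0//; lra.
rewrite distrC ler_pdivrMr; last by rewrite mulr_gt0//; lra.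
have v1 := normr_ge0 (v - 1).
apply: (@le_trans _ _ (2 * (1 + `|x|) * `|v - 1| * (1/2))).
  have := mulr_ge0 x0 v1; nra.
apply: ler_wpM2l; last by nra.
by rewrite !mulr_ge0//; lra.
Qed.

(** Trades an absolute deviation for two exponential moments, which are explicit for the noise
    energy. *)
Lemma normr_le_expR (u : R) : `|u| <= expR u + expR (- u).
Proof.
have a1 := expR_ge1Dx u; have a2 := expR_ge1Dx (- u).
have b1 := expR_ge0 u; have b2 := expR_ge0 (- u).
by rewrite ler_norml; apply/andP; split; lra.
Qed.

End dilated_gaussian.

Section quantile.
Context {R : realType}.
Local Notation N01 := (normal_prob (0 : R) 1).

(** A Chernoff bound with parameter 1, enough to see that the set defining [Phi_inv] is bounded
    below. *)
Lemma Phi_opp_le (u : R) : Phi (- u) <= expR (1 / 2 - u).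
Proof.
have mn : measurable_fun [set: R] (fun z : R => -1 * z) by exact: measurable_funM.
have mN : measurable_fun setT (fun z : R => expR (- u) * expR (-1 * z)).
  apply: measurable_funM => //.
  exact: (measurableT_comp (@measurable_expR R) mn).
rewrite -lee_fin PhiE.
apply: (@le_trans _ _ (\int[N01]_z (expR (- u) * expR (-1 * z))%:E)%E).
  apply: prob_le_integral => //.
  move=> z /=; rewrite in_itv/= => zu.
  by rewrite -expRD -[leLHS]expR0 ler_expR; lra.
under eq_integral do rewrite EFinM.
rewrite ge0_integralZl//; last first.
  apply/measurable_EFinP; exact: (measurableT_comp (@measurable_expR R) mn).
rewrite integral_normal_expR -EFinM -expRD lee_fin ler_expR; lra.
Qed.

(** The normal density is bounded below near the quantile, so lowering the threshold by eta frees a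
    probability proportional to eta. All O(1 / sqrt n) error terms will be charged to it. *)
Lemma Phi_inv_below (p : R) : 0 < p -> exists2 k, 0 < k &
  forall eta, 0 < eta <= 1 -> Phi (Phi_inv p - eta) + k * eta <= p.
Proof.
move=> p0; set t := Phi_inv p.
have lb : has_lbound [set x : R | p <= Phi x].
  exists (- (3 / 2 - ln p)) => x /= px; rewrite leNgt; apply/negP => xu.
  have := le_trans px (le_trans (Phi_le (ltW xu)) (Phi_opp_le _)).
  have -> : 1 / 2 - (3 / 2 - ln p) = -1 + ln p by lra.
  rewrite expRD lnK ?posrE// leNgt => /negP; apply.
  by rewrite gtr_pMl// expR_lt1; lra.
have below x : x < t -> Phi x <= p.
  move=> xt; rewrite leNgt; apply/negP => px.
  by have := ge_inf lb (ltW px : [set x : R | p <= Phi x] x); rewrite leNgt xt.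
pose b := 1 + `|t|.
pose k : R := normal_peak 1 * expR (- (b ^+ 2 / 2)).
have k0 : 0 < k by rewrite mulr_gt0 ?expR_gt0// normal_peak_gt0// oner_eq0.
have kz z : t - 1 <= z <= t -> k <= normal_pdf 0 1 z.
  move=> /andP[z1 z2]; rewrite normal_pdf_sqr ?oner_eq0//.
  apply: ler_wpM2l; first exact: normal_peak_ge0.
  rewrite ler_expR subr0 expr1n divr1 lerN2 ler_pM2r ?invr_gt0//.
  rewrite -(real_normK (num_real z)); apply: lerXn2r; rewrite ?nnegrE ?addr_ge0//.
  have [h1 h2] := (ler_norm t, ler_norm (- t)); rewrite normrN in h2.
  by rewrite ler_norml /b; apply/andP; split; lra.
exists (k / 2); first by rewrite divr_gt0.
move=> eta /andP[eta0 eta1].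
have inc : Phi (t - eta) + k * (t - eta / 2 - (t - eta)) <= Phi (t - eta / 2).
  apply: Phi_increment; [lra|exact: ltW|] => z /andP[z1 z2].
  by apply: kz; apply/andP; split; lra.
have bel : Phi (t - eta / 2) <= p by apply: below; lra.
apply: le_trans bel; apply: le_trans inc; rewrite lerD2l le_eqVlt; apply/orP; left.
by apply/eqP; field.
Qed.

End quantile.

(** * Moments of the energy and the tilt *)

Section energy_moments.
Context {R : realType} {d : measure_display} {T : measurableType d}.
Variables (Q : probability T R) (E : {RV Q >-> R}) (P m2 : R).
Hypotheses (E_ge0 : forall t, 0 <= E t) (E_mean : ('E_Q[E] = P%:E)%E)
  (E_m2 : ('E_Q[(fun t => (E t ^+ 2)%R)] = m2%:E)%E).

Let mean : (\int[Q]_t (E t)%:E = P%:E)%E.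
Proof. by have := E_mean; rewrite unlock. Qed.

Let moment2 : (\int[Q]_t (E t ^+ 2)%:E = m2%:E)%E.
Proof. by have := E_m2; rewrite unlock. Qed.

Let mE : measurable_fun setT E.
Proof. exact: measurable_funP. Qed.

Let mE2 : measurable_fun setT (fun t => E t ^+ 2).
Proof. exact: measurable_funX. Qed.

Let mexpE y : measurable_fun setT (fun t => expR (- (y * E t))).
Proof. by do 2 apply: measurableT_comp => //; exact: measurable_funM. Qed.

(** Inequalities with a subtraction are integrated after moving the negative term [c * g] to the
    other side, so that all integrands are non-negative. *)
Let integral_lin (f : T -> R) (c : R) (g : T -> R) (J : R) : 0 <= c ->
  measurable_fun setT f -> measurable_fun setT g ->
  (forall t, 0 <= f t) -> (forall t, 0 <= g t) -> (\int[Q]_t (g t)%:E = J%:E)%E ->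
  (\int[Q]_t (f t + c * g t)%:E = \int[Q]_t (f t)%:E + (c * J)%:E)%E.
Proof.
move=> c0 mf mg f0 g0 gJ.
under eq_integral do rewrite EFinD EFinM.
rewrite ge0_integralD//.
- rewrite ge0_integralZl ?lee_fin ?gJ//; first exact/measurable_EFinP.
  by move=> t _; rewrite lee_fin.
- by move=> t _; rewrite lee_fin.
- exact/measurable_EFinP.
- by move=> t _; rewrite -EFinM lee_fin mulr_ge0.
- by apply: emeasurable_funM => //; exact/measurable_EFinP.
Qed.

Lemma sqr_mean_le : 0 <= P -> P ^+ 2 <= m2.
Proof.
move=> P0; have P20 : 0 <= 2 * P by lra.
have H : (\int[Q]_t (0 + 2 * P * E t)%:E <= \int[Q]_t (P ^+ 2 + 1 * E t ^+ 2)%:E)%E.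
  apply: ge0_integral_le.
  - by apply: measurable_funD => //; exact: measurable_funM.
  - by apply: measurable_funD => //; exact: measurable_funM.
  - by move=> t; rewrite add0r mulr_ge0.
  - by move=> t; have := sqr_ge0 (P - E t); nra.
move: H; rewrite (@integral_lin (fun=> 0) _ E P)// (@integral_lin (fun=> P ^+ 2) 1 _ m2)//.
- by rewrite !prob_integral_cst -!EFinD lee_fin; lra.
- by move=> t; exact: sqr_ge0.
- by move=> t; exact: sqr_ge0.
Qed.

Lemma energy_mgf_le (y : R) : 0 <= y ->
  (\int[Q]_t (expR (- (y * E t)))%:E <= (1 - (y * P - y ^+ 2 * m2 / 2))%:E)%E.
Proof.
move=> y0; have y20 : 0 <= y ^+ 2 / 2 by rewrite divr_ge0 ?sqr_ge0.
have H : (\int[Q]_t (expR (- (y * E t)) + y * E t)%:E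
    <= \int[Q]_t (1 + y ^+ 2 / 2 * E t ^+ 2)%:E)%E.
  apply: ge0_integral_le.
  - by apply: measurable_funD => //; exact: measurable_funM.
  - by apply: measurable_funD => //; exact: measurable_funM.
  - by move=> t; rewrite addr_ge0 ?expR_ge0// mulr_ge0.
  - move=> t; have := expRN_le (mulr_ge0 y0 (E_ge0 t)); rewrite exprMn.
    by move=> h; lra.
move: H; rewrite (integral_lin y0 (mexpE y) mE _ E_ge0 mean)//.
rewrite (@integral_lin (fun=> 1) _ _ m2)//; last by move=> t; exact: sqr_ge0.
rewrite prob_integral_cst -EFinD -leeBrDr// -EFinB.
by move=> /le_trans; apply; rewrite lee_fin; lra.
Qed.

Lemma energy_mgf_ge (y : R) : 0 <= y ->
  ((1 - y * P)%:E <= \int[Q]_t (expR (- (y * E t)))%:E)%E.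
Proof.
move=> y0.
have H : (\int[Q]_t (1 : R)%:E <= \int[Q]_t (expR (- (y * E t)) + y * E t)%:E)%E.
  apply: ge0_integral_le => //.
  - by apply: measurable_funD => //; exact: measurable_funM.
  - by move=> t; have := expR_ge1Dx (- (y * E t)); lra.
move: H; rewrite prob_integral_cst (integral_lin y0 (mexpE y) mE _ E_ge0 mean)//.
by rewrite EFinB leeBlDr.
Qed.

End energy_moments.

(** * The tilt of the supermartingale and the constant gamma *)

Section mismatch_parameters.
Context {R : realType}.
Variables (P m2 l2 l rho : R).
Hypotheses (P0 : 0 < P) (Pm2 : P ^+ 2 <= m2) (l20 : 0 < l2) (l1 : 1 <= l) (rho0 : 0 < rho).

Let S := P * (1 - rho).
Let den := l * m2 + 3 * S ^+ 2.
Let alph := 2 * rho * P / den.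
Let bet := alph / (1 + 63 * alph * S).
Let gam := l2 / (l * P * bet + l ^+ 2 * alph ^+ 2 * m2 / 2).
Let u := l * alph.

Let ctx : [/\ 0 < P, P ^+ 2 <= m2, 0 < l2, 1 <= l & 0 < rho].
Proof. by []. Qed.

Let m20 : 0 < m2.
Proof. by apply: lt_le_trans Pm2; rewrite exprn_gt0. Qed.

Let l0 : 0 < l.
Proof. by apply: lt_le_trans l1. Qed.

Let den0 : 0 < den.
Proof. by apply: ltr_wpDr; [rewrite mulr_ge0 ?sqr_ge0|exact: mulr_gt0]. Qed.

Lemma alpha_gt0 : 0 < alph.
Proof. by apply: divr_gt0 => //; do 2 apply: mulr_gt0 => //. Qed.

Hypothesis rho32 : rho <= 1 / 32.

Let S0 : 0 < S.
Proof. by have r := rho32; rewrite /S mulr_gt0//; lra. Qed.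

Let SP : S <= P.
Proof. by have [p0 _ _ _ r] := ctx; rewrite /S; nra. Qed.

Lemma block_alpha_gt0 : 0 < u.
Proof. by rewrite mulr_gt0 ?alpha_gt0. Qed.

(** This is the drift equation u S + 3/2 u^2 S^2 / l = u P - u^2 m2 / 2 divided by u / 2, with P - S
    = rho P. *)
Lemma block_alpha_eq : u * (m2 + 3 * S ^+ 2 / l) = 2 * rho * P.
Proof.
have l_neq0 : l != 0 by rewrite gt_eqF.
have den_neq0 : l * m2 + 3 * S ^+ 2 != 0 by rewrite gt_eqF.
by rewrite /u /alph /den; field; rewrite l_neq0.
Qed.

Lemma block_alpha_le : u * m2 <= 2 * rho * P.
Proof.
rewrite -block_alpha_eq; apply: ler_wpM2l; first exact: ltW block_alpha_gt0.
by rewrite lerDl; apply: divr_ge0; [rewrite mulr_ge0 ?sqr_ge0|exact: ltW].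
Qed.

Lemma block_alpha_ge : 2 * rho * P <= u * (m2 + 3 * P ^+ 2).
Proof.
rewrite -block_alpha_eq; apply: ler_wpM2l; first exact: ltW block_alpha_gt0.
have [p0 _ _ q1 _] := ctx; have s0 := S0; have sP := SP.
rewrite lerD2l ler_pdivrMr//.
have h : 3 * S ^+ 2 <= 3 * P ^+ 2 by nra.
by have := sqr_ge0 P; nra.
Qed.

Lemma block_alphaP_le : u * P <= 2 * rho.
Proof.
have h := block_alpha_le; have u0 := block_alpha_gt0.
rewrite -(ler_pM2r P0); apply: le_trans h; rewrite -mulrA -expr2.
by apply: ler_wpM2l => //; exact: ltW.
Qed.

(** Raising the tilt by the factor 1 + d costs an extra drift y d rho P, to be covered by (y P /
    2)^2 / 4, that is d rho P <= y P^2 / 16. Since 2 rho P <= y (m2 + 3 P^2), this value of d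
    suffices. *)
Let d := P ^+ 2 / (8 * (m2 + 3 * P ^+ 2)).

Lemma slack_itv : 0 < d <= 1 / 32.
Proof.
have P20 : 0 < P ^+ 2 by rewrite exprn_gt0.
have e0 : 0 < 8 * (m2 + 3 * P ^+ 2) by have := m20; lra.
by rewrite divr_gt0//= ler_pdivrMr//; have := Pm2; lra.
Qed.

(** The exponent per unit of the energy variable E. The supermartingale uses y / l per unit of
    reserve, and a block delivers l times E. *)
Let y := (1 + d) * u.

Lemma tilt_gt0 : 0 < y.
Proof. by have /andP[? ?] := slack_itv; rewrite mulr_gt0 ?block_alpha_gt0//; lra. Qed.

Lemma tilt_le : y * P <= 4 * rho /\ y * m2 <= 4 * rho * P.
Proof.
have /andP[? ?] := slack_itv; have := block_alphaP_le; have := block_alpha_le.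
have u0 := block_alpha_gt0.
have uP : 0 < u * P by rewrite mulr_gt0.
have um : 0 < u * m2 by rewrite mulr_gt0.
by rewrite /y => h1 h2; split; nra.
Qed.

(* The gain x^2 / 4 over 1 - x <= exp (-x) pays for the relative excess d of
   the tilt y over l * alpha. *)
Lemma tilt_drift : let x := y * P - y ^+ 2 * m2 / 2 in
  0 <= x <= 1 /\ y * S + 3 / 2 * y ^+ 2 * S ^+ 2 / l <= x + x ^+ 2 / 4.
Proof.
move=> x; have [yP ym] := tilt_le; have y0 := tilt_gt0; have u0 := block_alpha_gt0.
have /andP[d0 d1] := slack_itv.
have yP0 : 0 < y * P by rewrite mulr_gt0.
have xP : y * P / 2 <= x.
  have : y ^+ 2 * m2 <= y * P.
    rewrite expr2 -mulrA; apply: ler_wpM2l; first exact: ltW.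
    by apply: (le_trans ym); have := P0; have := rho32; nra.
  by rewrite /x; lra.
have x1 : x <= y * P by rewrite /x gerBl divr_ge0// mulr_ge0 ?sqr_ge0// ltW.
have r32 := rho32; split; first by apply/andP; split; lra.
have E1 : y * (m2 + 3 * S ^+ 2 / l) = (1 + d) * (2 * rho * P).
  by rewrite -block_alpha_eq /y mulrA.
have l_neq0 : l != 0 by rewrite gt_eqF.
have E2 : y * S + 3 / 2 * y ^+ 2 * S ^+ 2 / l =
    y * S + y / 2 * (y * (m2 + 3 * S ^+ 2 / l)) - y ^+ 2 * m2 / 2 by field.
rewrite E2 E1.
have E3 : y * S + y / 2 * ((1 + d) * (2 * rho * P)) - y ^+ 2 * m2 / 2 =
   x + y * (d * (rho * P)) by rewrite /x /S; field.
rewrite E3 lerD2l.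
have x2 : (y * P / 2) ^+ 2 <= x ^+ 2 by rewrite ler_sqr ?nnegrE; lra.
apply: (@le_trans _ _ ((y * P / 2) ^+ 2 / 4)); last by lra.
have -> : (y * P / 2) ^+ 2 / 4 = y * (y * P ^+ 2 / 16) by field.
apply: ler_wpM2l; first exact: ltW.
have e0 : 0 < 8 * (m2 + 3 * P ^+ 2) by have := m20; have := sqr_ge0 P; lra.
have dE : d * (8 * (m2 + 3 * P ^+ 2)) = P ^+ 2 by rewrite divfK// gt_eqF.
have := block_alpha_ge => h.
have h2 : 2 * (rho * P) <= y * (m2 + 3 * P ^+ 2).
  apply: (le_trans (_ : _ <= u * (m2 + 3 * P ^+ 2))); first by lra.
  by rewrite ler_pM2r /y; [nra|lra].
rewrite -dE.
have := ler_wpM2l (ltW d0) h2; lra.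
Qed.

Lemma gamma_denominator : 0 < l * P * bet + l ^+ 2 * alph ^+ 2 * m2 / 2 /\
  l * P * bet + l ^+ 2 * alph ^+ 2 * m2 / 2 <= u * P * (1 + rho).
Proof.
have a0 := alpha_gt0; have u0 := block_alpha_gt0.
have aS : 0 <= 63 * alph * S by rewrite mulr_ge0 ?(ltW S0)// mulr_ge0// ltW.
have b0 : 0 < bet by rewrite divr_gt0//; lra.
have ba : bet <= alph by rewrite ler_pdivrMr; nra.
have lP : 0 < l * P by rewrite mulr_gt0//; lra.
have -> : l ^+ 2 * alph ^+ 2 * m2 / 2 = u * (u * m2) / 2 by rewrite /u; field.
have um : 0 < u * m2 by rewrite mulr_gt0.
split.
  apply: addr_gt0; first exact: mulr_gt0.
  by apply: divr_gt0 => //; exact: mulr_gt0.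
have h1 : l * P * bet <= u * P.
  by rewrite /u [leRHS]mulrAC; apply: ler_wpM2l => //; exact: ltW.
have h2 : u * (u * m2) <= u * (2 * rho * P).
  by apply: ler_wpM2l; [exact: ltW|exact: block_alpha_le].
by lra.
Qed.

Lemma gamma_gt0 : 0 < gam.
Proof. by have [? _] := gamma_denominator; rewrite divr_gt0. Qed.

Lemma gamma_ge : l2 / (4 * rho) <= gam.
Proof.
have [D0 D1] := gamma_denominator; have uP := block_alphaP_le.
apply: ler_wpM2l; first exact: ltW.
rewrite lef_pV2 ?posrE//; last by rewrite mulr_gt0.
apply: (le_trans D1); have := block_alpha_gt0; have := P0; have := rho32.
move: uP; set v := u * P => vr r1 p0 u0.
have v0 : 0 < v by rewrite mulr_gt0.
by have := rho0; nra.
Qed.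

Lemma gamma_le : gam <= 32 * l2 * (m2 + 3 * P ^+ 2) / (P ^+ 2 * rho).
Proof.
have a0 := alpha_gt0; have u0 := block_alpha_gt0; have [D0 _] := gamma_denominator.
have aS0 : 0 <= alph * S by rewrite mulr_ge0// ltW// S0.
have aS : alph * S <= 1.
  have := block_alphaP_le => h; apply: (le_trans _ (_ : u * P <= 1)); last by have := rho32; lra.
  rewrite /u -mulrA; apply: (le_trans _ (_ : 1 * (alph * P) <= _)).
    by rewrite mul1r; apply: ler_wpM2l => //; exact: ltW.
  by apply: ler_wpM2r => //; rewrite mulr_ge0// ltW.
(* Here 64 is 1 + 63, because [alph * S] is at most 1. *)
have b1 : alph / 64 <= bet.
  apply: ler_wpM2l; first exact: ltW.
  by rewrite lef_pV2 ?posrE//; lra.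
have D1 : u * P / 64 <= l * P * bet + l ^+ 2 * alph ^+ 2 * m2 / 2.
  apply: (@le_trans _ _ (l * P * bet)).
    have -> : u * P / 64 = l * P * (alph / 64) by rewrite /u; field.
    by apply: ler_wpM2l => //; rewrite mulr_ge0// ltW.
  by rewrite lerDl -exprMn divr_ge0// mulr_ge0 ?sqr_ge0// ltW.
have uP0 : 0 < u * P by rewrite mulr_gt0.
have w0 : 0 < m2 + 3 * P ^+ 2 by have := m20; have := sqr_ge0 P; lra.
rewrite ler_pdivlMr ?mulr_gt0 ?exprn_gt0//.
rewrite /gam mulrAC ler_pdivrMr//.
apply: (@le_trans _ _ (32 * l2 * (m2 + 3 * P ^+ 2) * (u * P / 64))); last first.
  by apply: ler_wpM2l D1; rewrite !mulr_ge0// ltW.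
have -> : 32 * l2 * (m2 + 3 * P ^+ 2) * (u * P / 64) =
   (l2 * P / 2) * (u * (m2 + 3 * P ^+ 2)) by field.
have -> : l2 * (P ^+ 2 * rho) = (l2 * P / 2) * (2 * rho * P) by field.
apply: ler_wpM2l block_alpha_ge.
by rewrite divr_ge0// mulr_ge0// ltW.
Qed.

Hypothesis rho_small : rho * (16 + 4 * l2) <= l2 * d.

Lemma gamma_ge1 : 1 <= gam.
Proof.
apply: (le_trans _ gamma_ge); rewrite ler_pdivlMr ?mulr_gt0// mul1r.
by have /andP[? ?] := slack_itv; have [_ _ ? _ ?] := ctx; have := rho_small; nra.
Qed.

(** The right side is at least l2 (1 + d) (1 - rho) / (1 + rho); its surplus l2 d is fixed, while
    all it must cover is O(rho). Of the term 4 y P, one half pays for C <= exp (2 y P), the other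
    for the two factors theta <= exp (y P) by which the exponent [N.-1] may fall short of gamma. *)
Lemma tilt_gamma : 4 * (y * P) + l2 <= y * S * gam.
Proof.
have [yP _] := tilt_le; have /andP[d0 d1] := slack_itv.
have [D0 D1] := gamma_denominator; have u0 := block_alpha_gt0.
apply: (@le_trans _ _ (16 * rho + l2)); first by lra.
have uP0 : 0 < u * P by rewrite mulr_gt0.
apply: (@le_trans _ _ (y * S * (l2 / (u * P * (1 + rho))))); last first.
  apply: ler_wpM2l; first by rewrite mulr_ge0// ltW// ?S0// tilt_gt0.
  by apply: ler_wpM2l; rewrite ?lef_pV2 ?posrE//; [exact: ltW|rewrite mulr_gt0//; have := rho0; lra].
have -> : y * S * (l2 / (u * P * (1 + rho))) = l2 * (1 + d) * ((1 - rho) / (1 + rho)).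
  rewrite /y /S; field; rewrite !gt_eqF//; have := rho0; lra.
have h : 1 - 2 * rho <= (1 - rho) / (1 + rho).
  by rewrite ler_pdivlMr; have := rho0; nra.
apply: (@le_trans _ _ (l2 * (1 + d) * (1 - 2 * rho))); last first.
  by apply: ler_wpM2l h; rewrite mulr_ge0//; [exact: ltW|lra].
have := rho_small; have := rho0; have := l20 => a b.
have h3 : l2 * d * rho <= l2 * rho.
  by rewrite ler_pM2r// ler_piMr//; [exact: ltW|lra].
lra.
Qed.

Lemma mismatch_tail_constant (N : nat) : (0 < N)%N -> gam - 1 <= N%:R ->
  (1 - y * P)^-1 * (expR (y * S))^-1 ^+ N.-1 <= expR (- l2).
Proof.
move=> N0 gN; have [yP _] := tilt_le; have y0 := tilt_gt0.
have yP0 : 0 < y * P by rewrite mulr_gt0.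
have yS0 : 0 < y * S by rewrite mulr_gt0// S0.
have ySP : y * S <= y * P by apply: ler_wpM2l SP; exact: ltW.
have C1 : (1 - y * P)^-1 <= expR (2 * (y * P)).
  rewrite -[leRHS]invrK -expRN lef_pV2 ?posrE ?expR_gt0//; last by have := rho32; lra.
  apply: (le_trans (expRN_le _)); first by lra.
  have yP8 : y * P <= 1 / 8 by have := rho32; lra.
  by nra.
apply: (@le_trans _ _ (expR (2 * (y * P)) * (expR (y * S))^-1 ^+ N.-1)).
  by apply: ler_wpM2r C1; rewrite exprn_ge0// invr_ge0 expR_ge0.
rewrite -expRN -expRM_natl -expRD ler_expR.
have -> : N.-1%:R = N%:R - 1 :> R by rewrite -{2}(prednK N0) -natr1 addrK.
have := tilt_gamma; nra.
Qed.

End mismatch_parameters.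

(** * Asymptotics of the parameters *)

Section rate_asymptotics.
Context {R : realType}.
Variables (P m2 eps2 : R).
Hypotheses (P0 : 0 < P) (Pm2 : P ^+ 2 <= m2) (eps2_itv : 0 < eps2 < 1).

Definition total_lambda (L n : nat) : R :=
  lambda1 P * L%:R + lambda2 P * ln n%:R.
Definition growth (L n : nat) : R := Num.max (ln n%:R) L%:R.
(** The part of [total_lambda] beyond the block energy bound, per unit of [growth]; see
    [slack_ge]. *)
Definition slack_constant : R := Num.min (ln (1 + P) / 2) 1.
Definition lambda_constant : R := lambda1 P + lambda2 P.
Definition rho_lower : R :=
  slack_constant * (P + 1) * m2 * ln (1 / eps2) / P ^+ 3.
Definition rho_upper : R :=
  lambda_constant * (P + 1) * (m2 + 3 * P ^+ 2) * ln (1 / eps2) / P ^+ 3.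

Let m20 : 0 < m2.
Proof. by apply: lt_le_trans Pm2; rewrite exprn_gt0. Qed.

Lemma ln_inv_gt0 : 0 < ln (1 / eps2).
Proof.
by have /andP[e0 e1] := eps2_itv; rewrite ln_gt0// ltr_pdivlMr// mul1r.
Qed.

Let lnP0 : 0 < ln (1 + P).
Proof. by rewrite ln_gt0// ltrDl. Qed.

Let ln20 : 0 < ln (2 : R).
Proof. by rewrite ln_gt0// ltr1n. Qed.

Lemma slack_constant_gt0 : 0 < slack_constant.
Proof. by rewrite lt_min divr_gt0//= ltr01. Qed.

Lemma lambda_constant_gt0 : 0 < lambda_constant.
Proof.
have [p0 q0 q1] := And3 P0 lnP0 ln20.
by rewrite /lambda_constant /lambda1 /lambda2; have := mulr_gt0 p0 q1; lra.
Qed.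

Lemma rho_lower_gt0 : 0 < rho_lower.
Proof.
rewrite divr_gt0 ?exprn_gt0// !mulr_gt0 ?slack_constant_gt0 ?ln_inv_gt0//.
by have := P0; lra.
Qed.

Lemma rho_upper_gt0 : 0 < rho_upper.
Proof.
rewrite divr_gt0 ?exprn_gt0// !mulr_gt0 ?lambda_constant_gt0 ?ln_inv_gt0//.
  by have := P0; lra.
by have := m20; have := sqr_ge0 P; lra.
Qed.

Variables (L n : nat).
Hypotheses (L0 : (0 < L)%N) (n0 : (0 < n)%N).

Let l1 : 1 <= L%:R :> R.
Proof. by rewrite ler1n. Qed.

Let l0 : 0 < L%:R :> R.
Proof. by rewrite ltr0n. Qed.

Let nR0 : 0 < n%:R :> R.
Proof. by rewrite ltr0n. Qed.

Let lnn0 : 0 <= ln n%:R :> R.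
Proof. by rewrite ln_ge0// ler1n. Qed.

Lemma growth_ge1 : 1 <= growth L n.
Proof. by rewrite /growth le_max l1 orbT. Qed.

Let mx0 : 0 < growth L n.
Proof. by apply: lt_le_trans growth_ge1. Qed.

Lemma slack_ge :
  slack_constant * growth L n <= ln (1 + P) / 2 * L%:R + ln n%:R.
Proof.
have c0 := slack_constant_gt0; have lp := lnP0; have [q0 q1] := conj lnn0 l1.
have ca : slack_constant <= ln (1 + P) / 2 by rewrite ge_min lexx.
have cb : slack_constant <= 1 by rewrite ge_min lexx orbT.
by rewrite /growth maxEle; case: ifP => _; nra.
Qed.

Lemma total_lambdaE : total_lambda L n =
  (2 * P * ln 2 * L%:R + 8 * P * ln n%:R) + (ln (1 + P) / 2 * L%:R + ln n%:R).
Proof. by rewrite /total_lambda /lambda1 /lambda2; ring. Qed.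

Lemma total_lambda_ge : slack_constant * growth L n <= total_lambda L n.
Proof.
apply: (le_trans slack_ge); rewrite total_lambdaE lerDr.
by rewrite addr_ge0// !mulr_ge0// ltW.
Qed.

Lemma total_lambda_le : total_lambda L n <= lambda_constant * growth L n.
Proof.
rewrite /total_lambda /lambda_constant [leRHS]mulrDl.
have a0 : 0 <= lambda1 P by rewrite /lambda1 addr_ge0// ?mulr_ge0// ltW// mulr_gt0.
have b0 : 0 <= lambda2 P by rewrite /lambda2 addr_ge0// mulr_ge0// ltW.
by apply: lerD; apply: ler_wpM2l => //; rewrite /growth le_max lexx ?orbT.
Qed.

Let lam0 : 0 < total_lambda L n.
Proof.
by apply: lt_le_trans total_lambda_ge; rewrite mulr_gt0 ?slack_constant_gt0.
Qed.

Local Notation r := (rho P m2 eps2 L n).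

Lemma rho_sqr : r ^+ 2 = total_lambda L n * (P + 1) * (L%:R * m2 + 3 * P ^+ 2)
  * ln (1 / eps2) / (P ^+ 3 * L%:R * n%:R).
Proof.
have P1 : 0 < P + 1 by have := P0; lra.
have D0 : 0 < L%:R * m2 + 3 * P ^+ 2 
  by apply: ltr_wpDr; [rewrite mulr_ge0 ?sqr_ge0|exact: mulr_gt0].
rewrite /rho expr_div_n exprMn !sqr_sqrtr.
- by rewrite /total_lambda !mulrA -exprSr.
- by rewrite !mulr_ge0// ltW.
- by rewrite !mulr_ge0 ?(ltW ln_inv_gt0)// ltW.
Qed.

Lemma rho_gt0 : 0 < r.
Proof.
have P1 : 0 < P + 1 by have := P0; lra.
have D0 : 0 < L%:R * m2 + 3 * P ^+ 2 
  by apply: ltr_wpDr; [rewrite mulr_ge0 ?sqr_ge0|exact: mulr_gt0].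
have e0 := ln_inv_gt0; have lm := lam0.
rewrite /rho -/(total_lambda L n); apply: divr_gt0.
  by rewrite sqrtr_gt0 !mulr_gt0.
by rewrite mulr_gt0// sqrtr_gt0 !mulr_gt0.
Qed.

(** As L >= 1, the factor L m2 + 3 P^2 lies between L m2 and L (m2 + 3 P^2). The block length then
    cancels and only [total_lambda] / n remains, which is of the order of [growth] / n. *)
Lemma rho_sqr_itv :
  rho_lower * (growth L n / n%:R) <= r ^+ 2 <= rho_upper * (growth L n / n%:R).
Proof.
have P1 : 0 < P + 1 by have := P0; lra.
have P30 : 0 < P ^+ 3 by rewrite exprn_gt0.
have e0 := ln_inv_gt0; have P20 := sqr_ge0 P.
rewrite rho_sqr; apply/andP; split.
- apply: (@le_trans _ _ (total_lambda L n * (P + 1) * (L%:R * m2)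
    * ln (1 / eps2) / (P ^+ 3 * L%:R * n%:R))).
    have -> : total_lambda L n * (P + 1) * (L%:R * m2) * ln (1 / eps2) / (P ^+ 3 * L%:R * n%:R) =
       total_lambda L n * ((P + 1) * m2 * ln (1 / eps2) / (P ^+ 3 * n%:R)).
      by field; rewrite !gt_eqF.
    have -> : rho_lower * (growth L n / n%:R) =
      slack_constant * growth L n * ((P + 1) * m2 * ln (1 / eps2) / (P ^+ 3 * n%:R)).
      by rewrite /rho_lower; field; rewrite !gt_eqF.
    apply: ler_wpM2r total_lambda_ge.
    by rewrite divr_ge0// ?mulr_ge0// ltW// mulr_gt0.
  apply: ler_wpM2r; first by rewrite invr_ge0 !mulr_ge0// ltW.
  apply: ler_wpM2r; first exact: ltW.
  apply: ler_wpM2l; first by rewrite mulr_ge0// ltW.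
  by rewrite lerDl mulr_ge0.
- apply: (@le_trans _ _ (total_lambda L n * (P + 1) * (L%:R * (m2 + 3 * P ^+ 2))
    * ln (1 / eps2) / (P ^+ 3 * L%:R * n%:R))).
    apply: ler_wpM2r; first by rewrite invr_ge0 !mulr_ge0// ltW.
    apply: ler_wpM2r; first exact: ltW.
    apply: ler_wpM2l; first by rewrite mulr_ge0// ltW.
    by rewrite mulrDr lerD2l ler_peMl// mulr_ge0.
  have D0 : 0 < m2 + 3 * P ^+ 2 by have := m20; lra.
  have -> : total_lambda L n * (P + 1) * (L%:R * (m2 + 3 * P ^+ 2)) * ln (1 / eps2) / (P ^+ 3 * L%:R * n%:R) =
     total_lambda L n * ((P + 1) * (m2 + 3 * P ^+ 2) * ln (1 / eps2) / (P ^+ 3 * n%:R)).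
    by field; rewrite !gt_eqF.
  have -> : rho_upper * (growth L n / n%:R) =
    lambda_constant * growth L n * ((P + 1) * (m2 + 3 * P ^+ 2) * ln (1 / eps2) / (P ^+ 3 * n%:R)).
    by rewrite /rho_upper; field; rewrite !gt_eqF.
  apply: ler_wpM2r total_lambda_le.
  by rewrite divr_ge0// ?mulr_ge0// ltW// mulr_gt0.
Qed.

Lemma rho_itv :
  Num.sqrt rho_lower * Num.sqrt (growth L n / n%:R) <= r <=
  Num.sqrt rho_upper * Num.sqrt (growth L n / n%:R).
Proof.
have /andP[h1 h2] := rho_sqr_itv.
have rE : r = Num.sqrt (r ^+ 2) by rewrite sqrtr_sqr gtr0_norm// rho_gt0.
rewrite -!sqrtrM ?(ltW rho_lower_gt0) ?(ltW rho_upper_gt0)// rE.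
apply/andP; split; rewrite ler_sqrt// ?sqr_ge0//.
by rewrite mulr_ge0 ?(ltW rho_upper_gt0)// divr_ge0// ltW.
Qed.

(** One half of this loss reappears in [log_capacity_ge], the other in [gamma_total_lambda]. *)
Lemma rate_sqrtE :
  Num.sqrt (total_lambda L n * (L%:R * m2 + 3 * P ^+ 2) * ln (1 / eps2)
            / (L%:R * P * (P + 1) * n%:R)) = r * P / (P + 1).
Proof.
have P1 : 0 < P + 1 by have := P0; lra.
have r0 := rho_gt0.
have -> : total_lambda L n * (L%:R * m2 + 3 * P ^+ 2) * ln (1 / eps2)
    / (L%:R * P * (P + 1) * n%:R) = (r * P / (P + 1)) ^+ 2.
  rewrite expr_div_n exprMn rho_sqr; field.
  by rewrite !gt_eqF.
by rewrite sqrtr_sqr gtr0_norm// divr_gt0// mulr_gt0.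
Qed.

Lemma log_capacity_ge : r <= 1 / 32 ->
  n%:R * ln (1 + P) / 2 - n%:R * r * P / (2 * (P + 1)) - n%:R * r ^+ 2
    <= n%:R / 2 * ln (1 + Svar P m2 eps2 L n).
Proof.
move=> r32; have r0 := rho_gt0; have p0 := P0; have P1 : 0 < P + 1 by lra.
rewrite /Svar; pose z := r * P / (P + 1).
have z0 : 0 < z by rewrite divr_gt0// mulr_gt0.
have zr : z <= r by rewrite ler_pdivrMr//; nra.
have e1 : 1 + P * (1 - r) = (1 + P) * (1 - z) by rewrite /z; field; rewrite gt_eqF.
have z1 : 0 < 1 - z by lra.
rewrite e1 lnM ?posrE//; last by lra.
have lz : - z - 2 * r ^+ 2 <= ln (1 - z).
  have h := @le_ln1Dx R ((1 - z)^-1 - 1).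
  have i1 : 0 < (1 - z)^-1 by rewrite invr_gt0.
  have e2 : 1 + ((1 - z)^-1 - 1) = (1 - z)^-1 by ring.
  rewrite e2 lnV ?posrE// in h.
  have h2 : (1 - z)^-1 - 1 <= z + 2 * r ^+ 2.
    rewrite lerBlDr -[(1 - z)^-1]mul1r ler_pdivrMr//; nra.
  have : - ln (1 - z) <= (1 - z)^-1 - 1 by apply: h; lra.
  lra.
have nR := nR0.
have -> : n%:R * r * P / (2 * (P + 1)) = n%:R / 2 * z by rewrite /z; field; rewrite gt_eqF.
have n20 : 0 <= n%:R / 2 :> R by rewrite divr_ge0// ltW.
have := ler_wpM2l n20 lz; lra.
Qed.

Local Notation g := (gamma P m2 eps2 L n).

(** Dropping the quadratic term of the denominator gives gamma <= ln (1 / eps2) / (L P beta), and 1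
    / beta = 1 / alpha + 63 S. By the choice of rho the first summand is the leading term, up to S
    <= P inside alpha; the second contributes only a multiple of [total_lambda]. *)
Lemma gamma_total_lambda : r <= 1 / 32 ->
  g * total_lambda L n <= r * P * n%:R / (2 * (P + 1))
     + 63 * ln (1 / eps2) * total_lambda L n.
Proof.
move=> r32; have r0 := rho_gt0; have p0 := P0; have P1 : 0 < P + 1 by lra.
have e0 := ln_inv_gt0; have a0 := alpha_gt0 P0 Pm2 l1 r0.
have S0 : 0 < Svar P m2 eps2 L n by rewrite /Svar mulr_gt0//; lra.
have SP : Svar P m2 eps2 L n <= P by rewrite /Svar; nra.
rewrite -/(Svar P m2 eps2 L n) -/(alpha P m2 eps2 L n) in a0.
set a := alpha P m2 eps2 L n in a0; set S := Svar P m2 eps2 L n in S0 SP.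
have aS : 0 < 1 + 63 * a * S by have := mulr_gt0 a0 S0; lra.
have lP : 0 < L%:R * P by rewrite mulr_gt0.
have b0 : 0 < beta P m2 eps2 L n by rewrite divr_gt0.
have g1 : g <= ln (1 / eps2) / (L%:R * P * beta P m2 eps2 L n).
  apply: ler_wpM2l; first exact: ltW.
  have d0 : 0 <= L%:R ^+ 2 * a ^+ 2 * m2 / 2.
    by rewrite divr_ge0// mulr_ge0 ?(ltW m20)// -exprMn sqr_ge0.
  rewrite lef_pV2 ?posrE; first by rewrite lerDl.
    by rewrite ltr_wpDr// mulr_gt0.
  by rewrite mulr_gt0.
apply: (@le_trans _ _ (ln (1 / eps2) / (L%:R * P * beta P m2 eps2 L n) * total_lambda L n)).
  by apply: ler_wpM2r g1; exact: ltW.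
have -> : ln (1 / eps2) / (L%:R * P * beta P m2 eps2 L n) * total_lambda L n =
   ln (1 / eps2) * total_lambda L n / (L%:R * P * a)
   + 63 * ln (1 / eps2) * total_lambda L n * (S / (L%:R * P)).
  rewrite /beta -/a -/S; field; rewrite !gt_eqF//.
apply: lerD; last first.
  rewrite ler_piMr//; first by rewrite !mulr_ge0// ltW.
  rewrite ler_pdivrMr// mul1r; apply: (le_trans SP).
  by rewrite ler_peMl// ltW.
have D0 : 0 < L%:R * m2 + 3 * S ^+ 2.
  by apply: ltr_wpDr; [rewrite mulr_ge0 ?sqr_ge0|exact: mulr_gt0].
have -> : ln (1 / eps2) * total_lambda L n / (L%:R * P * a) =
   ln (1 / eps2) * total_lambda L n / (2 * L%:R * P ^+ 2 * r) * (L%:R * m2 + 3 * S ^+ 2).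
  by rewrite /a /alpha -/S; field; rewrite !gt_eqF.
have -> : r * P * n%:R / (2 * (P + 1)) =
   ln (1 / eps2) * total_lambda L n / (2 * L%:R * P ^+ 2 * r) * (L%:R * m2 + 3 * P ^+ 2).
  apply: (mulIf (_ : r != 0)); first by rewrite gt_eqF.
  have -> : r * P * n%:R / (2 * (P + 1)) * r = r ^+ 2 * (P * n%:R / (2 * (P + 1))).
    by rewrite expr2; ring.
  rewrite rho_sqr; field; rewrite !gt_eqF//.
apply: ler_wpM2l.
  apply: ltW; apply: divr_gt0; first exact: mulr_gt0.
  by rewrite mulr_gt0// mulr_gt0 ?exprn_gt0// mulr_gt0.
rewrite lerD2l ler_pM2l//; apply: lerXn2r; rewrite ?nnegrE//; exact: ltW.
Qed.

(** A balance sheet. One half of the slack gamma * [slack_constant] * [growth] pays for the errors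
    of order [growth], the other half for the terms of order sqrt n. The two quantile terms, with S
    and with P, are bounded separately instead of being compared. The summand with constant 1 pays
    for ln n. *)
Lemma rate_bound_ge (eps1 t eta : R) : r <= 1 / 32 -> t = Phi_inv eps1 ->
  0 <= eta <= 1 ->
  rho_upper + 63 * ln (1 / eps2) * lambda_constant <= g * slack_constant / 2 ->
  Num.sqrt n%:R * (2 * `|t| + 1) <= g * slack_constant * growth L n / 2 ->
  n%:R * rate_lower_bound P m2 eps2 L n eps1 1 <=
  n%:R / 2 * ln (1 + Svar P m2 eps2 L n)
  + Num.sqrt (Svar P m2 eps2 L n / (Svar P m2 eps2 L n + 1)) * (Num.sqrt n%:R * (t - eta))
  - g * (2 * P * ln 2 * L%:R + 8 * P * ln n%:R) - ln n%:R.
Proof.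
move=> r32 tE /andP[eta0 eta1] c5 ct; rewrite /rate_lower_bound -/(total_lambda L n) -tE.
rewrite rate_sqrtE -/(growth L n).
have r0 := rho_gt0; have p0 := P0; have P1 : 0 < P + 1 by lra.
have nR := nR0; have sn0 : 0 < Num.sqrt n%:R :> R by rewrite sqrtr_gt0.
have sn2 : Num.sqrt n%:R ^+ 2 = n%:R :> R by rewrite sqr_sqrtr// ltW.
have sig (s : R) : 0 < s -> 0 <= Num.sqrt (s / (s + 1)) <= 1.
  move=> s0; rewrite sqrtr_ge0/= -[leRHS]sqrtr1 ler_sqrt// ler_pdivrMr; lra.
have S0 : 0 < Svar P m2 eps2 L n by rewrite /Svar mulr_gt0//; lra.
have /andP[a0 a1] := sig _ S0; have /andP[b0 b1] := sig _ P0.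
have sqrtPE : n%:R * Num.sqrt (P / ((P + 1) * n%:R)) = Num.sqrt (P / (P + 1)) * Num.sqrt n%:R.
  rewrite -[X in X * _]sn2 expr2 -mulrA -sqrtrM ?ltW// [in RHS]mulrC; congr (_ * Num.sqrt _).
  by field; rewrite !gt_eqF.
have F1 := log_capacity_ge r32; have F3 := gamma_total_lambda r32.
have /andP[_ F2] := rho_sqr_itv.
have F2' : n%:R * r ^+ 2 <= rho_upper * growth L n.
  rewrite mulrC -ler_pdivlMr//; apply: (le_trans F2); rewrite mulrA//.
have F4 := slack_ge; have lE := total_lambdaE; have F5 := total_lambda_le.
have g0 : 0 < g := gamma_gt0 P0 Pm2 ln_inv_gt0 l1 r0 r32.
have F7 : ln n%:R <= growth L n by rewrite /growth le_max lexx.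
set sS := Num.sqrt (Svar _ _ _ _ _ / _) in a0 a1 *.
set sP := Num.sqrt (P / (P + 1)) in b0 b1 sqrtPE *.
have [t1 t2] := (ler_norm t, ler_norm (- t)); rewrite normrN in t2.
have T1 : - (Num.sqrt n%:R * (`|t| + 1)) <= sS * (Num.sqrt n%:R * (t - eta)).
  have : - (`|t| + 1) <= sS * (t - eta) by nra.
  by move=> h; have := ler_wpM2l (ltW sn0) h; lra.
have T2 : - (Num.sqrt n%:R * `|t|) <= n%:R * (Num.sqrt (P / ((P + 1) * n%:R)) * t).
  rewrite mulrA sqrtPE; have : - `|t| <= sP * t by nra.
  by move=> h; have := ler_wpM2l (ltW sn0) h; lra.
have gl : g * (2 * P * ln 2 * L%:R + 8 * P * ln n%:R) + g * (slack_constant * growth L n)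
    <= g * total_lambda L n.
  by rewrite -mulrDr lE; apply: ler_wpM2l; [exact: ltW|rewrite lerD2l].
have c5' := ler_wpM2r (ltW mx0) c5.
have e0 := ln_inv_gt0.
have F5' : 63 * ln (1 / eps2) * total_lambda L n <= 63 * ln (1 / eps2) * (lambda_constant * growth L n).
  by apply: ler_wpM2l F5; rewrite mulr_ge0// ltW.
have k1 : n%:R * (1 * growth L n / n%:R) = growth L n by field; rewrite gt_eqF.
have k2 : n%:R * (r * P / (P + 1)) = 2 * (r * P * n%:R / (2 * (P + 1))).
  by field; rewrite gt_eqF.
have k3 : n%:R * r * P / (2 * (P + 1)) = r * P * n%:R / (2 * (P + 1)) by ring.
rewrite [leLHS]mulrBr [X in X - _]mulrBr [X in X - _ - _]mulrBr k1 k2; rewrite k3 in F1.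
move: F1 F2' F3 T1 T2 gl c5' F5' F7 ct.
set A := r * P * n%:R / _; set B := n%:R / 2 * ln _; set C := g * (_ + _).
set D := sS * _; set F := n%:R * (_ * t); set G := g * total_lambda _ _.
set W := Num.sqrt n%:R; clearbody A B C D F G W.
lra.
Qed.

End rate_asymptotics.

(** * Probabilities in the best-effort setup *)

Lemma preimage_set_systemI (T U : Type) (f : T -> U) (G : set (set U)) :
  setI_closed G -> setI_closed (preimage_set_system setT f G).
Proof.
move=> GI _ _ [A GA <-] [B GB <-]; exists (A `&` B); first exact: GI.
by rewrite !setTI preimage_setI.
Qed.

Lemma measurable_finite_valued d (T : measurableType d) (I : finType) (f : T -> I) :
  (forall i, measurable (f @^-1` [set i])) -> forall B : set I, measurable (f @^-1` B).
Proof.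
move=> mf B.
have -> : f @^-1` B = \bigcup_(i in B) f @^-1` [set i].
  by apply/seteqP; split => [t Bt|t [i Bi ft]]; [exists (f t)|rewrite /= ft].
by apply: fin_bigcup_measurable => [|i _]; [exact: finite_finset|exact: mf].
Qed.

Lemma sum_ord_eq_div (n L l : nat) : (0 < L)%N ->
  (\sum_(k < n | (k %/ L == l)%N) 1 <= L)%N /\
  ((l.+1 * L <= n)%N -> (\sum_(k < n | (k %/ L == l)%N) 1 = L)%N).
Proof.
move=> L0.
have E : (\sum_(k < n | (k %/ L == l)%N) 1 = \sum_(0 <= k < n | (l * L <= k < l.+1 * L)%N) 1)%N.
  rewrite big_mkord; apply: eq_bigl => k.
  by rewrite eqn_leq leq_divRL// -ltnS ltn_divLR// andbC.
have iotaE m : (\sum_(0 <= k < m | (l * L <= k < l.+1 * L)%N) 1 =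
    minn m (l.+1 * L) - l * L)%N.
  rewrite big_mkcond/=; elim: m => [|m IHm]; first by rewrite big_geq// min0n sub0n.
  by rewrite big_nat_recr//= IHm mulSnr; case: ifP; lia.
rewrite E iotaE mulSnr; split; lia.
Qed.

Lemma ge0_integral_normal_law (R : realType) d (T : measurableType d)
    (Pr : probability T R) (V : {RV Pr >-> R}) (m s : R) (f : R -> \bar R) :
  has_law V (normal_prob m s) -> measurable_fun setT f -> (forall x, 0 <= f x)%E ->
  (\int[Pr]_t f (V t) = \int[normal_prob m s]_x f x)%E.
Proof.
move=> law mf f0; rewrite -(ge0_integral_distribution V mf f0).
(* The normal law is a measure on [measurableTypeR R], the law of V one on R; the image under the
   identity connects the two. *)
pose idR : measurableTypeR R -> R := idfun.
have mid : measurable_fun setT idR := @measurable_id _ _ setT.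
have H : (\int[pushforward (normal_prob m s) idR]_x f x = \int[normal_prob m s]_x f x)%E.
  by rewrite ge0_integral_pushforward.
by rewrite -H; apply: eq_measure_integral => A mA _; exact: law.
Qed.

Section setup_analysis.
Context {R : realType} {d0 : measure_display} {T0 : measurableType d0}.
Variables (Q : probability T0 R) (E : {RV Q >-> R}).
Context {d : measure_display} {T : measurableType d}.
Variables (Pr : probability T R) (L n M : nat) (S : R).
Variables (En Z : nat -> {RV Pr >-> R}) (W : T -> 'I_M).
Variables (X : 'I_M -> 'I_n -> {RV Pr >-> R}) (D : T -> 'I_M).
Hypothesis setup : best_effort_setup L S En Z W X D (distribution Q E).
Hypothesis L0 : (0 < L)%N.
Hypothesis S0 : 0 < S.

Local Notation F := (sources L En Z W X D).
Local Notation index := (nat + nat + 'I_M * 'I_n + bool)%type.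
Local Notation sg J := (g_sigma_algebraType (cylinders F J)).

Definition energy_index (l : nat) : index := inl (inl (inl l)).
Definition noise_index (k : nat) : index := inl (inl (inr k)).
Definition symbol_index (w : 'I_M) (k : 'I_n) : index := inl (inr (w, k)).

Lemma measurable_message : forall B, measurable (W @^-1` B).
Proof. by apply: measurable_finite_valued => w; case: (message_law setup w). Qed.

Lemma measurable_guess : forall B, measurable (D @^-1` B).
Proof. by apply: measurable_finite_valued => w; case: (guess_law setup w). Qed.

Lemma sources_measurable i : F i `<=` measurable.
Proof.
case: i => [[[l|k]|[w k]]|b] A [B mB <-]; rewrite setTI.
- by rewrite -[X in measurable X]setTI; exact: measurable_funP.
- by rewrite -[X in measurable X]setTI; exact: measurable_funP.
- by rewrite -[X in measurable X]setTI; exact: measurable_funP.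
- by case: b; [exact: measurable_message|exact: measurable_guess].
Qed.

Lemma sourcesI i : setI_closed (F i).
Proof.
by case: i => [[[l|k]|[w k]]|b]; apply: preimage_set_systemI => // A B; exact: measurableI.
Qed.

Lemma sourcesT i : F i setT.
Proof. by case: i => [[[l|k]|[w k]]|b]; exists setT; rewrite ?preimage_setT ?setTI. Qed.

Let indF : mutually_independent Pr F := sources_independent setup.

Definition sources_decouple J K f :=
  @integral_decouple _ _ _ Pr _ F indF sources_measurable sourcesI sourcesT J K f.
Definition sources_prod s h :=
  @integral_prod_indep _ _ _ Pr _ F indF sources_measurable sourcesI sourcesT s h.

Lemma energy_measurable (J : pred index) k :
  J (energy_index (k %/ L)) -> measurable_fun [set: sg J] (En k).
Proof.
move=> Jk; rewrite (_ : (En k : T -> R) = En (k %/ L * L)%N); last first.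
  by apply/funext => t; rewrite (energy_block setup).
exact: (measurable_sigma_of sourcesT Jk).
Qed.

Lemma noise_measurable (J : pred index) k :
  J (noise_index k) -> measurable_fun [set: sg J] (Z k).
Proof. by move=> Jk; exact: (measurable_sigma_of sourcesT Jk). Qed.

Lemma symbol_measurable (J : pred index) w k :
  J (symbol_index w k) -> measurable_fun [set: sg J] (X w k).
Proof. by move=> Jk; exact: (measurable_sigma_of sourcesT Jk). Qed.

Local Notation sqrtS := (Num.sqrt S).

Lemma ge0_integral_symbol w k (f : R -> \bar R) :
  measurable_fun setT f -> (forall x, 0 <= f x)%E ->
  (\int[Pr]_t f (X w k t) = \int[normal_prob 0 sqrtS]_x f x)%E.
Proof. exact: (ge0_integral_normal_law (symbol_law setup w k)). Qed.

Lemma ge0_integral_noise k (f : R -> \bar R) :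
  measurable_fun setT f -> (forall x, 0 <= f x)%E ->
  (\int[Pr]_t f (Z k t) = \int[normal_prob 0 1]_x f x)%E.
Proof. exact: (ge0_integral_normal_law (noise_law setup k)). Qed.

Lemma ge0_integral_energy l (f : R -> \bar R) :
  measurable_fun setT f -> (forall x, 0 <= f x)%E ->
  (\int[Pr]_t f (En (l * L)%N t) = \int[Q]_q f (E q))%E.
Proof.
move=> mf f0; rewrite -(ge0_integral_distribution (En (l * L)%N) mf f0).
rewrite -(ge0_integral_distribution E mf f0).
by apply: eq_measure_integral => A mA _; exact: (energy_law setup l).
Qed.

Lemma block_energy_mgf (w : 'I_M) (a : R) l : 2 * a * S < 1 ->
  (\int[Pr]_t (expR (a * block_energy L (X w ^~ t) l))%:E =
   ((Num.sqrt (1 - 2 * a * S))^-1 ^+ (\sum_(k < n | (k %/ L == l)%N) 1)%N)%:E)%E.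
Proof.
move=> aS.
pose h (i : index) (t : T) : R :=
  if i is inl (inr (w', k)) then expR (a * X w' k t ^+ 2) else 1.
pose s := [seq symbol_index w k | k <- [seq k <- enum 'I_n | (nat_of_ord k %/ L == l)%N]].
have us : uniq s.
  by rewrite map_inj_uniq => [|k k' []//]; exact/filter_uniq/enum_uniq.
have mh i : i \in s -> measurable_fun [set: sg (pred1 i)] (h i).
  move=> /mapP[k _ ->]; apply: measurableT_comp => //; apply: measurable_funM => //.
  by apply: measurable_funX; apply: symbol_measurable => /=.
have h0 i t : 0 <= h i t by rewrite /h; case: i => [[|[]]|]// *; exact: expR_ge0.
have := sources_prod us mh h0.
under eq_integral => t _.
  rewrite big_map big_filter big_enum_cond/= -expR_sum -mulr_sumr.
  over.
move=> ->; rewrite big_map big_filter big_enum_cond/=.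
have sS : 0 < sqrtS by rewrite sqrtr_gt0.
have sS2 : sqrtS ^+ 2 = S by rewrite sqr_sqrtr// ltW.
rewrite (eq_bigr (fun=> (Num.sqrt (1 - 2 * a * S))^-1%:E)); last first.
  move=> k _; rewrite (@ge0_integral_symbol w k (fun x => (expR (a * x ^+ 2))%:E)).
  - by rewrite integral_normal_expR_sqr ?sS2.
  - apply/measurable_EFinP; apply: measurableT_comp => //.
    by apply: measurable_funM => //; exact: measurable_funX.
  - by move=> x; rewrite lee_fin expR_ge0.
rewrite prodEFin; congr EFin.
by rewrite sum1_card prodr_const.
Qed.

Local Notation sym w t := (fun k => X w k t).
Local Notation enr t := (fun k => En k t).

Let enr_block t k : En k t = En (k %/ L * L)%N t.
Proof. exact: energy_block setup k t. Qed.

(** * The misfits of a fixed codeword *)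

Definition past (w : 'I_M) (l : nat) : pred index := fun i =>
  match i with
  | inl (inl (inl m)) => (m < l)%N
  | inl (inr (w', k)) => (w' == w) && (k %/ L < l)%N
  | _ => false
  end.

Definition present (w : 'I_M) (l : nat) : pred index := fun i =>
  match i with
  | inl (inl (inl m)) => m == l
  | inl (inr (w', k)) => (w' == w) && (k %/ L == l)%N
  | _ => false
  end.

Definition present_symbols (w : 'I_M) (l : nat) : pred index := fun i =>
  if i is inl (inr (w', k)) then (w' == w) && (k %/ L == l)%N else false.

(** Decoupling is used twice: past from present, which freezes reserve and misfit count, then
    arrival from symbols within the present. The bound on l makes all blocks complete, so their
    energies share one moment generating function. The truncated subtraction keeps the potential at
    1 once K misfits have occurred. *)
Lemma potential_supermartingale w (a theta C : R) (K l : nat) :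
  (forall q, 0 <= E q) ->
  0 <= a -> 0 < theta -> 0 <= C -> 2 * a * S < 1 ->
  theta <= (Num.sqrt (1 - 2 * a * S))^-1 ^+ L ->
  (\int[Q]_q (expR (- (a * (L%:R * E q))))%:E *
    ((Num.sqrt (1 - 2 * a * S))^-1 ^+ L)%:E <= 1)%E ->
  (1 <= C%:E * \int[Q]_q (expR (- (a * (L%:R * E q))))%:E)%E ->
  (l * L <= n)%N ->
  (\int[Pr]_t (mismatch_potential a theta C (K - misfits L (sym w t) (enr t) l)
     (reserve L (sym w t) (enr t) l))%:E <= (mismatch_potential a theta C K 0)%:E)%E.
Proof.
move=> E0 a0 th0 C0 aS thb mgf1 C1.
elim: l => [_|l IHl lLn].
  rewrite le_eqVlt; apply/orP; left; apply/eqP.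
  rewrite -[RHS](prob_integral_cst Pr); apply: eq_integral => t _.
  by rewrite /misfits /reserve !big_ord0 subn0 mulr0 subr0.
apply: le_trans (IHl _); last by rewrite (leq_trans _ lLn)// leq_mul2r leqnSn orbT.
pose f (p : sg (past w l) * sg (present w l)) : \bar R :=
  (next_potential a theta C L (K - misfits L (sym w p.1) (enr p.1) l)
    (reserve L (sym w p.1) (enr p.1) l) (En (l * L)%N p.2)
    (block_energy L (sym w p.2) l))%:E.
have mX1 (k : 'I_n) : (k %/ L < l)%N -> measurable_fun [set: sg (past w l)] (X w k).
  by move=> kl; apply: symbol_measurable => /=; rewrite eqxx.
have mE1 k : (k %/ L < l)%N -> measurable_fun [set: sg (past w l)] (En k).
  by move=> kl; apply: energy_measurable.
have mN : measurable_fun [set: sg (past w l)] (fun t => misfits L (sym w t) (enr t) l).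
  exact: measurable_misfits.
have mU : measurable_fun [set: sg (past w l)] (fun t => reserve L (sym w t) (enr t) l).
  exact: measurable_reserve.
have mB : measurable_fun [set: sg (present w l)] (fun t => block_energy L (sym w t) l).
  apply: measurable_block_energy => k kl; apply: symbol_measurable => /=.
  by rewrite eqxx kl eqxx.
have mE2 : measurable_fun [set: sg (present w l)] (En (l * L)%N).
  by apply: energy_measurable; rewrite /= mulnK.
have f0 p : (0 <= f p)%E by rewrite lee_fin next_potential_ge0.
have mf : measurable_fun setT f.
  apply/measurable_EFinP.
  pose H r (p : sg (past w l) * sg (present w l)) := next_potential a theta C L r
    (reserve L (sym w p.1) (enr p.1) l) (En (l * L)%N p.2) (block_energy L (sym w p.2) l).
  pose rho (p : sg (past w l) * sg (present w l)) := (K - misfits L (sym w p.1) (enr p.1) l)%N.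
  have mH r : measurable_fun setT (H r).
    apply: measurable_next_potential.
    + exact: (measurableT_comp mU measurable_fst).
    + exact: (measurableT_comp mE2 measurable_snd).
    + exact: (measurableT_comp mB measurable_snd).
  have mrho : measurable_fun setT rho.
    have mK : measurable_fun setT (fun j => K - j)%N by [].
    exact: (measurableT_comp mK (measurableT_comp mN measurable_fst)).
  by apply: (measurable_nat_family mH mrho (K := K)) => p; exact: leq_subr.
have JK i : past w l i -> ~~ present w l i.
  case: i => [[[m|m]|[w' k]]|b] //=; first by move=> ml; rewrite ltn_eqF.
  by case/andP => _ kl; rewrite (ltn_eqF kl) andbF.
have -> : (\int[Pr]_t (mismatch_potential a theta C (K - misfits L (sym w t) (enr t) l.+1)
     (reserve L (sym w t) (enr t) l.+1))%:E = \int[Pr]_t f (t, t))%E.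
  apply: eq_integral => t _; rewrite /f /next_potential/= -fitsE// reserveS.
  rewrite /misfits big_ord_recr/=; case: fits; first by rewrite addn0.
  by rewrite addn1 subnS subr0.
rewrite (sources_decouple JK mf f0).
apply: ge0_le_integral => //.
- by move=> t _; apply: integral_ge0.
- have mdec := measurable_decouple Pr sources_measurable mf f0.
  exact: (sigma_ofW sources_measurable mdec).
- apply/measurable_EFinP.
  pose H r t := mismatch_potential a theta C r (reserve L (sym w t) (enr t) l).
  pose rho t := (K - misfits L (sym w t) (enr t) l)%N.
  have mH r : measurable_fun setT (H r).
    exact/measurable_mismatch_potential/(sigma_ofW sources_measurable mU).
  have mrho : measurable_fun setT rho.
    have mK : measurable_fun setT (fun j => K - j)%N by [].
    exact: (measurableT_comp mK (sigma_ofW sources_measurable mN)).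
  by apply: (measurable_nat_family mH mrho (K := K)) => p; exact: leq_subr.
move=> t _; set r := (K - _)%N; set u := reserve _ _ _ _.
pose B s := block_energy L (sym w s) l.
have mB2 : measurable_fun [set: sg (present_symbols w l)] B.
  by apply: measurable_block_energy => k kl; apply: symbol_measurable; rewrite /= eqxx kl eqxx.
have mE3 : measurable_fun [set: sg (pred1 (energy_index l))] (En (l * L)%N).
  by apply: energy_measurable; rewrite /= mulnK.
pose g (p : sg (pred1 (energy_index l)) * sg (present_symbols w l)) : \bar R :=
  (next_potential a theta C L r u (En (l * L)%N p.1) (B p.2))%:E.
have mg : measurable_fun setT g.
  apply/measurable_EFinP; apply: measurable_next_potential => //.
    exact: (measurableT_comp mE3 measurable_fst).
  exact: (measurableT_comp mB2 measurable_snd).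
have g0 p : (0 <= g p)%E by rewrite lee_fin next_potential_ge0.
have dis i : pred1 (energy_index l) i -> ~~ present_symbols w l i by move=> /eqP ->.
have -> : (\int[Pr]_s f (t, s) = \int[Pr]_s g (s, s))%E by [].
rewrite (sources_decouple dis mg g0) /g/=.
have mBT : measurable_fun setT B by exact: (sigma_ofW sources_measurable mB2).
pose G e := (\int[Pr]_s (next_potential a theta C L r u e (B s))%:E)%E.
have G0 e : (0 <= G e)%E.
  by apply: integral_ge0 => s _; rewrite lee_fin next_potential_ge0.
have mG : measurable_fun setT G.
  apply: (measurable_fun_fubini_tonelli_F (m2 := Pr) (fun p : R * T =>
    (next_potential a theta C L r u p.1 (B p.2))%:E)).
    apply/measurable_EFinP; apply: measurable_next_potential => //.
    exact: (measurableT_comp mBT measurable_snd).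
  by move=> p; rewrite lee_fin next_potential_ge0.
rewrite (ge0_integral_energy l mG G0) /G.
have mgfB : (\int[Pr]_s (expR (a * B s))%:E = ((Num.sqrt (1 - 2 * a * S))^-1 ^+ L)%:E)%E.
  by rewrite block_energy_mgf//; have [_ ->] := sum_ord_eq_div n l L0.
apply: integral_next_potential => //.
- by rewrite mgfB lee_fin.
- by rewrite mgfB.
Qed.

Lemma misfits_measurableT w l :
  measurable_fun setT (fun t => misfits L (sym w t) (enr t) l).
Proof.
by apply: measurable_misfits => // k _; exact: measurable_funP.
Qed.

(** The last block may be incomplete, so the process is stopped one block earlier; this forgets at
    most one misfit, whence K.+1 on the left and K misfits to exceed before the last block. At that
    point the potential started at K.+1 has reached 1. *)
Lemma misfits_tail w (a theta C : R) (K : nat) :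
  (forall q, 0 <= E q) ->
  0 <= a -> 0 < theta -> 0 <= C -> 2 * a * S < 1 ->
  theta <= (Num.sqrt (1 - 2 * a * S))^-1 ^+ L ->
  (\int[Q]_q (expR (- (a * (L%:R * E q))))%:E *
    ((Num.sqrt (1 - 2 * a * S))^-1 ^+ L)%:E <= 1)%E ->
  (1 <= C%:E * \int[Q]_q (expR (- (a * (L%:R * E q))))%:E)%E ->
  (Pr [set t | K.+1 < misfits L (sym w t) (enr t) (num_blocks L n)]%N
    <= (C * theta^-1 ^+ K)%:E)%E.
Proof.
move=> E0 a0 th0 C0 aS thb mgf1 C1.
set nb := num_blocks L n.
have nbLn : (nb.-1 * L <= n)%N.
  rewrite /nb /num_blocks; have := leq_divM (n + L.-1) L.
  case: ((n + L.-1) %/ L)%N => [|b]//=; rewrite mulSn; lia.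
have Kset t : (K.+1 < misfits L (sym w t) (enr t) nb)%N ->
    (K < misfits L (sym w t) (enr t) nb.-1)%N.
  clearbody nb; rewrite /misfits; case: nb {nbLn} => [|b] /=; first by rewrite big_ord0.
  by rewrite big_ord_recr/= -addn1 => H; case: fits H; rewrite ?addn0 ?addn1 ?ltnS// => /ltnW.
have mset j l : measurable [set t | (j < misfits L (sym w t) (enr t) l)%N].
  have := misfits_measurableT w l measurableT (Y := [set m | (j < m)%N]).
  by rewrite setTI; exact.
apply: (@le_trans _ _ (Pr [set t | K < misfits L (sym w t) (enr t) nb.-1]%N)).
  by apply: le_measure; rewrite ?inE// => t; exact: Kset.
have -> : C * theta^-1 ^+ K = mismatch_potential a theta C K.+1 0.
  by rewrite /= mulr0 oppr0 expR0 mulr1.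
apply: le_trans (potential_supermartingale w K.+1 E0 a0 th0 C0 aS thb mgf1 C1 nbLn).
apply: prob_le_integral => //.
- pose H r t := mismatch_potential a theta C r (reserve L (sym w t) (enr t) nb.-1).
  pose rho t := (K.+1 - misfits L (sym w t) (enr t) nb.-1)%N.
  have mH r : measurable_fun setT (H r).
    apply: measurable_mismatch_potential.
    by apply: measurable_reserve => // k _; exact: measurable_funP.
  have mrho : measurable_fun setT rho.
    have mK : measurable_fun setT (fun j => K.+1 - j)%N by [].
    exact: (measurableT_comp mK (misfits_measurableT w nb.-1)).
  by apply: (measurable_nat_family mH mrho (K := K.+1)) => p; exact: leq_subr.
- by move=> t; exact: mismatch_potential_ge0.
- by move=> t /= Kt; rewrite (eqP (_ : K.+1 - _ == 0)%N)// subn_eq0.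
Qed.

Lemma num_mismatch_le_misfits t :
  (num_mismatch_events L En W X t <=
   misfits L (sym (W t) t) (enr t) (num_blocks L n))%N.
Proof.
apply: (@leq_trans #|[pred l : 'I_(num_blocks L n) | ~~ fits L (sym (W t) t) (enr t) l]|).
  apply: subset_leq_card; apply/fintype.subsetP => l.
  rewrite !inE => /exists_inP[k]; rewrite inE be_input_fits => mis /eqP <-.
  by apply: contraNN mis => ->.
rewrite -sum1_card big_mkcond/=; apply: leq_sum => l _.
by rewrite inE; case: fits.
Qed.

(** * Block energies and the noise term of the silenced symbols *)

Lemma block_energy_tail w l (P : R) : S <= P -> (0 < n)%N ->
  (Pr [set t | 2 * P * ln 2 * L%:R + 8 * P * ln n%:R < block_energy L (sym w t) l]%R
    <= ((n%:R ^+ 2)^-1)%:E)%E.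
Proof.
move=> SP n0; set lam := _ + _.
have mB : measurable_fun setT (fun t => block_energy L (sym w t) l).
  by apply: measurable_block_energy => k _; exact: measurable_funP.
have n_gt0 : 0 < n%:R :> R by rewrite ltr0n.
have nln0 : 0 <= ln n%:R :> R by rewrite ln_ge0// ler1n.
have ln20 : 0 <= ln 2 :> R by rewrite ln_ge0// ler1n.
(* With this exponent each symbol contributes a factor sqrt 2, which the summand 2 P ln 2 L of the
   threshold cancels; 8 P ln n leaves n^-2, enough for a union over at most n blocks. *)
set a := (4 * S)^-1.
have a0 : 0 < a by rewrite invr_gt0 mulr_gt0.
have aS : 2 * a * S = 1 / 2 by rewrite /a; field; rewrite gt_eqF.
pose f t := expR (a * block_energy L (sym w t) l) * expR (- (a * lam)).
have mf : measurable_fun setT f.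
  by apply: measurable_funM => //; apply: measurableT_comp => //; exact: measurable_funM.
apply: (@le_trans _ _ (\int[Pr]_t (f t)%:E)%E).
  apply: prob_le_integral => //.
  - have := measurable_fun_ltr (measurable_cst lam) mB measurableT (Y := [set true]).
    by rewrite setTI; exact.
  - by move=> t; rewrite mulr_ge0 ?expR_ge0.
  - move=> t /= lt; rewrite /f -expRD -[leLHS]expR0 ler_expR -mulrBr mulr_ge0 ?ltW//.
    by rewrite subr_gt0.
under eq_integral do rewrite EFinM.
rewrite ge0_integralZr//; last first.
  by apply/measurable_EFinP; apply: measurableT_comp => //; exact: measurable_funM.
rewrite block_energy_mgf; last by rewrite aS; lra.
rewrite aS -EFinM lee_fin; set m := (\sum_(k < n | _) 1)%N.
have mL : (m <= L)%N by have [] := sum_ord_eq_div n l L0.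
have sq2 : (Num.sqrt (1 - 1 / 2 : R))^-1 = expR (ln 2 / 2).
  have -> : 1 - 1 / 2 = expR (- ln 2) :> R by rewrite expRN lnK ?posrE//; field.
  have -> : expR (- ln 2) = expR (- (ln 2 / 2)) ^+ 2 :> R.
    by rewrite -expRM_natl; congr expR; field.
  by rewrite sqrtr_sqr ger0_norm ?expR_ge0// expRN invrK.
rewrite sq2 -expRM_natl -expRD.
have -> : (n%:R ^+ 2)^-1 = expR (- (2%:R * ln n%:R)) :> R.
  by rewrite expRN expRM_natl lnK.
rewrite ler_expR.
have mLR : m%:R <= L%:R :> R by rewrite ler_nat.
have alam : L%:R * (ln 2 / 2) + 2 * ln n%:R <= a * lam.
  have -> : L%:R * (ln 2 / 2) + 2 * ln n%:R = a * (2 * S * ln 2 * L%:R + 8 * S * ln n%:R).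
    by rewrite /a; field; rewrite gt_eqF.
  rewrite ler_wpM2l ?(ltW a0)// /lam lerD//.
    by do 2 apply: ler_wpM2r => //; rewrite ler_wpM2l.
  by apply: ler_wpM2r => //; rewrite ler_wpM2l.
have : m%:R * (ln 2 / 2) <= L%:R * (ln 2 / 2) :> R by rewrite ler_wpM2r// divr_ge0.
lra.
Qed.

Lemma noise_exponential_martingale (c : 'I_n -> R) :
  (\int[Pr]_t (expR (\sum_(k < n) (c k * Z k t - c k ^+ 2 / 2)))%:E = 1)%E.
Proof.
pose c' (m : nat) := oapp c 0 (insub m).
pose h (i : index) (t : T) : R :=
  if i is inl (inl (inr m)) then expR (c' m * Z m t - c' m ^+ 2 / 2) else 1.
pose s := [seq noise_index k | k <- map val (enum 'I_n)].
have us : uniq s.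
  by rewrite map_inj_uniq => [|k k' []//]; rewrite val_enum_ord iota_uniq.
have mh i : i \in s -> measurable_fun [set: sg (pred1 i)] (h i).
  move=> /mapP[k _ ->]; apply: measurableT_comp => //; apply: measurable_funB => //.
  by apply: measurable_funM => //; apply: noise_measurable => /=.
have h0 i t : 0 <= h i t by rewrite /h; case: i => [[[]|]|]// *; exact: expR_ge0.
have := sources_prod us mh h0.
under eq_integral => t _.
  rewrite big_map big_map big_enum/= -expR_sum.
  under eq_bigr do rewrite /c' valK/=.
  over.
move=> ->; rewrite big_map big_map big_enum/=; apply: big1 => k _.
rewrite /c' valK/=.
have mt : measurable_fun [set: R] (fun z => c k * z) by exact: measurable_funM.
have mtB : measurable_fun [set: R] (fun z => c k * z - c k ^+ 2 / 2).
  by apply: measurable_funB; first exact: mt.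
rewrite (@ge0_integral_noise k (fun z => (expR (c k * z - c k ^+ 2 / 2))%:E)).
- under eq_integral do rewrite expRD EFinM.
  rewrite ge0_integralZr//.
  + by rewrite integral_normal_expR -EFinM expRxMexpNx_1.
  + apply/measurable_EFinP; exact: (measurableT_comp (@measurable_expR R) mt).
- apply/measurable_EFinP; exact: (measurableT_comp (@measurable_expR R) mtB).
- by move=> z; rewrite lee_fin expR_ge0.
Qed.

Definition signal (w : 'I_M) : pred index := fun i =>
  match i with
  | inl (inl (inl m)) => true
  | inl (inr (w', k)) => w' == w
  | _ => false
  end.

Definition noise : pred index := fun i =>
  if i is inl (inl (inr m)) then true else false.

Definition lost w t (k : 'I_n) : R := X w k t - be_input L (sym w t) (enr t) k.

Lemma lost_measurable (J : pred index) w k : (forall i, signal w i -> J i) ->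
  measurable_fun [set: sg J] (fun t => lost w t k).
Proof.
move=> wJ; have mX k' : measurable_fun [set: sg J] (X w k').
  by apply: symbol_measurable; apply: wJ => /=.
have mE k' : measurable_fun [set: sg J] (En k').
  by apply: energy_measurable; apply: wJ.
apply: measurable_funB; first exact: mX.
exact: (measurable_be_input (x := fun k => X w k : sg J -> R) (e := fun k => En k : sg J -> R) k L0).
Qed.

(** The lost symbols are functions of the energies and of the codeword, hence independent of the
    noise: freeze them and apply Markov's inequality to the exponential. *)
Lemma noise_loss_tail w (r : R) :
  (Pr [set t | r <= \sum_(k < n) (- lost w t k * Z k t - (- lost w t k) ^+ 2 / 2)]%R
    <= (expR (- r))%:E)%E.
Proof.
pose f (p : sg (signal w) * sg noise) : \bar R :=
  (expR (\sum_(k < n) (- lost w p.1 k * Z k p.2 - (- lost w p.1 k) ^+ 2 / 2)))%:E.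
have f0 p : (0 <= f p)%E by rewrite lee_fin expR_ge0.
have mf : measurable_fun setT f.
  apply/measurable_EFinP; apply: measurableT_comp => //; apply: measurable_sum => k.
  have ml : measurable_fun setT (fun p : sg (signal w) * sg noise => - lost w p.1 k).
    have ml1 : measurable_fun [set: sg (signal w)] (fun t => - lost w t k).
      by apply: measurableT_comp => //; apply: lost_measurable.
    exact: (measurableT_comp ml1 measurable_fst).
  apply: measurable_funB; last by apply: measurable_funM => //; exact: measurable_funX.
  apply: measurable_funM => //.
  have mz : measurable_fun [set: sg noise] (Z k) by apply: noise_measurable.
  exact: (measurableT_comp mz measurable_snd).
have dis i : signal w i -> ~~ noise i by case: i => [[[]|[]]|].
pose g t := expR (\sum_(k < n) (- lost w t k * Z k t - (- lost w t k) ^+ 2 / 2)).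
have mS : measurable_fun setT (fun t => \sum_(k < n) (- lost w t k * Z k t - (- lost w t k) ^+ 2 / 2)).
  apply: measurable_sum => k.
  have ml : measurable_fun setT (fun t => - lost w t k).
    apply: measurableT_comp => //; apply: (sigma_ofW sources_measurable (J := predT)).
    exact: lost_measurable.
  apply: measurable_funB; last by apply: measurable_funM => //; exact: measurable_funX.
  by apply: measurable_funM.
apply: (@le_trans _ _ (\int[Pr]_t (expR (- r) * g t)%:E)%E).
  apply: prob_le_integral.
  - have := measurable_fun_ler (measurable_cst r) mS measurableT (Y := [set true]).
    by rewrite setTI; exact.
  - by apply: measurable_funM => //; exact: measurableT_comp.
  - by move=> t; rewrite mulr_ge0 ?expR_ge0.
  - by move=> t /= rt; rewrite /g -expRD -[leLHS]expR0 ler_expR addrC subr_ge0.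
under eq_integral do rewrite EFinM.
rewrite ge0_integralZl//; last 2 first.
- by apply/measurable_EFinP; exact: measurableT_comp.
- by move=> t _; rewrite lee_fin expR_ge0.
have -> : (\int[Pr]_t (g t)%:E = \int[Pr]_t f (t, t))%E by [].
rewrite (sources_decouple dis mf f0).
have inner t : (\int[Pr]_s f (t, s) = 1)%E.
  exact: (noise_exponential_martingale (fun k => - lost w t k)).
under eq_integral do rewrite inner.
by rewrite prob_integral_cst mule1.
Qed.

(** * Scores of the wrong codewords *)

Definition received w t (k : 'I_n) : R :=
  be_input L (sym w t) (enr t) k + Z k t.

Definition symbols (w : 'I_M) : pred index := fun i =>
  if i is inl (inr (w', k)) then w' == w else false.

Lemma received_measurable (J : pred index) w k :
  (forall i, signal w i -> J i) -> (forall i, noise i -> J i) ->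
  measurable_fun [set: sg J] (fun t => received w t k).
Proof.
move=> wJ zJ; apply: measurable_funD; last by apply: noise_measurable; apply: zJ.
have mX k' : measurable_fun [set: sg J] (X w k').
  by apply: symbol_measurable; apply: wJ => /=.
have mE k' : measurable_fun [set: sg J] (En k').
  by apply: energy_measurable; apply: wJ.
exact: (measurable_be_input (x := fun k => X w k : sg J -> R) (e := fun k => En k : sg J -> R) k L0).
Qed.

Lemma normal_pdf_gt0 (m s x : R) : s != 0 -> 0 < normal_pdf m s x.
Proof.
move=> s0; rewrite normal_pdf_sqr// mulr_gt0 ?expR_gt0// invr_gt0 sqrtr_gt0.
by rewrite mulrn_wgt0// mulr_gt0 ?pi_gt0// exprn_even_gt0.
Qed.

Lemma measurable_normal_pdf2 d' (T' : measurableType d') (u v : T' -> R) (s : R) :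
  s != 0 -> measurable_fun setT u -> measurable_fun setT v ->
  measurable_fun setT (fun t => normal_pdf (u t) s (v t)).
Proof.
move=> s0 mu mv; under eq_fun do rewrite normal_pdf_sqr//.
apply: measurable_funM => //; apply: measurableT_comp => //.
apply: measurableT_comp => //; do 2 apply: measurable_funM => //.
by apply: measurable_funX; exact: measurable_funB.
Qed.

Let pY := normal_pdf (0 : R) (Num.sqrt (S + 1)).

Let sqS1 : Num.sqrt (S + 1) != 0.
Proof. by rewrite gt_eqF// sqrtr_gt0 addr_gt0. Qed.

Let pY_gt0 y : 0 < pY y. Proof. exact: normal_pdf_gt0. Qed.

Let mpYV : measurable_fun setT (fun y => (pY y)^-1).
Proof.
under eq_fun do rewrite /pY normal_pdf_sqr// invfM -expRN opprK.
apply: measurable_funM => //; apply: measurableT_comp => //.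
do 2 apply: measurable_funM => //.
by apply: measurable_funX; exact: measurable_funB.
Qed.

(** True for every fixed output: averaging the channel density over a Gaussian symbol gives exactly
    the output density in the denominator. *)
Lemma fresh_codeword_likelihood j (y : 'I_n -> R) :
  (\int[Pr]_t (\prod_(k < n) (normal_pdf (X j k t) 1 (y k) / pY (y k)))%:E = 1)%E.
Proof.
pose h (i : index) (t : T) : R :=
  if i is inl (inr (w', k)) then normal_pdf (X w' k t) 1 (y k) / pY (y k) else 1.
pose s := [seq symbol_index j k | k <- enum 'I_n].
have us : uniq s by rewrite map_inj_uniq => [|k k' []//]; exact: enum_uniq.
have mh i : i \in s -> measurable_fun [set: sg (pred1 i)] (h i).
  move=> /mapP[k _ ->]; apply: measurable_funM => //.
  by apply: measurable_normal_pdf2; rewrite ?oner_eq0//; apply: symbol_measurable => /=.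
have h0 i t : 0 <= h i t.
  by rewrite /h; case: i => [[|[w' k]]|]// *; rewrite divr_ge0 ?normal_pdf_ge0.
have := sources_prod us mh h0.
under eq_integral => t _.
  rewrite big_map big_enum/=.
  over.
move=> ->; rewrite big_map big_enum/=; apply: big1 => k _.
rewrite (@ge0_integral_symbol j k (fun x => (normal_pdf x 1 (y k) / pY (y k))%:E)).
- under eq_integral do rewrite EFinM.
  rewrite ge0_integralZr//.
  + rewrite integral_normal_pdf_conv// -EFinM divff//.
    by rewrite gt_eqF// pY_gt0.
  + by apply/measurable_EFinP; apply: measurable_normal_pdf2; rewrite ?oner_eq0.
  + by move=> x _; rewrite lee_fin normal_pdf_ge0.
  + by rewrite lee_fin invr_ge0 normal_pdf_ge0.
- apply/measurable_EFinP; apply: measurable_funM => //.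
  by apply: measurable_normal_pdf2; rewrite ?oner_eq0.
- by move=> x; rewrite lee_fin divr_ge0 ?normal_pdf_ge0.
Qed.

Definition physical : pred index := fun i => if i is inl _ then true else false.

Lemma score_measurable w j : measurable_fun [set: sg physical]
  (fun t => score S (fun v k => X v k t) (received w t) j).
Proof.
apply: measurable_sum => k.
have mr : measurable_fun [set: sg physical] (fun t => received w t k).
  by apply: received_measurable; [case=> [[[]|[]]|]|case=> [[[]|[]]|]].
apply: measurableT_comp => //; apply: measurable_funM.
  apply: measurable_normal_pdf2; rewrite ?oner_eq0//.
  exact: symbol_measurable.
exact: (measurableT_comp mpYV mr).
Qed.

Lemma score_measurableT w j :
  measurable_fun setT (fun t => score S (fun v k => X v k t) (received w t) j).
Proof. exact: (sigma_ofW sources_measurable (score_measurable w j)). Qed.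

(** All sources except the codeword of j are frozen, in particular the whole output produced by w,
    silenced blocks included; then Markov's inequality applies to the likelihood ratio. *)
Lemma wrong_codeword_tail w j (xi : R) : j != w -> 0 < xi ->
  (Pr [set t | ln xi <= score S (fun v k => X v k t) (received w t) j]%R
    <= (xi^-1)%:E)%E.
Proof.
move=> jw xi0.
pose J : pred index := fun i => ~~ symbols j i.
pose ratio t s := \prod_(k < n) (normal_pdf (X j k s) 1 (received w t k) / pY (received w t k)).
pose f (p : sg J * sg (symbols j)) : \bar R := (ratio p.1 p.2)%:E.
have ratio0 t s : 0 <= ratio t s.
  by apply: prodr_ge0 => k _; rewrite divr_ge0 ?normal_pdf_ge0.
have f0 p : (0 <= f p)%E by rewrite lee_fin.
have mr k : measurable_fun [set: sg J] (fun t => received w t k).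
  apply: received_measurable; last by case=> [[[]|[]]|].
  by case=> [[[]|[w' k']]|]//= /eqP ->; rewrite /J/= eq_sym.
have mf : measurable_fun setT f.
  apply/measurable_EFinP; apply: measurable_prod => k _.
  have mr1 : measurable_fun setT (fun p : sg J * sg (symbols j) => received w p.1 k).
    exact: (measurableT_comp (mr k) measurable_fst).
  apply: measurable_funM.
    apply: measurable_normal_pdf2; rewrite ?oner_eq0//.
    have mx : measurable_fun [set: sg (symbols j)] (X j k).
      by apply: symbol_measurable => /=.
    exact: (measurableT_comp mx measurable_snd).
  exact: (measurableT_comp mpYV mr1).
have dis i : J i -> ~~ symbols j i by [].
have mratio : measurable_fun setT (fun t => ratio t t).
  apply: measurable_prod => k _; apply: measurable_funM.
    by apply: measurable_normal_pdf2; rewrite ?oner_eq0//; exact: (sigma_ofW sources_measurable (mr k)).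
  exact: (measurableT_comp mpYV (sigma_ofW sources_measurable (mr k))).
apply: (@le_trans _ _ (\int[Pr]_t (xi^-1 * ratio t t)%:E)%E).
  apply: prob_le_integral.
  - have := measurable_fun_ler (measurable_cst (ln xi)) (score_measurableT w j) measurableT (Y := [set true]).
    by rewrite setTI; exact.
  - exact: measurable_funM.
  - by move=> t; rewrite mulr_ge0// invr_ge0 ltW.
  - move=> t /=; rewrite -[in X in X -> _]ler_expR lnK ?posrE// mulrC => xs.
    rewrite ler_pdivlMr// mul1r; apply: le_trans xs _.
    rewrite /score expR_sum /ratio; apply: ler_prod => k _.
    by rewrite expR_ge0/= lnK// posrE divr_gt0 ?normal_pdf_gt0 ?oner_eq0.
under eq_integral do rewrite EFinM.
rewrite ge0_integralZl//; last 3 first.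
- exact/measurable_EFinP.
- by move=> t _; rewrite lee_fin.
- by rewrite lee_fin invr_ge0 ltW.
have -> : (\int[Pr]_t (ratio t t)%:E = \int[Pr]_t f (t, t))%E by [].
rewrite (sources_decouple dis mf f0).
have inner t : (\int[Pr]_s f (t, s) = 1)%E.
  exact: (fresh_codeword_likelihood j (received w t)).
under eq_integral do rewrite inner.
by rewrite prob_integral_cst mule1.
Qed.

(** * The law of the ideal score *)

Local Notation sigma := (Num.sqrt (S / (S + 1))).
Local Notation N01 := (normal_prob (0 : R) 1).

(** The score of one symbol that is actually sent, centred by its mean ln (1 + S) / 2; see
    [log_likelihood_ratio]. *)
Definition info_density (x z : R) : R := ((x + z) ^+ 2 / (S + 1) - z ^+ 2) / 2.

Definition channel_uses (w : 'I_M) (A : pred 'I_n) : pred index := fun i =>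
  match i with
  | inl (inr (w', k)) => (w' == w) && A k
  | inl (inl (inr m)) => oapp A false (insub m)
  | _ => false
  end.

Lemma measurable_info_density d' (T' : measurableType d') (u v : T' -> R) :
  measurable_fun setT u -> measurable_fun setT v ->
  measurable_fun setT (fun t => info_density (u t) (v t)).
Proof.
move=> mu mv; apply: measurable_funM => //; apply: measurable_funB.
  by apply: measurable_funM => //; apply: measurable_funX; exact: measurable_funD.
exact: measurable_funX.
Qed.

Lemma measurable_sqrt : measurable_fun [set: R] Num.sqrt.
Proof. by apply: continuous_measurable_fun; exact: sqrt_continuous. Qed.

Lemma measurable_sum_seq d' (T' : measurableType d') (I : eqType) (s : seq I) (g : I -> T' -> R) :
  (forall i, i \in s -> measurable_fun setT (g i)) ->
  measurable_fun setT (fun t => \sum_(i <- s) g i t).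
Proof.
move=> mg; under eq_fun do rewrite big_seq big_mkcond/=.
apply: (measurable_sum s (h := fun i t => if i \in s then g i t else 0)) => i.
by case: (i \in s) (mg i) => // mgi; exact: mgi.
Qed.

(** Induction on the symbols. By induction the sum over s has the law of sigma sqrt V h', and the
    rotation gives the new symbol the law of sigma g h. For frozen g and V the combination g h +
    sqrt V h' is sqrt (g^2 + V) times one standard normal, so that squares accumulate under the
    root. *)
Lemma info_density_sum_law w (s : seq 'I_n) (f : R -> \bar R) : uniq s ->
  measurable_fun setT f -> (forall x, 0 <= f x)%E ->
  (\int[Pr]_t f (\sum_(k <- s) info_density (X w k t) (Z k t))%R =
   \int[Pr]_t \int[N01]_h f (sigma * (Num.sqrt (\sum_(k <- s) Z k t ^+ 2) * h))%R)%E.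
Proof.
elim: s f => [|k s IHs] f /= us mf f0.
  transitivity (f 0); first by under eq_integral do rewrite big_nil; rewrite prob_integral_cst.
  under eq_integral => t _.
    under eq_integral do rewrite big_nil sqrtr0 mul0r mulr0.
    rewrite integral_normal_cst; over.
  by rewrite prob_integral_cst.
have /andP[ks us'] := us.
pose T_ t := \sum_(j <- s) info_density (X w j t) (Z j t).
pose V t := \sum_(j <- s) Z j t ^+ 2.
have mX1 (A : pred 'I_n) j : A j -> measurable_fun [set: sg (channel_uses w A)] (X w j).
  by move=> Aj; apply: symbol_measurable => /=; rewrite eqxx.
have mZ1 (A : pred 'I_n) (j : 'I_n) : A j -> measurable_fun [set: sg (channel_uses w A)] (Z j).
  by move=> Aj; apply: noise_measurable => /=; rewrite valK.
have mT : measurable_fun [set: sg (channel_uses w (mem s))] T_.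
  apply: measurable_sum_seq => j sj; apply: measurable_info_density.
    exact: mX1.
  exact: mZ1.
have mV : measurable_fun [set: sg (channel_uses w (mem s))] V.
  by apply: measurable_sum_seq => j sj; apply: measurable_funX; exact: mZ1.
have mVT : measurable_fun [set: T] V by exact: (sigma_ofW sources_measurable mV).
have msqV : measurable_fun [set: T] (fun t => Num.sqrt (V t)).
  exact: (measurableT_comp measurable_sqrt mVT).
have V0 t : 0 <= V t by apply: sumr_ge0 => j _; rewrite sqr_ge0.
pose F3 (p : R * T) := (\int[N01]_h f (p.1 + sigma * (Num.sqrt (V p.2) * h))%R)%E.
have mF30 : measurable_fun setT (fun p : (R * T) * R =>
    f (p.1.1 + sigma * (Num.sqrt (V p.1.2) * p.2))%R).
  apply: (measurableT_comp mf); apply: measurable_funD.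
    exact: (measurableT_comp measurable_fst measurable_fst).
  apply: measurable_funM => //; apply: measurable_funM => //.
  exact: (measurableT_comp msqV (measurableT_comp measurable_snd measurable_fst)).
have mF3 : measurable_fun setT F3.
  exact: (@measurable_fun_fubini_tonelli_F _ _ _ _ _ N01 _ mF30).
have F30 p : (0 <= F3 p)%E by apply: integral_ge0.
pose G u := (\int[Pr]_s F3 (u, s))%E.
have mG : measurable_fun setT G.
  exact: (@measurable_fun_fubini_tonelli_F _ _ _ _ _ Pr _ mF3).
have G0 u : (0 <= G u)%E by apply: integral_ge0.
have step1 : (\int[Pr]_t f (\sum_(j <- k :: s) info_density (X w j t) (Z j t))%R =
    \int[Pr]_t G (info_density (X w k t) (Z k t)))%E.
  pose f1 (p : sg (channel_uses w (pred1 k)) * sg (channel_uses w (mem s))) :=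
    f (info_density (X w k p.1) (Z k p.1) + T_ p.2)%R.
  have mq : measurable_fun [set: sg (channel_uses w (pred1 k))]
      (fun t => info_density (X w k t) (Z k t)).
    by apply: measurable_info_density; [apply: mX1|apply: mZ1] => /=.
  have mf1 : measurable_fun setT f1.
    apply: (measurableT_comp mf); apply: measurable_funD.
      exact: (measurableT_comp mq measurable_fst).
    exact: (measurableT_comp mT measurable_snd).
  have f10 p : (0 <= f1 p)%E by exact: f0.
  have dis i : channel_uses w (pred1 k) i -> ~~ channel_uses w (mem s) i.
    case: i => [[[m|m]|[w' j]]|b] //=.
      by case: insubP => //= j _ _ /eqP ->.
    by case/andP => _ /eqP ->; rewrite (negbTE ks) andbF.
  transitivity (\int[Pr]_t f1 (t, t))%E.
    by apply: eq_integral => t _; rewrite big_cons.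
  rewrite (sources_decouple dis mf1 f10); apply: eq_integral => t _.
  pose g u := f (info_density (X w k t) (Z k t) + u)%R.
  have mg : measurable_fun setT g.
    by apply: (measurableT_comp mf); apply: measurable_funD.
  exact: (IHs g us' mg (fun u => f0 _)).
have step2 : (\int[Pr]_t G (info_density (X w k t) (Z k t)) =
    \int[N01]_g \int[N01]_h G (sigma * (g * h))%R)%E.
  pose f2 (p : sg (pred1 (symbol_index w k)) * sg (pred1 (noise_index k))) :=
    G (info_density (X w k p.1) (Z k p.2)).
  have mXk : measurable_fun [set: sg (pred1 (symbol_index w k))] (X w k).
    by apply: symbol_measurable => /=.
  have mZk : measurable_fun [set: sg (pred1 (noise_index k))] (Z k).
    by apply: noise_measurable => /=.
  have mf2 : measurable_fun setT f2.
    apply: (measurableT_comp mG); apply: measurable_info_density.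
      exact: (measurableT_comp mXk measurable_fst).
    exact: (measurableT_comp mZk measurable_snd).
  have f20 p : (0 <= f2 p)%E by exact: G0.
  have dis i : pred1 (symbol_index w k) i -> ~~ pred1 (noise_index k) i by move=> /eqP ->.
  transitivity (\int[Pr]_t f2 (t, t))%E => //.
  rewrite (sources_decouple dis mf2 f20).
  have mGx x : measurable_fun setT (fun z : R => G (info_density x z)).
    by apply: (measurableT_comp mG); apply: measurable_info_density.
  have row t : (\int[Pr]_s f2 (t, s) = \int[N01]_z G (info_density (X w k t) z))%E.
    pose gx z := G (info_density (X w k t) z).
    have gx0 z : (0 <= gx z)%E by exact: G0.
    exact: (ge0_integral_noise k (mGx (X w k t) : measurable_fun setT gx) gx0).
  under eq_integral do rewrite row.
  rewrite (ge0_integral_symbol w k (f := fun x => \int[N01]_z G (info_density x z))%E).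
  - exact: (integral_normal_info_density S0 mG G0).
  - have mGG : measurable_fun setT (fun p : R * R => G (info_density p.1 p.2)).
      by apply: (measurableT_comp mG); apply: measurable_info_density.
    exact: (@measurable_fun_fubini_tonelli_F _ _ _ _ _ N01 _ mGG).
  - by move=> x; apply: integral_ge0.
pose H z v := (\int[N01]_h f (sigma * (Num.sqrt (z ^+ 2 + v) * h))%R)%E.
have step3 g : (\int[N01]_h G (sigma * (g * h))%R = \int[Pr]_s H g (V s))%E.
  have mF4 : measurable_fun setT (fun p : R * T => F3 (sigma * (g * p.1), p.2)%R).
    apply: (measurableT_comp mF3); apply/measurable_fun_pairP; split.
      by apply: measurable_funM => //; exact: measurable_funM.
    exact: measurable_snd.
  rewrite /G (@fubini_tonelli _ _ _ _ _ N01 Pr _ mF4)/=; last by move=> p; exact: F30.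
  apply: eq_integral => s' _.
  have mfs : measurable_fun setT (fun u => f (sigma * u)%R).
    by apply: (measurableT_comp mf); exact: measurable_funM.
  have Hl := integral_normal_lin g (Num.sqrt (V s')) mfs (fun u => f0 _).
  have HV : g ^+ 2 + Num.sqrt (V s') ^+ 2 = g ^+ 2 + V s' by rewrite (sqr_sqrtr (V0 s')).
  rewrite HV in Hl.
  refine (etrans _ Hl).
  apply: eq_integral => h _; apply: eq_integral => h' _.
  by rewrite mulrDr.
(* The variable g comes from the rotation and is not the noise of symbol k, but it has the law of
   [Z k] and is independent of V. Only laws matter, so it may be renamed, which makes g^2 + V the
   noise energy of k :: s. *)
have step4 : (\int[Pr]_t H (Z k t) (V t) = \int[N01]_g \int[Pr]_s H g (V s))%E.
  pose A : pred index := fun i => if i is inl (inl (inr m)) then oapp (mem s) false (insub m) else false.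
  pose f4 (p : sg (pred1 (noise_index k)) * sg A) := H (Z k p.1) (V p.2).
  have mZk : measurable_fun [set: sg (pred1 (noise_index k))] (Z k).
    by apply: noise_measurable => /=.
  have mVA : measurable_fun [set: sg A] V.
    apply: measurable_sum_seq => j sj; apply: measurable_funX.
    by apply: noise_measurable => /=; rewrite valK.
  have mH0 : measurable_fun setT (fun p : (R * R) * R =>
      f (sigma * (Num.sqrt (p.1.1 ^+ 2 + p.1.2) * p.2))%R).
    apply: (measurableT_comp mf); apply: measurable_funM => //; apply: measurable_funM => //.
    apply: (measurableT_comp measurable_sqrt); apply: measurable_funD.
      by apply: measurable_funX; exact: (measurableT_comp measurable_fst measurable_fst).
    exact: (measurableT_comp measurable_snd measurable_fst).
  have mH : measurable_fun setT (fun p : R * R => H p.1 p.2).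
    exact: (@measurable_fun_fubini_tonelli_F _ _ _ _ _ N01 _ mH0).
  have H0 z v : (0 <= H z v)%E by apply: integral_ge0.
  have mf4 : measurable_fun setT f4.
    have mu4 : measurable_fun setT (fun p : sg (pred1 (noise_index k)) * sg A => (Z k : T -> R) p.1).
      exact: (measurableT_comp mZk measurable_fst).
    have mv4 : measurable_fun setT (fun p : sg (pred1 (noise_index k)) * sg A => V p.2).
      exact: (measurableT_comp mVA measurable_snd).
    exact: (measurable_fun2 mH mu4 mv4).
  have f40 p : (0 <= f4 p)%E by exact: H0.
  have dis i : pred1 (noise_index k) i -> ~~ A i.
    by move=> /eqP -> /=; rewrite valK.
  transitivity (\int[Pr]_t f4 (t, t))%E => //.
  rewrite (sources_decouple dis mf4 f40).
  apply: (ge0_integral_noise k (f := fun z => \int[Pr]_s H z (V s))%E).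
    have mHV : measurable_fun setT (fun p : R * T => H p.1 (V p.2)).
      have mv5 : measurable_fun setT (fun p : R * T => V p.2).
        exact: (measurableT_comp mVT measurable_snd).
      exact: (measurable_fun2 mH measurable_fst mv5).
    exact: (@measurable_fun_fubini_tonelli_F _ _ _ _ _ Pr _ mHV).
  by move=> z; apply: integral_ge0.
rewrite step1 step2; under eq_integral do rewrite step3.
rewrite -step4; apply: eq_integral => t _; apply: eq_integral => h _.
by rewrite big_cons.
Qed.

Lemma noise_energy_mgf (a : R) : 2 * a < 1 ->
  (\int[Pr]_t (expR (a * \sum_(k < n) Z k t ^+ 2))%:E =
   ((Num.sqrt (1 - 2 * a))^-1 ^+ n)%:E)%E.
Proof.
move=> a1.
pose h (i : index) (t : T) : R :=
  if i is inl (inl (inr m)) then expR (a * Z m t ^+ 2) else 1.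
pose s := [seq noise_index k | k <- map val (enum 'I_n)].
have us : uniq s.
  by rewrite map_inj_uniq => [|k k' []//]; rewrite val_enum_ord iota_uniq.
have mh i : i \in s -> measurable_fun [set: sg (pred1 i)] (h i).
  move=> /mapP[k _ ->]; apply: measurableT_comp => //; apply: measurable_funM => //.
  by apply: measurable_funX; apply: noise_measurable => /=.
have h0 i t : 0 <= h i t by rewrite /h; case: i => [[[]|]|]// *; exact: expR_ge0.
have := sources_prod us mh h0.
under eq_integral => t _.
  rewrite big_map big_map big_enum/= -expR_sum -mulr_sumr.
  over.
move=> ->; rewrite big_map big_map big_enum/=.
rewrite (eq_bigr (fun=> (Num.sqrt (1 - 2 * a))^-1%:E)); last first.
  move=> k _; rewrite (@ge0_integral_noise k (fun z => (expR (a * z ^+ 2))%:E)).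
  - by rewrite integral_normal_expR_sqr ?expr1n ?mulr1.
  - apply/measurable_EFinP; apply: measurableT_comp => //.
    by apply: measurable_funM => //; exact: measurable_funX.
  - by move=> z; rewrite lee_fin expR_ge0.
by rewrite prodEFin; congr EFin; rewrite prodr_const card_ord.
Qed.

(** At scale 1 / sqrt n the linear terms cancel and the quadratic ones add up to 3/2 u^2 n = 3 / 32.
    The condition n >= 4 keeps u within the range of [sqrt_mgf_le]. *)
Lemma noise_energy_exp_moment (u : R) : (4 <= n)%N -> `|u| = 1 / (4 * Num.sqrt n%:R) ->
  (\int[Pr]_t (expR (u * (\sum_(k < n) Z k t ^+ 2 - n%:R)))%:E <= 2%:E)%E.
Proof.
move=> n4 uE; have n4R : 4 <= n%:R :> R by rewrite ler_nat.
have sn2 : Num.sqrt n%:R ^+ 2 = n%:R :> R by rewrite sqr_sqrtr.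
have sn : 2 <= Num.sqrt n%:R :> R by have := sqrtr_ge0 (n%:R : R); nra.
have u8 : `|u| <= 1 / 8.
  by rewrite uE ler_pdivrMr; lra.
have u2 : u ^+ 2 * n%:R = 1 / 16.
  rewrite -(real_normK (num_real u)) uE -{2}sn2; field.
  by rewrite gt_eqF//; lra.
have := u8; rewrite ler_norml => /andP[u81 u82].
under eq_integral do rewrite mulrBr expRD EFinM.
rewrite ge0_integralZr//; last first.
  apply/measurable_EFinP; apply: measurableT_comp => //; apply: measurable_funM => //.
  by apply: measurable_sum => k; apply: measurable_funX.
rewrite noise_energy_mgf; last by lra.
rewrite -EFinM lee_fin.
apply: (@le_trans _ _ (expR (u + 3 / 2 * u ^+ 2) ^+ n * expR (- (u * n%:R)))).
  rewrite ler_pM2r ?expR_gt0//; apply: lerXn2r; rewrite ?nnegrE ?expR_ge0 ?invr_ge0 ?sqrtr_ge0//.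
  exact: sqrt_mgf_le.
rewrite -expRM_natl -expRD.
have -> : n%:R * (u + 3 / 2 * u ^+ 2) - u * n%:R = 3 / 32.
  transitivity (3 / 2 * (u ^+ 2 * n%:R)); first by ring.
  by rewrite u2; lra.
rewrite -[expR _]invrK -expRN; have := expR_ge1Dx (- (3 / 32) : R).
move=> h; rewrite -[leRHS]invrK lef_pV2 ?posrE ?invr_gt0 ?expR_gt0//; lra.
Qed.

(* Conditionally on the noise energy V the sum is N(0, sigma^2 V), and V / n is
   within O(1 / sqrt n) of 1. *)
Lemma info_density_cdf w (x : R) : (4 <= n)%N ->
  (Pr [set t | \sum_(k < n) info_density (X w k t) (Z k t)
                 < sigma * (Num.sqrt n%:R * x)]%R
    <= (Phi x + 32 * (1 + `|x|) / Num.sqrt n%:R)%:E)%E.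
Proof.
move=> n4; set A := sigma * _.
have n4R : 4 <= n%:R :> R by rewrite ler_nat.
have sn0 : 0 < Num.sqrt n%:R :> R by rewrite sqrtr_gt0; lra.
have sn2 : Num.sqrt n%:R ^+ 2 = n%:R :> R by rewrite sqr_sqrtr.
have sig0 : 0 < sigma by rewrite sqrtr_gt0 divr_gt0// addr_gt0.
have mset d' (T' : measurableType d') (g : T' -> R) : measurable_fun setT g ->
    measurable [set t | g t < A].
  move=> mg; have := measurable_fun_ltr mg (measurable_cst A) measurableT (Y := [set true]).
  by rewrite setTI; exact.
have mI : measurable_fun setT (fun t => \sum_(k < n) info_density (X w k t) (Z k t)).
  by apply: measurable_sum => k; apply: measurable_info_density.
pose f u : \bar R := (\1_[set u : R | u < A] u)%:E.
have mf : measurable_fun setT f.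
  by apply/measurable_EFinP; apply: measurable_indic; apply: (mset _ _ idfun); exact: measurable_id.
have f0 u : (0 <= f u)%E by rewrite lee_fin.
have eE t : \sum_(k < n) info_density (X w k t) (Z k t) =
    \sum_(k <- enum 'I_n) info_density (X w k t) (Z k t) by rewrite big_enum.
pose V t := \sum_(k < n) Z k t ^+ 2.
have V0 t : 0 <= V t by apply: sumr_ge0 => j _; rewrite sqr_ge0.
have mV : measurable_fun setT V.
  by apply: measurable_sum => k; apply: measurable_funX.
have -> : (Pr [set t | \sum_(k < n) info_density (X w k t) (Z k t) < A]%R =
    \int[Pr]_t f (\sum_(k <- enum 'I_n) info_density (X w k t) (Z k t))%R)%E.
  rewrite -[X in Pr X]setIT -integral_indic//; last exact: mset.
  apply: eq_integral => t _; rewrite /f -eE !indicE.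
  by congr (_%:R%:E); apply/idP/idP; rewrite !inE.
rewrite (info_density_sum_law w (enum_uniq _) mf f0).
pose y (c : R) t := expR (c / (4 * Num.sqrt n%:R) * (V t - n%:R)).
have my c : measurable_fun setT (y c).
  apply: measurableT_comp => //; apply: measurable_funM => //.
  exact: measurable_funB.
(* The 8 is the 2 of [normal_dilated_cdf] times the 4 in the scale 4 / sqrt n of the deviation; two
   exponential moments of at most 2 each make it 32. *)
pose b := 8 * (1 + `|x|) / Num.sqrt n%:R.
have b0 : 0 <= b by rewrite divr_ge0// mulr_ge0// addr_ge0.
have inner t : (\int[N01]_h f (sigma * (Num.sqrt (\sum_(k <- enum 'I_n) Z k t ^+ 2) * h))%R
    <= (Phi x + b * (y 1 t + y (-1) t))%:E)%E.
  have VE : \sum_(k <- enum 'I_n) Z k t ^+ 2 = V t by rewrite big_enum.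
  have v0 : 0 <= V t / n%:R by rewrite divr_ge0.
  have sVE : Num.sqrt (V t) = Num.sqrt n%:R * Num.sqrt (V t / n%:R).
    rewrite -sqrtrM// mulrC divfK// gt_eqF//; lra.
  have fE h : f (sigma * (Num.sqrt (\sum_(k <- enum 'I_n) Z k t ^+ 2) * h)) =
      (\1_[set h | Num.sqrt (V t / n%:R) * h < x] h)%:E.
    congr EFin; rewrite !indicE; congr ((nat_of_bool _)%:R).
    apply/idP/idP; rewrite !inE/= VE sVE /A -mulrA.
      by rewrite ltr_pM2l// ltr_pM2l.
    by rewrite ltr_pM2l// ltr_pM2l.
  have mt : measurable_fun [set: R] (fun z => Num.sqrt (V t / n%:R) * z) by exact: measurable_funM.
  have mD : measurable [set h : R | Num.sqrt (V t / n%:R) * h < x].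
    have := measurable_fun_ltr mt (measurable_cst x) measurableT (Y := [set true]).
    by rewrite setTI; exact.
  have intE : (\int[N01]_h f (sigma * (Num.sqrt (\sum_(k <- enum 'I_n) Z k t ^+ 2) * h))%R
     = N01 [set h | Num.sqrt (V t / n%:R) * h < x]%R)%E.
    rewrite -[X in N01 X]setIT -integral_indic//.
    by apply: eq_integral => h _; exact: fE.
  rewrite intE; apply: (le_trans (normal_dilated_cdf x v0)); rewrite lee_fin lerD2l.
  have nl := normr_le_expR (1 / (4 * Num.sqrt n%:R) * (V t - n%:R)).
  have vE (r : R) : 0 < r -> r ^+ 2 = n%:R ->
      V t / n%:R - 1 = 4 / r * (1 / (4 * r) * (V t - n%:R)).
    by move=> r0 <-; field; rewrite gt_eqF.
  rewrite (vE _ sn0 sn2) normrM (ger0_norm (_ : 0 <= 4 / Num.sqrt n%:R)); last by rewrite divr_ge0 ?ltW.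
  apply: (@le_trans _ _ (2 * (1 + `|x|) * (4 / Num.sqrt n%:R * (y 1 t + y (-1) t)))).
    apply: ler_wpM2l; first by rewrite mulr_ge0// addr_ge0.
    apply: ler_wpM2l; first by rewrite divr_ge0 ?ltW.
    by rewrite /y !mulNr.
  by rewrite /b le_eqVlt; apply/orP; left; apply/eqP; ring.
have m1 : measurable_fun setT (fun t => Phi x + b * (y 1 t + y (-1) t)).
  by apply: measurable_funD => //; apply: measurable_funM => //; apply: measurable_funD.
apply: (@le_trans _ _ (\int[Pr]_t (Phi x + b * (y 1 t + y (-1) t))%:E)%E).
  apply: ge0_le_integral => //.
  - by move=> t _; apply: integral_ge0.
  - have mf30 : measurable_fun setT (fun p : T * R =>
        f (sigma * (Num.sqrt (\sum_(k <- enum 'I_n) Z k p.1 ^+ 2) * p.2))%R).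
      apply: (measurableT_comp mf); apply: measurable_funM => //; apply: measurable_funM => //.
      apply: (measurableT_comp measurable_sqrt).
      have mVe : measurable_fun setT (fun t => \sum_(k <- enum 'I_n) Z k t ^+ 2).
        by apply: measurable_sum => k; apply: measurable_funX.
      exact: (measurableT_comp mVe measurable_fst).
    exact: (@measurable_fun_fubini_tonelli_F _ _ _ _ _ N01 _ mf30).
  - exact/measurable_EFinP.
have y0 c t : 0 <= y c t by exact: expR_ge0.
have ybd c : `|c| = 1 -> (\int[Pr]_t (y c t)%:E <= 2%:E)%E.
  move=> c1; apply: noise_energy_exp_moment => //.
  by rewrite normrM c1 gtr0_norm// invr_gt0 mulr_gt0.
under eq_integral do rewrite EFinD EFinM EFinD.
have m2 : measurable_fun setT (fun t => (y 1 t)%:E + (y (-1) t)%:E)%E.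
  by apply: emeasurable_funD; apply/measurable_EFinP.
rewrite ge0_integralD//; last 3 first.
- by move=> t _; rewrite lee_fin Phi_ge0.
- by move=> t _; rewrite -EFinD -EFinM lee_fin mulr_ge0// addr_ge0.
- by apply: emeasurable_funM => //; exact: measurable_cst.
rewrite prob_integral_cst EFinD leeD2l//.
rewrite ge0_integralZl//; last by move=> t _; rewrite adde_ge0// lee_fin.
rewrite ge0_integralD//; try (by move=> t _; rewrite lee_fin); try exact/measurable_EFinP.
apply: (@le_trans _ _ (b%:E * (2%:E + 2%:E))%E).
  apply: lee_wpmul2l; first by rewrite lee_fin.
  by apply: leeD; apply: ybd; rewrite ?normrN normr1.
rewrite -EFinD -EFinM lee_fin /b le_eqVlt; apply/orP; left; apply/eqP; ring.
Qed.

(** * The score of the transmitted codeword *)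

Lemma lost_energyE w t :
  \sum_(k < n) lost w t k ^+ 2 =
  \sum_(l < num_blocks L n | ~~ fits L (sym w t) (enr t) l) block_energy L (sym w t) l.
Proof.
have blk (k : 'I_n) : (k %/ L < num_blocks L n)%N.
  rewrite ltn_divLR// /num_blocks.
  have := ltn_pmod (n + L.-1) L0; have := divn_eq (n + L.-1) L; have := ltn_ord k.
  move: (_ %/ L * L)%N (_ %% L)%N; lia.
rewrite (partition_big (fun k : 'I_n => Ordinal (blk k)) predT)//= [RHS]big_mkcond/=.
apply: eq_bigr => l _; case: ifP => lf.
  apply: eq_big => [k|k /eqP kl]; first by rewrite -val_eqE.
  by rewrite /lost be_input_fits -[(k %/ L)%N]/(val (Ordinal (blk k))) kl (negbTE lf) subr0.
apply: big1 => k /eqP kl.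
rewrite /lost be_input_fits -[(k %/ L)%N]/(val (Ordinal (blk k))) kl.
by rewrite (negbFE lf) subrr expr0n.
Qed.

Lemma lost_energy_le w t (lam : R) :
  (forall l : 'I_(num_blocks L n), block_energy L (sym w t) l <= lam) ->
  \sum_(k < n) lost w t k ^+ 2 <= (misfits L (sym w t) (enr t) (num_blocks L n))%:R * lam.
Proof.
move=> Bl; rewrite lost_energyE /misfits.
apply: (@le_trans _ _ (\sum_(l < num_blocks L n | ~~ fits L (sym w t) (enr t) l) lam)).
  by apply: ler_sum => l _; exact: Bl.
rewrite big_mkcond/= natr_sum mulr_suml; apply: ler_sum => l _.
by case: (fits _ _ _ _); rewrite ?mul0r ?mul1r.
Qed.

Lemma log_likelihood_ratio (x y : R) :
  ln (normal_pdf x 1 y / normal_pdf 0 (Num.sqrt (S + 1)) y) =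
  ln (1 + S) / 2 + (y ^+ 2 / (S + 1) - (y - x) ^+ 2) / 2.
Proof.
have S1 : 0 < S + 1 by rewrite addr_gt0.
have sS1 : Num.sqrt (S + 1) != 0 by rewrite gt_eqF// sqrtr_gt0.
have s2 : Num.sqrt (S + 1) ^+ 2 = S + 1 by rewrite sqr_sqrtr// ltW.
have pi0 : 0 < (pi : R) *+ 2 by rewrite mulrn_wgt0// pi_gt0.
rewrite !normal_pdf_sqr ?oner_eq0// s2 expr1n mul1r divr1 subr0.
rewrite -mulrnAr (sqrtrM _ (ltW S1)).
have sp : 0 < Num.sqrt ((pi : R) *+ 2) by rewrite sqrtr_gt0.
transitivity (ln (Num.sqrt (S + 1) * expR (- ((y - x) ^+ 2 / 2) + y ^+ 2 / (S + 1) / 2))).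
  congr ln; rewrite expRD -[expR (y ^+ 2 / _ / 2)]invrK -expRN; field.
  by rewrite !gt_eqF ?expR_gt0// sqrtr_gt0.
rewrite lnM ?posrE ?expR_gt0 ?sqrtr_gt0// expRK.
have -> : ln (Num.sqrt (S + 1)) = ln (1 + S) / 2.
  rewrite (addrC 1) -[in RHS]s2 lnXn; last by rewrite sqrtr_gt0.
  by rewrite -[X in X / 2]mulr_natr mulfK.
ring.
Qed.

Lemma score_lower_bound w t (r lam : R) (N : nat) : 0 <= r -> 0 <= lam ->
  (misfits L (sym w t) (enr t) (num_blocks L n) <= N)%N ->
  (forall l : 'I_(num_blocks L n), block_energy L (sym w t) l <= lam) ->
  \sum_(k < n) (- lost w t k * Z k t - (- lost w t k) ^+ 2 / 2) <= r ->
  n%:R / 2 * ln (1 + S) + \sum_(k < n) info_density (X w k t) (Z k t) - N%:R * lam - r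
    <= score S (fun v k => X v k t) (received w t) w.
Proof.
move=> r0 lam0 mN Bl loss.
have V0 : 0 <= \sum_(k < n) lost w t k ^+ 2 by apply: sumr_ge0 => k _; rewrite sqr_ge0.
have VN : \sum_(k < n) lost w t k ^+ 2 <= N%:R * lam.
  apply: (le_trans (lost_energy_le Bl)); apply: ler_wpM2r => //.
  by rewrite ler_nat.
have S1 : 0 < S + 1 by rewrite addr_gt0.
have per k : ln (normal_pdf (X w k t) 1 (received w t k) /
      normal_pdf 0 (Num.sqrt (S + 1)) (received w t k)) =
    ln (1 + S) / 2 + info_density (X w k t) (Z k t)
    - lost w t k ^+ 2 * ((2 + S) / (2 * (S + 1)))
    - S / (S + 1) * (- lost w t k * Z k t).
  rewrite log_likelihood_ratio /received /info_density /lost be_input_fits.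
  by case: fits; field; rewrite gt_eqF.
rewrite /score (eq_bigr _ (fun k _ => per k)) !big_split/= !sumrN.
rewrite sumr_const card_ord -(mulr_sumr _ _ (fun k => - lost w t k * Z k t)).
rewrite -(mulr_suml _ _ (fun k => lost w t k ^+ 2)).
(* Completing the noise term to the exponent with mean-one exponential moves half of the lost
   energy, weighted by S / (S + 1). The total weight of the lost energy then becomes exactly 1, see
   [cV]. *)
have -> : \sum_(k < n) (- lost w t k * Z k t) =
   \sum_(k < n) (- lost w t k * Z k t - (- lost w t k) ^+ 2 / 2)
   + (\sum_(k < n) lost w t k ^+ 2) / 2.
  rewrite mulr_suml -big_split/=; apply: eq_bigr => k _ /=; by field.
move: loss VN V0; set A := \sum_(k < n) (_ - _); set V := \sum_(k < n) lost w t k ^+ 2.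
move=> Ar VN V0; rewrite -[ln (1 + S) / 2 *+ n]mulr_natl.
have c1 : 0 <= S / (S + 1) <= 1.
  rewrite divr_ge0 ?(ltW S0) ?(ltW S1)//= ler_pdivrMr// mul1r lerDl//.
have cA : S / (S + 1) * A <= r.
  case/andP: c1 => c0 c1; case: (leP 0 A) => A0; last by nra.
  by apply: le_trans Ar; rewrite -[leRHS]mul1r ler_wpM2r.
have cV : V * ((2 + S) / (2 * (S + 1))) + S / (S + 1) * (V / 2) = V.
  by field; rewrite gt_eqF.
rewrite (_ : n%:R * (ln (1 + S) / 2) = n%:R / 2 * ln (1 + S)); last by field.
move: cV cA; rewrite mulrDr; lra.
Qed.

(** The message is independent of energies, noise and codebook, so the events for fixed w enter with
    weight 1 / M each. They must therefore be events of [physical], free of message and guess. *)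
Lemma message_mixture (A : 'I_M -> set T) (B : set T) (p : R) :
  measurable B -> (forall w, <<s cylinders F physical >> (A w)) ->
  (forall w, (Pr (A w) <= p%:E)%E) -> (forall t, B t -> A (W t) t) ->
  (Pr B <= p%:E)%E.
Proof.
move=> mB sA Ap BA.
have phys_meas : <<s cylinders F physical >> `<=` measurable.
  apply: smallest_sub; first exact: sigma_algebra_measurable.
  exact: (cylinders_measurable sources_measurable).
have M0 : (0 < M)%N by case: (W point) => m; case: (M).
have mA w : measurable (A w) by apply: phys_meas.
have [mW PW] : (forall w, measurable (W @^-1` [set w])) /\
    (forall w, Pr (W @^-1` [set w]) = (M%:R^-1)%:E).
  by split=> w; case: (message_law setup w).
apply: (@le_trans _ _ (\sum_(w : 'I_M) Pr (A w `&` W @^-1` [set w]))).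
  apply: union_bound => // [w|t Bt]; first exact: measurableI.
  by exists (W t) => //; split=> //; exact: BA.
have per w : (Pr (A w `&` W @^-1` [set w]) <= (p * M%:R^-1)%:E)%E.
  have dis i : physical i -> ~~ pred1 (inr true : index) i by case: i.
  have sW : <<s cylinders F (pred1 (inr true : index)) >> (W @^-1` [set w]).
    by apply: (cylinders_gen sourcesT (i := inr true)) => //=; exists [set w]; rewrite ?setTI.
  have -> := indep_sigma indF sources_measurable sourcesI sourcesT dis (sA w) sW.
  by rewrite PW EFinM lee_wpmul2r// lee_fin.
apply: (@le_trans _ _ (\sum_(w : 'I_M) (p * M%:R^-1)%:E)%E); first exact: lee_sum.
rewrite sumEFin lee_fin sumr_const card_ord -[leLHS]mulr_natr divfK//.
by rewrite pnatr_eq0 -lt0n.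
Qed.

Lemma misfits_measurable w l :
  measurable_fun [set: sg physical] (fun t => misfits L (sym w t) (enr t) l).
Proof.
apply: measurable_misfits => // k _; first exact: symbol_measurable.
exact: energy_measurable.
Qed.

Lemma mismatch_event_measurable (c : R) :
  measurable [set t | c <= (num_mismatch_events L En W X t)%:R].
Proof.
pose f t := (W t, [ffun k : 'I_n => be_input L (sym (W t) t) (enr t) k != X (W t) k t]).
have mf B : measurable (f @^-1` B).
  apply: measurable_finite_valued => -[w b].
  have -> : f @^-1` [set (w, b)] = W @^-1` [set w] `&`
      \bigcap_(k : 'I_n) [set t | (be_input L (sym w t) (enr t) k == X w k t) == ~~ b k].
    apply/seteqP; split => t /=.
      by case=> <- <-; split=> // k _ /=; rewrite ffunE negbK.
    case=> <- H; congr pair; apply/ffunP => k; rewrite ffunE.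
    by rewrite (eqP (H k I)) negbK.
  apply: measurableI; first exact: measurable_message.
  apply: fin_bigcap_measurable => // k _.
  have mb : measurable_fun setT (fun t => be_input L (sym w t) (enr t) k).
    by apply: measurable_be_input => // k'; exact: measurable_funP.
  have mx : measurable_fun setT (X w k) by exact: measurable_funP.
  have := measurable_fun_eqr mb mx measurableT (Y := [set ~~ b k]).
  rewrite setTI => /(_ I); congr measurable.
  by apply/seteqP; split => t /=; [move=> ->|move/eqP].
pose g (u : 'I_M * {ffun 'I_n -> bool}) : nat :=
  #|[pred l : 'I_(num_blocks L n) | [exists k, u.2 k && (k %/ L == l)%N]]|.
have -> : [set t | c <= (num_mismatch_events L En W X t)%:R] =
    f @^-1` [set u | c <= (g u)%:R].
  apply/seteqP; suff E0 t : num_mismatch_events L En W X t = g (f t).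
    by split => t /=; rewrite E0.
  apply: eq_card => l; rewrite !inE; apply: eq_existsb => k.
  by rewrite inE /= ffunE.
exact: mf.
Qed.

Lemma mismatch_events_tail (c p : R) (N : nat) : N%:R < c ->
  (forall w, (Pr [set t | N < misfits L (sym w t) (enr t) (num_blocks L n)]%N <= p%:E)%E) ->
  (Pr [set t | c <= (num_mismatch_events L En W X t)%:R]%R <= p%:E)%E.
Proof.
move=> Nc tail.
apply: (message_mixture (A := fun w =>
   [set t | (N < misfits L (sym w t) (enr t) (num_blocks L n))%N]) _ _ tail).
- exact: mismatch_event_measurable.
- move=> w; have := misfits_measurable w (num_blocks L n) measurableT (Y := [set m | (N < m)%N]).
  by rewrite setTI; exact.
- move=> t /= ct; apply: leq_trans (num_mismatch_le_misfits t).
  by rewrite -(ltr_nat R); exact: lt_le_trans ct.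
Qed.

(** * Decoding errors, feasibility and the tail of the misfits *)

Variable xi : R.
Hypothesis xi0 : 0 < xi.

Local Notation cb t := (fun v k => X v k t).

(** Covers every decoding error when w is sent, whatever the random guess turns out to be, and is an
    event of [physical] as [message_mixture] requires. *)
Definition decoding_failure (w : 'I_M) : set T :=
  [set t | (score S (cb t) (received w t) w < ln xi) ||
           [exists j, (j != w) && (ln xi <= score S (cb t) (received w t) j)]].

Lemma decoding_failure_measurable w : <<s cylinders F physical >> (decoding_failure w).
Proof.
have mj j : @measurable _ (sg physical) [set t | ln xi <= score S (cb t) (received w t) j].
  have := measurable_fun_ler (measurable_cst (ln xi)) (score_measurable w j) measurableT
    (Y := [set true]).
  by rewrite setTI; exact.
have -> : decoding_failure w = ~` [set t | ln xi <= score S (cb t) (received w t) w] `|`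
    \bigcup_(j in [set j | j != w]) [set t | ln xi <= score S (cb t) (received w t) j].
  apply/seteqP; split => t /=.
    case/orP => [|/existsP[j /andP[jw xj]]]; first by rewrite ltNge => /negP ?; left.
    by right; exists j.
  rewrite /decoding_failure/=; case=> [/negP|[j jw xj]]; first by rewrite -ltNge => ->.
  by apply/orP; right; apply/existsP; exists j; rewrite jw.
apply: (@measurableU _ (sg physical)); first exact: (@measurableC _ (sg physical)).
by apply: (@fin_bigcup_measurable _ (sg physical)) => // ; exact: finite_finset.
Qed.

Lemma decoding_errorE t :
  decoding_error (best_effort_code L n M S xi) En Z W (codebook_seed X D) t <->
  be_decode S xi (codebook_seed X D t) (received (W t) t) != W t.
Proof.
have <- : channel_output (best_effort_code L n M S xi) En Z W (codebook_seed X D) t =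
    received (W t) t; last by [].
apply/funext => k; congr (_ + _).
exact: (be_encodeE L (codebook_seed X D t) (W t) k (fun i => En i t)).
Qed.

Lemma decoding_error_failure t :
  decoding_error (best_effort_code L n M S xi) En Z W (codebook_seed X D) t ->
  decoding_failure (W t) t.
Proof.
rewrite decoding_errorE /decoding_failure/=; apply: contraNT.
rewrite negb_or -leNgt => /andP[xw /existsPn wrong].
have small i : i != W t -> (ln xi <= score S (cb t) (received (W t) t) i) = false.
  by move=> iw; have := wrong i; rewrite iw /= => /negbTE.
rewrite /be_decode /=; case: pickP => [j /andP[xj _]|/(_ (W t))] /=.
  by apply/eqP; apply: contraTeq xj => /small ->.
rewrite xw /= => /negbT/forallPn[i]; rewrite negb_imply => /andP[xi' iw].
by rewrite small in xi'.
Qed.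

Lemma decoding_error_measurable :
  measurable (decoding_error (best_effort_code L n M S xi) En Z W (codebook_seed X D)).
Proof.
pose f t := (W t, D t,
  [ffun j : 'I_M => ln xi <= score S (cb t) (received (W t) t) j]).
have mf B : measurable (f @^-1` B).
  apply: measurable_finite_valued => -[[w v] b].
  have -> : f @^-1` [set (w, v, b)] = (W @^-1` [set w] `&` D @^-1` [set v]) `&`
      \bigcap_(j : 'I_M) [set t | (ln xi <= score S (cb t) (received w t) j) == b j].
    apply/seteqP; split => t /=.
      by case=> <- <- <-; split=> // j _ /=; rewrite ffunE.
    case=> -[<- <-] H; congr pair; apply/ffunP => j; rewrite ffunE.
    exact: eqP (H j I).
  apply: measurableI.
    by apply: measurableI; [exact: measurable_message|exact: measurable_guess].
  apply: fin_bigcap_measurable => // j _.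
  have := measurable_fun_ler (measurable_cst (ln xi)) (score_measurableT w j) measurableT
    (Y := [set b j]).
  rewrite setTI => /(_ I); congr measurable.
  by apply/seteqP; split => t /=; [move=> ->|move/eqP].
pose g (u : 'I_M * 'I_M * {ffun 'I_M -> bool}) : 'I_M :=
  odflt u.1.2 [pick j | u.2 j && [forall i, u.2 i ==> (i == j)]].
have -> : decoding_error (best_effort_code L n M S xi) En Z W (codebook_seed X D) =
    f @^-1` [set u | g u != u.1.1].
  apply/seteqP; suff E0 t : be_decode S xi (codebook_seed X D t) (received (W t) t) = g (f t).
    by split => t; rewrite decoding_errorE E0.
  rewrite /be_decode /g /=; congr (odflt _ _); apply: eq_pick => j; rewrite ffunE.
  by congr (_ && _); apply: eq_forallb => i; rewrite ffunE.
exact: mf.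
Qed.

(** The five summands belong to five bad events: too many misfits, an oversized block, an
    unfavourable noise term, an atypical ideal score, a wrong codeword above the threshold. Outside
    the first four, [score_lower_bound] puts the score of w above ln xi. *)
Lemma decoding_failure_prob w (P x r p1 : R) (N : nat) :
  S <= P -> (4 <= n)%N -> 0 <= r -> 
  (Pr [set t | N < misfits L (sym w t) (enr t) (num_blocks L n)]%N <= p1%:E)%E ->
  ln xi <= n%:R / 2 * ln (1 + S) + sigma * (Num.sqrt n%:R * x)
           - N%:R * (2 * P * ln 2 * L%:R + 8 * P * ln n%:R) - r ->
  (Pr (decoding_failure w) <=
   (p1 + (n%:R^-1 + (expR (- r) + (Phi x + 32 * (1 + `|x|) / Num.sqrt n%:R
     + M.-1%:R / xi))))%:E)%E.
Proof.
set lam := 2 * P * _ * _ + _.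
move=> SP n4 r0 tail xiE; have n0 : (0 < n)%N by exact: leq_trans n4.
have P0 : 0 <= P by apply: le_trans SP; exact: ltW.
have lam0 : 0 <= lam.
  rewrite /lam addr_ge0// !mulr_ge0// ?ln_ge0//; last by rewrite ler1n.
  lra.
have phys_meas : <<s cylinders F physical >> `<=` measurable.
  apply: smallest_sub; first exact: sigma_algebra_measurable.
  exact: (cylinders_measurable sources_measurable).
have mle (f g : T -> R) : measurable_fun setT f -> measurable_fun setT g ->
    measurable [set t | f t <= g t].
  move=> mf mg; have := measurable_fun_ler mf mg measurableT (Y := [set true]).
  by rewrite setTI; exact.
have mlt (f g : T -> R) : measurable_fun setT f -> measurable_fun setT g ->
    measurable [set t | f t < g t].
  move=> mf mg; have := measurable_fun_ltr mf mg measurableT (Y := [set true]).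
  by rewrite setTI; exact.
pose A1 := [set t | N < misfits L (sym w t) (enr t) (num_blocks L n)]%N.
have mA1 : measurable A1.
  have := misfits_measurableT w (num_blocks L n) measurableT (Y := [set m | (N < m)%N]).
  by rewrite setTI; exact.
pose A2 := [set t | exists l : 'I_(num_blocks L n), lam < block_energy L (sym w t) l].
have mB l : measurable_fun setT (fun t => block_energy L (sym w t) l).
  by apply: measurable_block_energy => k _; exact: measurable_funP.
have mA2 : measurable A2.
  have -> : A2 = \bigcup_(l : 'I_(num_blocks L n)) [set t | lam < block_energy L (sym w t) l].
    by apply/seteqP; split => t [l]; [exists l|move=> _; exists l].
  apply: fin_bigcup_measurable; first exact: finite_finset.
  by move=> l _; apply: mlt.
pose loss t := \sum_(k < n) (- lost w t k * Z k t - (- lost w t k) ^+ 2 / 2).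
have mloss : measurable_fun setT loss.
  apply: measurable_sum => k.
  have ml : measurable_fun setT (fun t => - lost w t k).
    apply: measurableT_comp => //; apply: (sigma_ofW sources_measurable (J := predT)).
    exact: lost_measurable.
  apply: measurable_funB; last by apply: measurable_funM => //; exact: measurable_funX.
  by apply: measurable_funM.
pose A3 := [set t | r <= loss t].
have mA3 : measurable A3 by apply: mle.
pose A4 := [set t | \sum_(k < n) info_density (X w k t) (Z k t) < sigma * (Num.sqrt n%:R * x)].
have mA4 : measurable A4.
  by apply: mlt => //; apply: measurable_sum => k; apply: measurable_info_density.
pose A5 := [set t | [exists j, (j != w) && (ln xi <= score S (cb t) (received w t) j)]].
have mA5j j : measurable [set t | ln xi <= score S (cb t) (received w t) j].
  by apply: mle => //; exact: score_measurableT.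
have mA5 : measurable A5.
  have -> : A5 = \bigcup_(j in [set j | j != w]) [set t | ln xi <= score S (cb t) (received w t) j].
    apply/seteqP; split => t /=; first by move=> /existsP[j /andP[jw xj]]; exists j.
    by case=> j jw xj; apply/existsP; exists j; rewrite jw.
  by apply: fin_bigcup_measurable => //; exact: finite_finset.
have mF : measurable (decoding_failure w) by apply: phys_meas; exact: decoding_failure_measurable.
have sub : decoding_failure w `<=` A1 `|` (A2 `|` (A3 `|` (A4 `|` A5))).
  move=> t; rewrite /decoding_failure/= => /orP[xw|]; last by right; right; right; right.
  have [H1|H1] := boolP (N < misfits L (sym w t) (enr t) (num_blocks L n))%N; first by left.
  right; have [H2|H2] := pselect (A2 t); [by left|right].
  have [H3|H3] := leP r (loss t); [by left|right; left].
  rewrite /A4/= ltNge; apply/negP => H4; move: xw; rewrite ltNge => /negP; apply.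
  have Bl (l : 'I_(num_blocks L n)) : block_energy L (sym w t) l <= lam.
    by rewrite leNgt; apply/negP => ?; apply: H2; exists l.
  rewrite -leqNgt in H1.
  have := score_lower_bound r0 lam0 H1 Bl (ltW H3).
  apply: le_trans; apply: (le_trans xiE); lra.
have mU (B C : set T) : measurable B -> measurable C -> measurable (B `|` C).
  exact: measurableU.
apply: (le_trans (prob_le_add Pr mF mA1 (mU _ _ mA2 (mU _ _ mA3 (mU _ _ mA4 mA5))) sub)).
rewrite EFinD; apply: leeD => //.
apply: (le_trans (measureU2 Pr mA2 (mU _ _ mA3 (mU _ _ mA4 mA5)))).
rewrite EFinD; apply: leeD.
  apply: (@le_trans _ _ (\sum_(l < num_blocks L n)
      Pr [set t | lam < block_energy L (sym w t) l]%R)%E).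
    by apply: union_bound => // [l|t [l Bl]]; [apply: mlt|exists l].
  apply: (@le_trans _ _ (\sum_(l < num_blocks L n) ((n%:R ^+ 2)^-1)%:E)%E).
    by apply: lee_sum => l _; exact: block_energy_tail.
  rewrite sumEFin lee_fin sumr_const card_ord -[_ *+ num_blocks L n]mulr_natl.
  have nn : 0 < n%:R :> R by rewrite ltr0n.
  rewrite ler_pdivrMr ?exprn_gt0// expr2 mulKf ?gt_eqF// ler_nat.
  rewrite /num_blocks -(leq_pmul2r L0); apply: (leq_trans (leq_divM _ _)).
  by rewrite -{2}(prednK L0) mulnS leq_add2l leq_pmull.
apply: (le_trans (measureU2 Pr mA3 (mU _ _ mA4 mA5))).
rewrite EFinD; apply: leeD; first exact: noise_loss_tail.
apply: (le_trans (measureU2 Pr mA4 mA5)).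
rewrite EFinD; apply: leeD; first exact: info_density_cdf.
apply: (@le_trans _ _ (\sum_(j | j != w)
    Pr [set t | ln xi <= score S (cb t) (received w t) j]%R)%E).
  by apply: union_bound => // t /existsP[j /andP[jw xj]]; exists j.
apply: (@le_trans _ _ (\sum_(j | j != w) (xi^-1)%:E)%E).
  by apply: lee_sum => j jw; exact: wrong_codeword_tail.
rewrite sumEFin lee_fin sumr_const -[xi^-1 *+ _]mulr_natl.
by have := cardC1 w; rewrite card_ord => ->.
Qed.

Lemma decoding_error_prob (p : R) :
  (forall w, (Pr (decoding_failure w) <= p%:E)%E) ->
  (Pr (decoding_error (best_effort_code L n M S xi) En Z W (codebook_seed X D)) <= p%:E)%E.
Proof.
move=> fp; apply: (message_mixture decoding_error_measurable decoding_failure_measurable fp).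
exact: decoding_error_failure.
Qed.

(** The constraint holds pathwise for non-negative energies. In the setup their sign is known only
    through their law, so almost surely. *)
Lemma best_effort_feasible : (forall q, 0 <= E q) ->
  energy_feasible Pr (best_effort_code L n M S xi) En W (codebook_seed X D).
Proof.
move=> E0.
have ge0 k : {ae Pr, forall t, 0 <= En k t}.
  have mneg : measurable (`]-oo, (0 : R)[ : set R) by exact: measurable_itv.
  exists (En (k %/ L * L)%N @^-1` `]-oo, 0[); split.
  - by rewrite -[X in measurable X]setTI; exact: measurable_funP.
  - have := energy_law setup (k %/ L) mneg; rewrite /distribution /pushforward => ->.
    rewrite (_ : E @^-1` _ = set0) ?measure0//.
    by apply/seteqP; split => // q /=; rewrite in_itv/= ltNge E0.
  - by move=> t /= /negP; rewrite in_itv/= (energy_block setup) -ltNge.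
apply: filterS (ae_foralln ge0) => t e0 k.
have cE i : channel_input (best_effort_code L n M S xi) En W (codebook_seed X D) t i =
    be_input L (sym (W t) t) (enr t) i.
  exact: (be_encodeE L (codebook_seed X D t) (W t) i (fun i => En i t)).
rewrite (eq_bigr (fun i => be_input L (sym (W t) t) (enr t) i ^+ 2)); last first.
  by move=> i _; rewrite cE.
exact: be_input_energy.
Qed.

(** An instance of [misfits_tail]: a = y / L, theta = exp (y S), which is a lower bound for the
    moment generating function of a block, and C = 1 / (1 - y P), which comes from exp (- z) >= 1 -
    z. *)
Lemma misfits_prob w (P m2 y eps : R) (N : nat) :
  (forall q, 0 <= E q) -> ('E_Q[E] = P%:E)%E ->
  ('E_Q[(fun q => (E q ^+ 2)%R)] = m2%:E)%E ->
  S <= P -> 0 < y -> y * P <= 1 / 8 ->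
  (let x := y * P - y ^+ 2 * m2 / 2 in
   0 <= x <= 1 /\ y * S + 3 / 2 * y ^+ 2 * S ^+ 2 / L%:R <= x + x ^+ 2 / 4) ->
  (0 < N)%N -> (1 - y * P)^-1 * (expR (y * S))^-1 ^+ N.-1 <= eps ->
  (Pr [set t | N < misfits L (sym w t) (enr t) (num_blocks L n)]%N <= eps%:E)%E.
Proof.
move=> E0 meanE momE SP y0 yP; set x := _ - _ / 2 => -[x01 drift] N0 epsN.
apply: (@le_trans _ _ ((1 - y * P)^-1 * (expR (y * S))^-1 ^+ N.-1)%:E); last by rewrite lee_fin.
have L0R : 0 < L%:R :> R by rewrite ltr0n.
have L1R : 1 <= L%:R :> R by rewrite ler1n.
have L_neq0 : L%:R != 0 :> R by rewrite gt_eqF.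
pose z := y / L%:R * S.
have yS : 0 < y * S by rewrite mulr_gt0.
have zE : L%:R * z = y * S by rewrite /z; field.
have z0 : 0 < z by rewrite mulr_gt0// divr_gt0.
have z8 : z <= 1 / 8.
  apply: (@le_trans _ _ (y * S)); first by rewrite -zE ler_peMl// ltW.
  by apply: le_trans yP; rewrite ler_pM2l.
have z2 : 2 * (y / L%:R) * S = 2 * z by rewrite -mulrA.
have z12 : 2 * (y / L%:R) * S < 1 by rewrite z2; lra.
have yE q : y / L%:R * (L%:R * E q) = y * E q by rewrite mulrA divfK.
have mgfE : (\int[Q]_q (expR (- (y / L%:R * (L%:R * E q))))%:E =
    \int[Q]_q (expR (- (y * E q)))%:E)%E.
  by apply: eq_integral => q _; rewrite yE.
have s0 : 0 < Num.sqrt (1 - 2 * z) by rewrite sqrtr_gt0; lra.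
have H := @misfits_tail w (y / L%:R) (expR (y * S)) (1 - y * P)^-1 N.-1 E0.
rewrite (prednK N0) mgfE z2 in H; apply: H.
- by rewrite divr_ge0 ?ltW.
- exact: expR_gt0.
- by rewrite invr_ge0; lra.
- lra.
- rewrite -zE expRM_natl; apply: lerXn2r; rewrite ?nnegrE ?expR_ge0 ?invr_ge0 ?(ltW s0)//.
  rewrite -[leLHS]invrK -expRN lef_pV2 ?posrE ?expR_gt0//.
  have e2 : 1 - 2 * z <= expR (- z) ^+ 2.
    by rewrite -expRM_natl; have := expR_ge1Dx (2 * - z); lra.
  apply: (@le_trans _ _ (Num.sqrt (expR (- z) ^+ 2))); first by rewrite ler_sqrt// sqr_ge0.
  by rewrite sqrtr_sqr ger0_norm// expR_ge0.
- have mgf1 : (\int[Q]_q (expR (- (y * E q)))%:E <= (expR (- (x + x ^+ 2 / 4)))%:E)%E.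
    apply: (le_trans (energy_mgf_le E0 meanE momE (ltW y0))).
    by rewrite lee_fin; exact: onem_le_expR.
  apply: (@le_trans _ _ ((expR (- (x + x ^+ 2 / 4)))%:E * (expR (L%:R * (z + 3 / 2 * z ^+ 2)))%:E)%E).
    apply: lee_pmul => //.
    + by apply: integral_ge0 => q _; rewrite lee_fin expR_ge0.
    + rewrite lee_fin expRM_natl; apply: lerXn2r; rewrite ?nnegrE ?expR_ge0 ?invr_ge0 ?(ltW s0)//.
      by apply: sqrt_mgf_le; rewrite gtr0_norm.
  rewrite -EFinM -expRD lee_fin -[leRHS]expR0 ler_expR.
  have -> : L%:R * (z + 3 / 2 * z ^+ 2) = y * S + 3 / 2 * y ^+ 2 * S ^+ 2 / L%:R.
    by rewrite /z; field.
  lra.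
- have yP1 : 0 < 1 - y * P by lra.
  apply: (@le_trans _ _ ((1 - y * P)^-1%:E * (1 - y * P)%:E)%E).
    by rewrite -EFinM mulVf// gt_eqF.
  apply: lee_wpmul2l; first by rewrite lee_fin invr_ge0 ltW.
  exact: (energy_mgf_ge E0 meanE (ltW y0)).
Qed.

End setup_analysis.

(** * Performance of the code *)

(** Non-asymptotic: every requirement that n be large is an explicit inequality, left to the final
    theorem. *)
Lemma best_effort_performance (R : realType) (d0 : measure_display)
    (T0 : measurableType d0) (Q : probability T0 R) (E : {RV Q >-> R})
    (P m2 eps1 eps2 k : R) (L n : nat) :
  (forall t, 0 <= E t) -> 0 < P -> ('E_Q[E] = P%:E)%E ->
  ('E_Q[(fun t => (E t ^+ 2)%R)] = m2%:E)%E -> 0 < eps2 < 1 ->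
  (0 < L)%N -> (4 <= n)%N -> 0 < k ->
  (forall eta, 0 < eta <= 1 -> Phi (Phi_inv eps1 - eta) + k * eta <= eps1) ->
  (67 + 32 * `|Phi_inv eps1|) / k <= Num.sqrt n%:R ->
  rho P m2 eps2 L n <= 1 / 32 ->
  rho P m2 eps2 L n * (16 + 4 * ln (1 / eps2)) <=
    ln (1 / eps2) * (P ^+ 2 / (8 * (m2 + 3 * P ^+ 2))) ->
  rho_upper P m2 eps2 + 63 * ln (1 / eps2) * lambda_constant P <=
    gamma P m2 eps2 L n * slack_constant P / 2 ->
  Num.sqrt n%:R * (2 * `|Phi_inv eps1| + 1) <=
    gamma P m2 eps2 L n * slack_constant P * growth L n / 2 ->
  exists (M : nat) (xi : R),
    [/\ (0 < M)%N, 0 < xi, rate_lower_bound P m2 eps2 L n eps1 1 <= ln M%:R / n%:R &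
     forall (d : measure_display) (T : measurableType d)
       (Pr : probability T R) (En Z : nat -> {RV Pr >-> R})
       (W : T -> 'I_M) (X : 'I_M -> 'I_n -> {RV Pr >-> R}) (D : T -> 'I_M),
       best_effort_setup L (Svar P m2 eps2 L n) En Z W X D (distribution Q E) ->
       is_eps_eh_code Pr (best_effort_code L n M (Svar P m2 eps2 L n) xi)
         En Z W (codebook_seed X D) (eps1 + eps2) /\
       (Pr [set t | (gamma P m2 eps2 L n + 1
          <= (num_mismatch_events L En W X t)%:R)%R] <= eps2%:E)%E].
Proof.
move=> E0 P0 meanE momE eps2_itv L0 n4 k0 Phik nk r32 rsmall c5 ct.
have n0 : (0 < n)%N by exact: leq_trans n4.
have Pm2 := sqr_mean_le E0 meanE momE (ltW P0).
have l20 := ln_inv_gt0 eps2_itv; have /andP[eps20 _] := eps2_itv.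
have l1 : 1 <= L%:R :> R by rewrite ler1n.
have nR : 0 < n%:R :> R by rewrite ltr0n.
have nR4 : 4 <= n%:R :> R by rewrite ler_nat.
have sn0 : 0 < Num.sqrt n%:R :> R by rewrite sqrtr_gt0.
have sn2 : Num.sqrt n%:R ^+ 2 = n%:R :> R by rewrite sqr_sqrtr// ltW.
have r0 := rho_gt0 P0 Pm2 eps2_itv L0 n0.
set S := Svar P m2 eps2 L n; set g := gamma P m2 eps2 L n in c5 ct *.
set t := Phi_inv eps1 in Phik nk ct *.
have S0 : 0 < S by rewrite /S /Svar mulr_gt0//; lra.
have SP : S <= P by rewrite /S /Svar; nra.
(* In units of 1 / sqrt n: 3 for an oversized block, the noise term and the wrong codewords, and 32
   (2 + |t|) for the cdf error at t - eta. The choice of eta below makes k eta equal to their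
   sum. *)
pose c := 67 + 32 * `|t|.
have c0 : 0 < c by rewrite /c; have := normr_ge0 t; lra.
pose eta := c / k / Num.sqrt n%:R.
have eta0 : 0 < eta by rewrite !divr_gt0.
have eta1 : eta <= 1 by rewrite /eta ler_pdivrMr// mul1r.
have g1 : 1 <= g := gamma_ge1 P0 Pm2 l20 l1 r0 r32 rsmall.
(* Rounding down keeps the score penalty N Lam below gamma Lam; N > gamma - 1 is what the tail of
   the misfits needs. *)
pose N := Num.truncn g.
have /andP[Ng gN] : N%:R <= g < N.+1%:R by apply: truncn_itv; lra.
have N0 : (0 < N)%N by rewrite /N truncn_gt0.
pose Lam := 2 * P * ln 2 * L%:R + 8 * P * ln n%:R.
have lnn : 0 <= ln n%:R :> R by rewrite ln_ge0// ler1n.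
have Lam0 : 0 <= Lam.
  by rewrite /Lam addr_ge0// !mulr_ge0 ?ln_ge0 ?ler1n// ltW.
(* The last term is the allowance r = ln n / 2 for the noise, whose failure probability is exp (- r)
   = 1 / sqrt n. *)
pose lxi := n%:R / 2 * ln (1 + S) + Num.sqrt (S / (S + 1)) * (Num.sqrt n%:R * (t - eta))
  - N%:R * Lam - ln n%:R / 2.
pose xi := expR lxi.
have xi0 : 0 < xi by exact: expR_gt0.
(* M - 1 <= xi / sqrt n makes the wrong codewords contribute at most 1 / sqrt n, and M > xi / sqrt n
   costs another ln n / 2, which completes the ln n of [rate_bound_ge]. *)
pose M := (Num.truncn (xi / Num.sqrt n%:R)).+1.
have /andP[Mx xM] : (M.-1)%:R <= xi / Num.sqrt n%:R < M%:R.
  by apply: truncn_itv; rewrite divr_ge0 ?ltW.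
exists M, xi; split => //.
- rewrite ler_pdivlMr// mulrC.
  apply: (le_trans (rate_bound_ge P0 Pm2 eps2_itv L0 n0 r32 (erefl _) _ c5 ct (eta := eta))).
    by rewrite (ltW eta0).
  have : ln (xi / Num.sqrt n%:R) <= ln M%:R by rewrite ler_ln ?posrE ?divr_gt0// ltW.
  apply: le_trans; rewrite ln_div ?posrE// expRK.
  have -> : ln (Num.sqrt n%:R) = ln n%:R / 2 :> R.
    by rewrite -[in RHS]sn2 lnXn// -[X in X / 2]mulr_natr mulfK.
  rewrite -/S -/g -/t -/Lam /lxi.
  have := ler_wpM2r Lam0 Ng; lra.
move=> d T Pr En Z W X D setup.
pose dl := P ^+ 2 / (8 * (m2 + 3 * P ^+ 2)).
pose y := (1 + dl) * (L%:R * alpha P m2 eps2 L n).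
have y0 : 0 < y := tilt_gt0 P0 Pm2 l1 r0.
have [yP _] := tilt_le P0 Pm2 l1 r0.
have tail w : (Pr [set t | N < misfits L (fun k => X w k t) (fun k => En k t)
    (num_blocks L n)]%N <= eps2%:E)%E.
  apply: (misfits_prob setup L0 S0 w (P := P) (m2 := m2) (y := y)) => //.
  - by apply: (le_trans yP); lra.
  - have td := tilt_drift P0 Pm2 l20 l1 r0 r32.
    exact: td.
  - have -> : eps2 = expR (- ln (1 / eps2)).
      by rewrite div1r lnV ?posrE// opprK lnK ?posrE.
    apply: (mismatch_tail_constant P0 Pm2 l20 l1 r0 r32 rsmall N0).
    by rewrite lerBlDr natr1 ltW.
split; last first.
  apply: (mismatch_events_tail setup L0 (N := N) _ tail).
  by apply: (le_lt_trans Ng); rewrite ltrDl.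
split; first exact: (best_effort_feasible setup).
have sqn_gt : Num.sqrt n%:R <= n%:R :> R.
  by rewrite -[leRHS]sn2 expr2 ler_peMl ?(ltW sn0)//; nra.
apply: (decoding_error_prob setup L0 S0) => w.
have xiE : ln xi <= n%:R / 2 * ln (1 + S)
    + Num.sqrt (S / (S + 1)) * (Num.sqrt n%:R * (t - eta)) - N%:R * Lam - ln n%:R / 2.
  by rewrite expRK.
have r20 : 0 <= ln n%:R / 2 :> R by rewrite divr_ge0.
apply: (le_trans (decoding_failure_prob setup L0 S0 xi0 SP n4 r20 (tail w) xiE)).
rewrite lee_fin.
have e1 : n%:R^-1 <= (Num.sqrt n%:R)^-1 :> R by rewrite lef_pV2.
have e2 : expR (- (ln n%:R / 2)) = (Num.sqrt n%:R)^-1 :> R.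
  rewrite expRN; congr (_^-1).
  rewrite -[in LHS]sn2 lnXn// -[X in X / 2]mulr_natr mulfK// lnK//.
have e3 : M.-1%:R / xi <= (Num.sqrt n%:R)^-1.
  by rewrite ler_pdivrMr// mulrC.
have e4 : 32 * (1 + `|t - eta|) / Num.sqrt n%:R <= 32 * (2 + `|t|) / Num.sqrt n%:R.
  apply: ler_wpM2r; first by rewrite invr_ge0 ltW.
  have := ler_normB t eta; rewrite (gtr0_norm eta0); lra.
have e5 := Phik eta; rewrite eta0 eta1 in e5.
have e6 : k * eta = c / Num.sqrt n%:R by rewrite /eta; field; rewrite !gt_eqF.
have e7 : c / Num.sqrt n%:R = 3 / Num.sqrt n%:R + 32 * (2 + `|t|) / Num.sqrt n%:R.
  by rewrite /c; field; rewrite gt_eqF.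
rewrite e2; have := e5 isT; rewrite e6 e7; move: e1 e3 e4.
set a := 32 * (1 + _) / _; set b := 32 * (2 + _) / _; set s := (Num.sqrt _)^-1.
lra.
Qed.

(** * Asymptotic orders and the conditions for large n *)

Section eventual_growth.
Context {R : realType}.

Lemma ln_le_sqrt (n : nat) : (0 < n)%N -> ln n%:R <= 2 * Num.sqrt n%:R :> R.
Proof.
move=> n0; have nR : 0 < n%:R :> R by rewrite ltr0n.
have s0 : 0 < Num.sqrt n%:R :> R by rewrite sqrtr_gt0.
rewrite -[in leLHS](sqr_sqrtr (ltW nR)) lnXn// -[_ *+ 2]mulr_natl ler_wpM2l//.
exact: ltW (ln_sublinear s0).
Qed.

(** Sublinearity of the block length handles the part L n / n of [growth], and ln n <= 2 sqrt n the
    other part. *)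
Lemma growth_eventually (L : nat -> nat) (e K : R) : 0 < e ->
  ((L n)%:R / n%:R : R) @[n --> \oo] --> (0 : R) ->
  \forall n \near \oo, [/\ (4 <= n)%N, Num.sqrt (growth (L n) n / n%:R) <= e,
    K <= ln n%:R & K <= Num.sqrt n%:R].
Proof.
move=> e0 /cvgr0Pnorm_le Lim; have e20 : 0 < e ^+ 2 by rewrite exprn_gt0.
have L1 := Lim _ e20.
near=> n.
have n4 : (4 <= n)%N by near: n; exact: nbhs_infty_ge.
have nR : 0 < n%:R :> R by rewrite ltr0n (leq_trans _ n4).
have s0 : 0 < Num.sqrt n%:R :> R by rewrite sqrtr_gt0.
have s2 : Num.sqrt n%:R ^+ 2 = n%:R :> R by rewrite sqr_sqrtr// ltW.
have big : (2 / e ^+ 2) ^+ 2 <= n%:R by near: n; exact: nbhs_infty_ger.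
have bigK : `|K| ^+ 2 <= n%:R by near: n; exact: nbhs_infty_ger.
have expK : expR K <= n%:R by near: n; exact: nbhs_infty_ger.
split => //.
- rewrite -[leRHS]gtr0_norm// -sqrtr_sqr ler_sqrt ?(ltW e20)//.
  rewrite ler_pdivrMr// /growth ge_max; apply/andP; split; last first.
    rewrite -ler_pdivrMr//; apply: le_trans (ler_norm _) _.
    by near: n.
  apply: (le_trans (ln_le_sqrt _)); first exact: leq_trans n4.
  have : 2 / e ^+ 2 <= Num.sqrt n%:R.
    have d0 : 0 <= 2 / e ^+ 2 by apply: ltW; exact: divr_gt0.
    by rewrite -(@ler_pXn2r _ 2) ?nnegrE ?sqrtr_ge0// s2.
  rewrite ler_pdivrMr// -{3}s2 => h; have := ler_wpM2l (ltW s0) h; lra.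
- by rewrite -ler_expR lnK// posrE.
- apply: (le_trans (ler_norm K)).
  by rewrite -(@ler_pXn2r _ 2) ?nnegrE ?sqrtr_ge0// s2.
Unshelve. all: by end_near.
Qed.

Lemma Theta_posI (f g : nat -> R) (a b : R) : 0 < a -> 0 < b ->
  (\forall n \near \oo, 0 < g n /\ a * g n <= f n <= b * g n) -> Theta_pos f g.
Proof.
move=> a0 b0 fg; split.
  apply: filterS fg => n [g0 /andP[agf _]].
  by apply: lt_le_trans agf; rewrite mulr_gt0.
rewrite eqThetaE qualifE; apply/asboolP; exists (a, b); first by rewrite a0 b0.
apply: filterS fg => n [g0 /andP[agf fbg]].
rewrite !gtr0_norm//; apply: lt_le_trans agf; exact: mulr_gt0.
Qed.

End eventual_growth.

Theorem corollary9 (R : realType)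
    (d0 : measure_display) (T0 : measurableType d0) (Q : probability T0 R)
    (E : {RV Q >-> R}) (P m2 eps eps1 eps2 : R)
    (E_ge0 : forall t, 0 <= E t)
    (P_gt0 : 0 < P)
    (E_mean : ('E_Q[E] = P%:E)%E)
    (E_m2 : ('E_Q[(fun t => (E t ^+ 2)%R)] = m2%:E)%E)
    (eps_itv : 0 < eps < 1 / 2)
    (eps1_gt0 : 0 < eps1) (eps2_gt0 : 0 < eps2) (eps12 : eps1 + eps2 = eps) :
  exists2 kappa : R, 0 < kappa &
  forall L : nat -> nat,
    (forall n, (0 < n)%N -> (0 < L n <= n)%N) ->
    ((L n)%:R / n%:R : R) @[n --> \oo] --> (0 : R) ->
  [/\ Theta_pos (fun n => rho P m2 eps2 (L n) n)
        (fun n => Num.sqrt (Num.max (ln n%:R) (L n)%:R / n%:R)),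
      Theta_pos (fun n => P - Svar P m2 eps2 (L n) n)
        (fun n => Num.sqrt (Num.max (ln n%:R) (L n)%:R / n%:R)),
      Theta_pos (fun n => gamma P m2 eps2 (L n) n)
        (fun n => Num.sqrt (n%:R / Num.max (ln n%:R) (L n)%:R)) &
      \forall n \near \oo,
        0 < Svar P m2 eps2 (L n) n < P /\
        exists (M : nat) (xi : R),
          [/\ (0 < M)%N, 0 < xi,
              rate_lower_bound P m2 eps2 (L n) n eps1 kappa
                <= ln M%:R / n%:R &
              forall (d : measure_display) (T : measurableType d)
                (Pr : probability T R) (En Z : nat -> {RV Pr >-> R})
                (W : T -> 'I_M) (X : 'I_M -> 'I_n -> {RV Pr >-> R})
                (D : T -> 'I_M),
                best_effort_setup (L n) (Svar P m2 eps2 (L n) n)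
                  En Z W X D (distribution Q E) ->
                is_eps_eh_code Pr
                  (best_effort_code (L n) n M (Svar P m2 eps2 (L n) n) xi)
                  En Z W (codebook_seed X D) eps /\
                (Pr [set t | (gamma P m2 eps2 (L n) n + 1
                     <= (num_mismatch_events (L n) En W X t)%:R)%R]
                   <= eps2%:E)%E]].
Proof.
exists 1 => // L Lpos Lsub.
have Pm2 := sqr_mean_le E_ge0 E_mean E_m2 (ltW P_gt0).
have e2 : 0 < eps2 < 1 by rewrite eps2_gt0/=; case/andP: eps_itv => *; lra.
have l20 := ln_inv_gt0 e2.
have m20 : 0 < m2 by apply: lt_le_trans Pm2; rewrite exprn_gt0.
have P20 : 0 < P ^+ 2 by rewrite exprn_gt0.
have w0 : 0 < m2 + 3 * P ^+ 2 by lra.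
have c10 := slack_constant_gt0 P_gt0; have c20 := lambda_constant_gt0 P_gt0.
have k10 := rho_lower_gt0 P_gt0 Pm2 e2; have k20 := rho_upper_gt0 P_gt0 Pm2 e2.
pose q n : R := Num.sqrt (growth (L n) n / n%:R).
have [k k0 Phik] := Phi_inv_below eps1_gt0.
pose s1 := Num.sqrt (rho_lower P m2 eps2); pose s2 := Num.sqrt (rho_upper P m2 eps2).
have s10 : 0 < s1 by rewrite sqrtr_gt0.
have s20 : 0 < s2 by rewrite sqrtr_gt0.
set l2 := ln (1 / eps2) in l20.
pose c1 := slack_constant P; rewrite -/c1 in c10.
pose c5 := rho_upper P m2 eps2 + 63 * l2 * lambda_constant P.
have c50 : 0 < c5 by rewrite addr_gt0// !mulr_gt0.
pose dl := P ^+ 2 / (8 * (m2 + 3 * P ^+ 2)).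
have dl0 : 0 < dl by rewrite divr_gt0// mulr_gt0.
(* Three thresholds for rho: the range of the elementary estimates, the condition under which the
   tilt surplus covers the losses, and, through gamma >= l2 / (4 rho), the condition c5 <= gamma c1
   / 2. *)
pose r0 := Num.min (1 / 32) (Num.min (l2 * dl / (16 + 4 * l2)) (l2 * c1 / (8 * c5))).
have d160 : 0 < 16 + 4 * l2 by lra.
have r00 : 0 < r0.
  by rewrite /r0 !lt_min; apply/and3P; split; apply: divr_gt0 => //; exact: mulr_gt0.
pose t := Phi_inv eps1.
(* With gamma >= l2 / (4 s2 q) and q sqrt n = sqrt growth, the remaining condition on the terms of
   order sqrt n reads K1 <= sqrt growth. It follows from K1^2 <= ln n, as [growth] dominates ln
   n. *)
pose K1 := (2 * `|t| + 1) * (8 * s2 / (c1 * l2)).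
pose K := Num.max ((67 + 32 * `|t|) / k) (K1 ^+ 2).
have ev := growth_eventually K (divr_gt0 r00 s20) Lsub.
have common : \forall n \near \oo, [/\ (4 <= n)%N, (0 < L n)%N,
    K <= ln n%:R, K <= Num.sqrt n%:R & [/\ 0 < q n, s1 * q n <= rho P m2 eps2 (L n) n <= s2 * q n
    & rho P m2 eps2 (L n) n <= r0]].
  apply: filterS ev => n [n4 qe Kl Ks].
  have n0 : (0 < n)%N by exact: leq_trans n4.
  have /andP[Ln _] := Lpos n n0.
  have /andP[h1 h2] := rho_itv P_gt0 Pm2 e2 Ln n0.
  split => //; split.
  - rewrite sqrtr_gt0 divr_gt0 ?ltr0n//.
    by apply: lt_le_trans (growth_ge1 n Ln).
  - by rewrite h1.
  - by apply: (le_trans h2); rewrite mulrC -ler_pdivlMr.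
have r0r (r : R) : r <= r0 -> [/\ r <= 1 / 32, r * (16 + 4 * l2) <= l2 * dl &
    r * (8 * c5) <= l2 * c1].
  by rewrite /r0 !le_min => /and3P[a b c]; split; rewrite -?ler_pdivlMr// mulr_gt0.
have gb n : (4 <= n)%N -> (0 < L n)%N -> rho P m2 eps2 (L n) n <= r0 ->
    l2 / (4 * rho P m2 eps2 (L n) n) <= gamma P m2 eps2 (L n) n <=
    32 * l2 * (m2 + 3 * P ^+ 2) / (P ^+ 2 * rho P m2 eps2 (L n) n).
  move=> n4 Ln rr; have n0 : (0 < n)%N by exact: leq_trans n4.
  have rp := rho_gt0 P_gt0 Pm2 e2 Ln n0.
  have [r32 _ _] := r0r _ rr.
  have l1 : 1 <= (L n)%:R :> R by rewrite ler1n.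
  apply/andP; split; first exact: (gamma_ge P_gt0 Pm2 l20 l1 rp r32).
  exact: (gamma_le P_gt0 Pm2 l20 l1 rp r32).
have div_le (c a b : R) : 0 < c -> 0 < a -> a <= b -> c / b <= c / a.
  by move=> cp ap ab; rewrite ler_pM2l// lef_pV2 ?posrE// (lt_le_trans ap).
split.
- apply: (Theta_posI s10 s20); apply: filterS common => n [_ _ _ _ [q0 h _]].
  by split.
- apply: (Theta_posI (mulr_gt0 P_gt0 s10) (mulr_gt0 P_gt0 s20)).
  apply: filterS common => n [_ _ _ _ [q0 /andP[h1 h2] _]]; split => //.
  have -> : P - Svar P m2 eps2 (L n) n = P * rho P m2 eps2 (L n) n by rewrite /Svar; ring.
  by rewrite -!mulrA !ler_pM2l// h1.
- apply: (Theta_posI (a := l2 / (4 * s2)) (b := 32 * l2 * (m2 + 3 * P ^+ 2) / (P ^+ 2 * s1))).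
  + by rewrite divr_gt0// mulr_gt0.
  + by rewrite divr_gt0// !mulr_gt0.
  apply: filterS common => n [n4 Ln _ _ [q0 /andP[h1 h2] rr]].
  have /andP[g1 g2] := gb n n4 Ln rr.
  have n0 : (0 < n)%N by exact: leq_trans n4.
  have rp := rho_gt0 P_gt0 Pm2 e2 Ln n0.
  have -> : Num.sqrt (n%:R / Num.max (ln n%:R) (L n)%:R) = (q n)^-1.
    by rewrite -invf_div -sqrtrV// divr_ge0// (le_trans _ (growth_ge1 n Ln)).
  split; first by rewrite invr_gt0.
  apply/andP; split.
    apply: le_trans g1; rewrite -mulrA -invfM -mulrA.
    by apply: div_le => //; [exact: mulr_gt0|rewrite ler_pM2l].
  apply: (le_trans g2); rewrite -[leRHS]mulrA -invfM -[P ^+ 2 * s1 * _]mulrA.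
  apply: div_le; [by rewrite !mulr_gt0|by rewrite !mulr_gt0|by rewrite ler_pM2l].
apply: filterS common => n [n4 Ln Kl Ks [q0 /andP[h1 h2] rr]].
have n0 : (0 < n)%N by exact: leq_trans n4.
have rp := rho_gt0 P_gt0 Pm2 e2 Ln n0.
have [r32 rs rc] := r0r _ rr.
have /andP[g1 _] := gb n n4 Ln rr.
have mx1 := growth_ge1 n Ln : 1 <= growth (L n) n :> R.
have nR : 0 < n%:R :> R by rewrite ltr0n.
have mx0 : 0 < growth (L n) n :> R by apply: lt_le_trans mx1.
split.
  apply/andP; split; rewrite /Svar; first by rewrite mulr_gt0//; lra.
  by rewrite gtr_pMr//; lra.
rewrite -eps12; apply: (best_effort_performance E_ge0 P_gt0 E_mean E_m2 e2 Ln n4 k0 Phik) => //.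
- by apply: le_trans Ks; rewrite /K le_max lexx.
- rewrite -/c1 -/l2 -/c5; apply: (@le_trans _ _ (l2 / (4 * rho P m2 eps2 (L n) n) * c1 / 2)).
    have -> : l2 / (4 * rho P m2 eps2 (L n) n) * c1 / 2 = l2 * c1 / (8 * rho P m2 eps2 (L n) n).
      by field; rewrite gt_eqF.
    rewrite ler_pdivlMr; last exact: mulr_gt0.
    by rewrite mulrA mulrC [c5 * 8]mulrC.
  apply: ler_wpM2r; first by rewrite invr_ge0.
  by apply: ler_wpM2r g1; exact: ltW.
- rewrite -/c1 -/t.
  have qE : q n * Num.sqrt n%:R = Num.sqrt (growth (L n) n).
    by rewrite -sqrtrM ?divr_ge0 ?ltW// divfK// gt_eqF.
  have mxE : growth (L n) n = Num.sqrt (growth (L n) n) ^+ 2 :> R by rewrite sqr_sqrtr// ltW.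
  have sm0 : 0 < Num.sqrt (growth (L n) n) :> R by rewrite sqrtr_gt0.
  have K1s : K1 <= Num.sqrt (growth (L n) n).
    have K10 : 0 <= K1 by rewrite mulr_ge0 ?divr_ge0 ?addr_ge0 ?mulr_ge0// ltW.
    rewrite -(@ler_pXn2r _ 2) ?nnegrE ?sqrtr_ge0// -mxE.
    by apply: le_trans (le_trans _ Kl) _; rewrite ?le_max ?lexx ?orbT.
  have g3 : l2 / (4 * (s2 * q n)) <= gamma P m2 eps2 (L n) n.
    by apply: le_trans g1; apply: div_le => //; [exact: mulr_gt0|rewrite ler_pM2l].
  apply: (@le_trans _ _ (l2 / (4 * (s2 * q n)) * c1 * growth (L n) n / 2)); last first.
    apply: ler_wpM2r; first by rewrite invr_ge0.
    apply: ler_wpM2r; first exact: ltW.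
    by apply: ler_wpM2r g3; exact: ltW.
  have -> : l2 / (4 * (s2 * q n)) * c1 * growth (L n) n / 2 =
      Num.sqrt n%:R * (Num.sqrt (growth (L n) n) / (8 * s2 / (c1 * l2))).
    rewrite {1}mxE -qE; field; rewrite !gt_eqF//.
  apply: ler_wpM2l; first exact: sqrtr_ge0.
  by rewrite ler_pdivlMr// divr_gt0 ?mulr_gt0.
Qed.
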